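(* Fix a positive integer $m$. For a prime $p$, let $N_1^m$ be the number of zero-sum-free sequences $A$ of $\mathbb{Z}_p$ with $m(A)\le m$. Then, as $p\to\infty$, $$N_1^m=\exp\Big(\Big(\sqrt{\big(1-\tfrac{1}{m+1}\big)\tfrac{2}{3}}\,\pi+o(1)\Big)\sqrt{p}\Big).$$
   Context: $\mathbb{Z}_p$ is the cyclic group of prime order $p$. A sequence is a finite multiset of elements of $\mathbb{Z}_p$ (sequences are counted as multisets); $m(A)$ is its maximum multiplicity. $A$ is zero-sum-free if no non-empty subsequence (sub-multiset) of $A$ has sum $0$ in $\mathbb{Z}_p$. *)

(* Defs.v *)
From HB Require Import structures.
From mathcomp Require Import all_boot all_order all_algebra.
From mathcomp Require Import finmap multiset.
From mathcomp Require Import all_classical all_reals all_analysis.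
Set Implicit Arguments.
Unset Strict Implicit.
Unset Printing Implicit Defensive.
Import Order.TTheory GRing.Theory Num.Theory.
Import numFieldNormedType.Exports.
Local Open Scope classical_set_scope.
Local Open Scope ring_scope.

(* Meant for 1 < p only: 'Z_0 and 'Z_1 both denote the integers mod 2. *)
Notation zseq p := {mset 'Z_p}%mset.

Definition max_mult (p : nat) (A : zseq p) : nat := (\max_(x : 'Z_p) A x)%N.

(* The sum ranges over [B] with multiplicities, via [enum_mset]. *)
Definition zero_sum_free (p : nat) (A : zseq p) : Prop :=
  forall B : zseq p, (B `<=` A)%mset -> B <> mset0 -> \sum_(x <- B) x <> 0.

Definition zsf_bounded (m p : nat) : set (zseq p) :=
  [set A | zero_sum_free A /\ (max_mult A <= m)%N].

Arguments zsf_bounded : clear implicits.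

Definition N1 (m p : nat) : nat := #|` fset_set (zsf_bounded m p)|.

(* [fset_set] is [fset0] on infinite sets, so [N1] counts what it should
   because of the following. *)
Lemma finite_zsf_bounded (m p : nat) : finite_set (zsf_bounded m p).
Proof.
pose f (A : zseq p) : {ffun 'Z_p -> 'I_m.+1} := [ffun x => inord (A x)].
have bnd (A : zseq p) x : (max_mult A <= m -> A x < m.+1)%N.
  by rewrite ltnS; apply: leq_trans; rewrite /max_mult (bigD1 x) //= leq_maxl.
have injf : {in zsf_bounded m p &, injective f}.
  move=> A B /set_mem[_ Am] /set_mem[_ Bm] /ffunP AB; apply/msetP => x.
  by have /(congr1 val) := AB x; rewrite !ffunE /= !inordK ?bnd.
have /card_eqPle[_ /card_le_finite] := inj_card_eq injf; apply.
exact: finite_finset.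
Qed.

(* Main.v *)
(** Lower bound: a multiset of integers in [1, p - 1] with sum less than [p] is
    zero-sum-free modulo [p], so [N1 m p] is at least the number of partitions of
    integers below [p] with multiplicities at most [m].

    Upper bound: a zero-sum-free [A] is, up to a dilation and [o(sqrt p / ln p)]
    elements, a partition of about [p] together with the negative of a partition
    of a small multiple of [p]. If the product of the [|1 + chi a|] for
    [a] in [A] were small for all nontrivial characters [chi], some nonempty
    sub-multiset would have sum [0]; so some dilation brings
    most of [A] close to [0]; take the best such dilation, and view [A] as integers in
    [-M, M]. No integer [g > 1] divides, and no further dilation shrinks, most of
    [A]. A small part of [A] whose subset sums already form a large set [T] then
    makes every other element [a] add about [|a|] new subset sums, because
    [x |-> |(T + x) \ T|] is subadditive and small on a set generating the
    integers modulo [a]. Hence two disjoint parts of [A], on either side of [0],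
    would fill up intervals and meet unless the sums of [|a|] are as claimed.

    Partitions are counted by Chernoff bounds on the generating function
    [prod_k (1 + e^(-tk) + ... + e^(-mtk))], whose logarithm is asymptotic to
    [(1 - 1 / (m + 1)) (pi^2 / 6) / t] as [t] tends to [0]. *)
Require Import Defs.
From mathcomp Require Import all_boot all_order all_algebra zify ring.
Set Implicit Arguments.
Unset Strict Implicit.
Unset Printing Implicit Defensive.
Import Order.TTheory GRing.Theory Num.Theory.

(** * Translates of sets in finite abelian groups *)

Section Growth.
Local Open Scope nat_scope.
Variable G : finZmodType.
Implicit Types (T V W : {set G}) (x y : G) (s : seq G).

(** Each exceptional element costs a factor of about [p] in the count, hence the allowance
    [o(sqrt p / ln p)]. The obstacle is that adjoining [a] to a sequence with subset sums [T]
    creates [lam T a] new sums, and this is small when [T] is almost [a]-periodic. Were [lam T] at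
    most [L] on integers of gcd 1, short words in them would represent many residues mod [a] with
    [lam T] still small; shifting these by multiples of [a] would then give too many [x] with
    [T + x] close to [T], as the sizes of all [T cap (T + x)] sum to only [|T|^2]. An element with
    [lam T > L] may spoil the assumption, but it can be spent to enlarge [T], at most [p / L] times:
    so gcd 1 must survive the deletion of that many elements, which is what [robust] and [kit]
    provide. The crude [weak_growth] serves to shrink the range of the elements: with [p] about
    [w^200], Fourier analysis only gives [w^153], and below [w^107] every residue mod [a] is
    reached. Then [sharp_growth], with constant near 1, applies. [D = 30] gives the density
    [(D - 5) / (D + 1) = 25 / 31 > 1 / 2], so two such sets in one interval meet. *)

Definition cor T x := #|[set y in T | (y + x)%R \in T]|.
Definition lam T x := #|[set y in T | (y + x)%R \notin T]|.

Lemma cor_lam T x : cor T x + lam T x = #|T|.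
Proof.
rewrite -(cardsID [set y | (y + x)%R \in T] T) /cor /lam.
by congr (_ + _); apply: eq_card => y; rewrite !inE // andbC.
Qed.

Lemma lam0 T : lam T 0%R = 0.
Proof.
by apply/eqP; rewrite cards_eq0; apply/eqP/setP=> y; rewrite !inE addr0 andbN.
Qed.

Lemma corN T x : cor T (- x)%R = cor T x.
Proof.
rewrite /cor -[RHS](card_imset _ (addIr x)); apply: eq_card => y; rewrite !inE.
apply/andP/imsetP => [[yT yxT]|[z]].
  by exists (y - x)%R; rewrite ?inE ?subrK ?yxT.
by rewrite inE => /andP[zT zxT] ->; rewrite addrK.
Qed.

Lemma lamN T x : lam T (- x)%R = lam T x.
Proof. by have := cor_lam T x; have := cor_lam T (- x)%R; rewrite corN; lia. Qed.

(** A point of [T] that [x + y] moves out of [T] is either moved out by [x], or moved by [x] to a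
    point of [T] that [y] moves out. With [lamN], bounds on generators thus spread linearly along
    words. *)
Lemma lamD T x y : lam T (x + y)%R <= lam T x + lam T y.
Proof.
rewrite [in X in _ <= X + _]/lam {2}/lam.
rewrite -[in X in _ <= _ + X](card_imset _ (addIr (- x)%R)).
apply: leq_trans (leq_card_setU _ _); apply: subset_leq_card.
apply/subsetP => z; rewrite !inE addrA => /andP[zT zxyT].
rewrite zT /=; have [zxT|//] := boolP (z + x \in T)%R.
apply/orP; right; apply/imsetP; exists (z + x)%R; last by rewrite addrK.
by rewrite inE zxT.
Qed.

(** The counted pairs [(y, x)] correspond to the pairs [(y, y + x)] of [T * T]. In particular at
    most [2 |T|] elements [x] can satisfy [cor T x >= |T| / 2]. *)
Lemma sum_cor T : \sum_x cor T x = #|T| ^ 2.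
Proof.
under eq_bigr => x _.
  rewrite /cor -sum1dep_card big_mkcondr /=; over.
rewrite exchange_big /= -mulnn -sum_nat_const; apply: eq_bigr => y yT.
rewrite -big_mkcond /= sum1dep_card -[RHS](card_imset _ (addrI (- y)%R)).
apply: eq_card => x; rewrite !inE; apply/idP/imsetP => [h|[z zT ->]].
  by exists (y + x)%R; rewrite ?addKr.
by rewrite addNKr.
Qed.

(** Closure under adding [V] suffices for generation because the group is finite. Quantifying over
    the closed sets [W] lets balls and sets of translates be plugged in directly. *)
Definition gen V :=
  forall W, 0%R \in W -> (forall w v, w \in W -> v \in V -> (w + v)%R \in W) ->
  W = setT.

Lemma gen_sub V V' : V \subset V' -> gen V -> gen V'.
Proof.
move=> /subsetP sVV' gV W W0 WV; apply: gV => // w v wW vV.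
by apply: WV => //; apply: sVV'.
Qed.

Lemma lam_gt0 T x : gen [set x] -> T != set0 -> T != setT -> 0 < lam T x.
Proof.
move=> gx /set0Pn[y yT] nT; rewrite lt0n; apply: contra nT => /eqP l0.
have cl z : z \in T -> (z + x)%R \in T.
  move=> zT; apply: contraT => nz; suff: z \in set0 by rewrite inE.
  by move/eqP: l0; rewrite cards_eq0 => /eqP <-; rewrite inE zT.
have /setP h : [set z | (y + z)%R \in T] = setT.
  apply: gx => [|w v]; first by rewrite inE addr0.
  by rewrite !inE addrA => h /eqP ->; apply: cl.
apply/eqP/setP => z; rewrite inE; have := h (z - y)%R.
by rewrite !inE addrC subrK.
Qed.

Definition addset W V : {set G} := [set (w + v)%R | w in W, v in V].
Definition ball V h : {set G} := iter h (fun W => addset W V) [set 0%R].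

Lemma mem_ballS V h x y : x \in ball V h -> y \in V -> (x + y)%R \in ball V h.+1.
Proof. by move=> *; apply/imset2P; exists x y. Qed.

Lemma ballSP V h x : reflect (exists2 w, w \in ball V h & exists2 v, v \in V & x = w + v)%R
  (x \in ball V h.+1).
Proof.
apply: (iffP imset2P) => [[w v wW vV ->]|[w wW [v vV ->]]]; last by exists w v.
by exists w => //; exists v.
Qed.

Section Ball.
Variable V : {set G}.
Hypotheses (V0 : 0%R \in V) (VN : forall v, v \in V -> (- v)%R \in V) (gV : gen V).

Lemma ball_0 h : 0%R \in ball V h.
Proof.
by elim: h => [|h ih]; rewrite ?set11 // -[0%R]addr0; apply: mem_ballS.
Qed.

Lemma sub_ballS h : ball V h \subset ball V h.+1.
Proof. by apply/subsetP => x xh; rewrite -[x]addr0; apply: mem_ballS. Qed.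

Lemma ball_stat h : ball V h.+1 = ball V h -> ball V h = setT.
Proof.
by move=> e; apply: gV; rewrite ?ball_0 // => w v wh vV; rewrite -e; apply: mem_ballS.
Qed.

(* A point of the sphere of radius [3t+2] centres a translate of [V] lying
   between the balls of radii [3t] and [3t+3]. *)
Lemma ball_growth t : minn #|G| (t * #|V|) <= #|ball V (3 * t)|.
Proof.
elim: t => [|t ih]; first by rewrite mul0n minn0.
have -> : 3 * t.+1 = (3 * t).+3 by lia.
have [e|ne] := eqVneq (ball V (3 * t).+2) (ball V (3 * t).+1).
  have := ball_stat e => e'.
  rewrite geq_min; apply/orP; left.
  rewrite -cardsT -e'; apply: subset_leq_card.
  by apply: subset_trans (sub_ballS _); rewrite e' -e'; apply: sub_ballS.
have /properP[_ [x x2 x1]] : ball V (3 * t).+1 \proper ball V (3 * t).+2.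
  by rewrite properEneq eq_sym ne sub_ballS.
pose X := [set (x + v)%R | v in V].
have dX : [disjoint ball V (3 * t) & X].
  apply/pred0P => y /=; apply/negbTE/negP => /andP[yb /imsetP[v vV ey]].
  case/negP: x1; rewrite (_ : x = y - v)%R; last by rewrite ey addrK.
  by apply: mem_ballS => //; apply: VN.
rewrite geq_min; apply/orP.
have le : #|ball V (3 * t)| + #|V| <= #|ball V (3 * t).+3|.
  rewrite -(card_imset (mem V) (addrI x)) -/X.
  have := cardsUI (ball V (3 * t)) X; rewrite (disjoint_setI0 dX) cards0 addn0 => <-.
  apply: subset_leq_card; apply/subUsetP; split.
    by do 2! apply: subset_trans (sub_ballS _) _; apply: sub_ballS.
  by apply/subsetP => y /imsetP[v vV ->]; apply: mem_ballS.
by move: ih; rewrite (mulSn t) geq_min; case/orP => h; [left|right]; lia.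
Qed.

Lemma lam_ball T K h x : (forall v, v \in V -> lam T v <= K) ->
  x \in ball V h -> lam T x <= h * K.
Proof.
move=> VK; elim: h x => [|h ih] x; first by rewrite inE => /eqP->; rewrite lam0.
case/ballSP => w wh [v vV ->]; apply: leq_trans (lamD _ _ _) _.
by rewrite mulSn addnC leq_add ?VK ?ih.
Qed.

(** With [t = |T| / (6 K)], every [x] in the ball of radius [3t] has [lam T x <= |T| / 2], so by
    [sum_cor] that ball has at most [2 |T| < |G|] points. [ball_growth] then gives [t |V| <= 2 |T|],
    and [|T| < (t + 1) 6 K <= 12 t K]. *)
Lemma card_small_lam T K : 0 < K -> (forall v, v \in V -> lam T v <= K) ->
  12 * K <= #|T| -> 2 * #|T| < #|G| -> #|V| <= 24 * K.
Proof.
move=> K0 VK KT TG; set s := #|T| in KT TG *.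
have s0 : 0 < s by lia.
pose t := s %/ (6 * K).
have bs : #|ball V (3 * t)| <= 2 * s.
  rewrite -(leq_pmul2r s0); apply: (@leq_trans (2 * s ^ 2)); last by nia.
  rewrite -sum_cor big_distrr /=.
  apply: (@leq_trans (\sum_(x in ball V (3 * t)) 2 * cor T x)); last first.
    by rewrite [leqRHS](bigID (mem (ball V (3 * t)))) /= leq_addr.
  rewrite -sum_nat_const; apply: leq_sum => x xb.
  have := lam_ball VK xb; have := cor_lam T x; rewrite -/s.
  have : t * (6 * K) <= s by apply: leq_divM.
  nia.
have := ball_growth t; rewrite geq_min => /orP[|h]; first by lia.
have h2 : t * #|V| <= 2 * s by lia.
have : s < t.+1 * (6 * K) by rewrite /t ltn_ceil ?muln_gt0.
nia.
Qed.

End Ball.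
End Growth.

(** * Subset sums and zero-sum-free sequences *)

Section SubsetSums.
Local Open Scope nat_scope.
Variable G : finZmodType.
Implicit Types (T V W : {set G}) (x y : G) (s : seq G).

Definition ssums s : {set G} := foldr (fun a T => T :|: [set (y + a)%R | y in T]) [set 0%R] s.

Arguments ssums : simpl never.

(** This makes [lam] the currency of the whole argument: the new sums are the points of [T + a]
    outside [T]. *)
Lemma card_ssums_cons a s : #|ssums (a :: s)| = #|ssums s| + lam (ssums s) a.
Proof.
rewrite [ssums (a :: s)]/ssums [foldr _ _ _]/= -/(ssums s) cardsU card_imset; last exact: addIr.
have <- : cor (ssums s) a = #|ssums s :&: [set (y + a)%R | y in ssums s]|.
  rewrite -corN; apply: eq_card => y; rewrite !inE; apply: andb_id2l => _.
  apply/idP/imsetP => [h|[z zT ->]]; last by rewrite addrK.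
  by exists (y - a)%R; rewrite ?subrK.
by rewrite -!(cor_lam (ssums s) a); lia.
Qed.

Lemma ssumsP s x : reflect (exists b, x = \sum_(y <- mask b s) y)%R (x \in ssums s).
Proof.
apply: (iffP idP) => [|[b ->]].
  elim: s x => [|a s ih] x /=; first by rewrite inE => /eqP ->; exists [::]; rewrite big_nil.
  rewrite inE => /orP[/ih[b ->]|/imsetP[y /ih[b ->] ->]].
    by exists (false :: b).
  by exists (true :: b); rewrite /= big_cons addrC.
elim: s b => [|a s ih] [|c b] /=; rewrite ?big_nil ?inE //.
  by have := ih [::]; rewrite /= big_nil => ->.
case: c; last by rewrite ih.
rewrite big_cons; apply/orP; right; apply/imsetP.
by exists (\sum_(y <- mask b s) y)%R; [apply: ih|rewrite addrC].
Qed.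

Lemma ssums_cat s1 s2 x y :
  x \in ssums s1 -> y \in ssums s2 -> (x + y)%R \in ssums (s1 ++ s2).
Proof.
elim: s1 x => [|a s1 ih] x /=; first by rewrite inE => /eqP -> ?; rewrite add0r.
rewrite !inE => /orP[xs|/imsetP[z zs ->]] ys; first by rewrite ih.
by apply/orP; right; apply/imsetP; exists (z + y)%R; [apply: ih|rewrite addrAC].
Qed.

Lemma ssums0 s : 0%R \in ssums s.
Proof. by apply/ssumsP; exists [::]; rewrite mask0s big_nil. Qed.

Lemma ssums_catr s1 s2 : ssums s2 \subset ssums (s1 ++ s2).
Proof.
by apply/subsetP => x xs; rewrite -[x]add0r; apply: ssums_cat; rewrite ?ssums0.
Qed.

Lemma sub_ssums s1 s2 : (forall x, count_mem x s1 <= count_mem x s2) ->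
  ssums s1 \subset ssums s2.
Proof.
move=> s12; apply/subsetP => x /ssumsP[b ->]; apply/ssumsP.
have /count_maskP[c _ pc] : forall x, count_mem x (mask b s1) <= count_mem x s2.
  by move=> y; apply: leq_trans (leq_count_mask _ _ _) (s12 y).
by exists c; rewrite (perm_big _ pc).
Qed.

Lemma perm_ssums s1 s2 : perm_eq s1 s2 -> ssums s1 = ssums s2.
Proof.
by move=> /permP p12; apply/eqP; rewrite eqEsubset !sub_ssums // => x; rewrite p12.
Qed.

Definition zsf s := forall u,
  (forall x, count_mem x u <= count_mem x s) -> u != [::] -> (\sum_(x <- u) x != 0)%R.

Lemma zsf_perm s1 s2 : perm_eq s1 s2 -> zsf s1 -> zsf s2.
Proof.
by move=> /permP p12 z1 u us; apply: z1 => x; rewrite p12.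
Qed.

Lemma zsf_neq0 s : zsf s -> all (fun x => x != 0%R) s.
Proof.
move=> zs; apply/allP => x xs; have := zs [:: x]; rewrite big_seq1; apply => // y /=.
rewrite addn0; case: eqP => [<-|_] //.
by rewrite -has_count has_pred1.
Qed.

Lemma zsf_catl s1 s2 : zsf (s1 ++ s2) -> zsf s1.
Proof.
by move=> z u us; apply: z => x; rewrite count_cat (leq_trans (us x)) ?leq_addr.
Qed.

Lemma zsf_catr s1 s2 : zsf (s1 ++ s2) -> zsf s2.
Proof.
by move=> z u us; apply: z => x; rewrite count_cat (leq_trans (us x)) ?leq_addl.
Qed.

(* Two disjoint subsequences with more subset sums than the group has elements
   have opposite non-trivial subset sums. *)
Lemma zsf_card s1 s2 : zsf (s1 ++ s2) -> #|ssums s1| + #|ssums s2| <= #|G|.+1.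
Proof.
move=> z; rewrite leqNgt; apply/negP => lt.
pose N := [set (- y)%R | y in ssums s2].
have cN : #|N| = #|ssums s2| by rewrite card_imset //; apply: oppr_inj.
have := cardsUI (ssums s1) N; rewrite cN => e.
have : #|ssums s1 :|: N| <= #|G| by rewrite -cardsT subset_leq_card ?subsetT.
move=> leG; have /card_gt1P : 1 < #|ssums s1 :&: N| by lia.
case=> x [y [xI yI xy]].
wlog x0 : x y xI yI xy / x != 0%R.
  move=> h; have [e0|] := eqVneq x 0%R; last by move=> nx; apply: (h x y).
  by apply: (h y x) => //; rewrite eq_sym // -e0.
move: xI; rewrite inE => /andP[/ssumsP[b xb] /imsetP[z' /ssumsP[c zc] xz]].
have ne : mask b s1 ++ mask c s2 != [::].
  by case: (mask b s1) xb x0 => [|? ?] // ->; rewrite big_nil eqxx.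
have us u : count_mem u (mask b s1 ++ mask c s2) <= count_mem u (s1 ++ s2).
  by rewrite !count_cat leq_add ?leq_count_mask.
by have := z _ us ne; rewrite big_cat /= -xb -zc xz addNr eqxx.
Qed.

Lemma zsf_meet s1 s2 s3 x y :
  zsf (s1 ++ s2 ++ s3) -> s3 != [::] -> x \in ssums s1 -> y \in ssums s2 ->
  (x + y + \sum_(z <- s3) z != 0)%R.
Proof.
move=> z n3 /ssumsP[b ->] /ssumsP[c ->]; rewrite -!big_cat -catA; apply: z.
  by move=> u; rewrite !count_cat !leq_add ?leq_count_mask.
by rewrite -size_eq0 !size_cat !addn_eq0 !size_eq0 (negbTE n3) !andbF.
Qed.

Lemma size_mask_le (b : bitseq) s : size (mask b s) <= size s.
Proof. exact: size_subseq (mask_subseq _ _). Qed.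

Lemma mask_flip b s x : size b = size s -> x \in mask (map negb b) s ->
  exists2 c, size c = size s & perm_eq (mask c s) (x :: mask b s).
Proof.
elim: s b => [|y s ih] [|c b] //= [sb].
case: c => /=; rewrite ?inE => h.
  have [c sc pc] := ih b sb h; exists (true :: c); rewrite /= ?sc //.
  rewrite perm_sym (perm_catCA [:: x] [:: y]) /= perm_cons perm_sym; exact: pc.
case/orP: h => [/eqP ->|h]; first by exists (true :: b); rewrite /= ?sb.
by have [c sc pc] := ih b sb h; exists (false :: c); rewrite /= ?sc.
Qed.

(* Among the ways of adding a part of [Q], take one that maximises the number
   of subset sums minus [L] times the number of elements used: then no unused
   element of [Q] creates more than [L] new sums. *)
Lemma growth_process (I : eqType) (f : I -> G) (Q0 Q : seq G) (A : seq I) (g : I -> nat) (Bd L : nat) :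
  (forall b (T : {set G}), size b = size Q -> ssums Q0 \subset T -> #|T| <= Bd ->
     #|ssums Q0| + size (mask b Q) * L <= #|T| ->
     (forall q, q \in mask (map negb b) Q -> lam T q <= L) ->
     forall a, a \in A -> g a <= lam T (f a)) ->
  Bd < #|ssums (Q0 ++ Q ++ map f A)| \/
  #|ssums Q0| + \sum_(a <- A) g a <= #|ssums (Q0 ++ Q ++ map f A)|.
Proof.
move=> H.
suff : Bd < #|ssums (Q0 ++ Q ++ map f A)| \/ exists2 b, size b = size Q &
   #|ssums Q0| + \sum_(a <- A) g a + size (mask b Q) * L <= #|ssums (map f A ++ mask b Q ++ Q0)|.
  case=> [|[b sb le]]; first by left.
  right; apply: leq_trans (leq_trans le _); first by rewrite leq_addr.
  apply/subset_leq_card/sub_ssums => x; rewrite !count_cat.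
  have cm : count_mem x (mask b Q) <= count_mem x Q := leq_count_mask _ _ _; lia.
elim: A H => [|a A ih] H.
  right; exists (nseq (size Q) false); first by rewrite size_nseq.
  by rewrite mask_false big_nil /= mul0n !addn0.
case: ih => [b T sb sQ TB Tc Tq a' a'A|lt|[b0 sb0 le0]].
- by apply: (H b T) => //; rewrite inE a'A orbT.
- left; apply: leq_trans lt _; apply/subset_leq_card/sub_ssums => x.
  by rewrite !count_cat /=; lia.
pose S (b : bitseq) := ssums (map f A ++ mask b Q ++ Q0).
(* The shift by [size Q * L] keeps the truncated subtraction exact. The maximiser does at least as
   well as the selection [b0] inherited from the previous step, so the invariant persists. *)
pose F (b : (size Q).-tuple bool) := #|S b| + (size Q * L - size (mask b Q) * L).
have sb0' : size b0 == size Q by rewrite sb0.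
case: (@arg_maxnP _ (Tuple sb0') predT F isT) => b _ bmax.
have [TB|lt] := leqP #|S b| Bd; last first.
  left; apply: leq_trans lt _; apply/subset_leq_card/sub_ssums => x.
  have cm : count_mem x (mask b Q) <= count_mem x Q := leq_count_mask _ _ _.
  by move: cm; rewrite !count_cat /=; lia.
have le : #|ssums Q0| + \sum_(a <- A) g a + size (mask b Q) * L <= #|S b|.
  have arith (x0 x1 u0 u1 n k : nat) :
    x0 + (n - u0) <= x1 + (n - u1) -> k + u0 <= x0 -> u0 <= n -> u1 <= n -> k + u1 <= x1.
    by lia.
  apply: arith (bmax (Tuple sb0') isT) le0 _ _; by rewrite leq_mul2r size_mask_le orbT.
right; exists b; first exact: size_tuple.
rewrite big_cons map_cons cat_cons card_ssums_cons -/(S b).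
have arith2 (k r u x y l : nat) : k + r + u <= x -> y <= l -> k + (y + r) + u <= x + l by lia.
apply: (arith2 _ _ _ _ _ _ le).
apply: (H b); rewrite ?inE ?eqxx ?size_tuple //.
- by apply: sub_ssums => x; rewrite !count_cat; lia.
- by apply: leq_trans le; rewrite leq_add2r leq_addr.
move=> q /(mask_flip (size_tuple b))[c sc pc].
have sc' : size c == size Q by rewrite sc.
have arith3 (x y n u : nat) :
  x + y + (n * L - u.+1 * L) <= x + (n * L - u * L) -> u < n -> y <= L by nia.
have Sc : #|S c| = #|S b| + lam (S b) q.
  have -> : S c = ssums (q :: (map f A ++ mask b Q ++ Q0)).
    apply: perm_ssums; apply/permP => P.
    by rewrite /= !count_cat (permP pc) /=; lia.
  exact: card_ssums_cons.
have szc : size (mask c Q) = (size (mask b Q)).+1 by rewrite (perm_size pc).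
apply: (@arith3 #|S b| _ (size Q) (size (mask b Q))); last by rewrite -szc size_mask_le.
by rewrite -szc -Sc; apply: (bmax (Tuple sc')).
Qed.

End SubsetSums.

(** * Growth of subset sums when every nonzero element generates *)

Section PrimeOrder.
Local Open Scope nat_scope.
Variable G : finZmodType.
Implicit Types (T V W : {set G}) (x y : G) (s A C D : seq G).
Hypothesis genG : forall x, x != 0%R -> gen [set x].

(** A nonempty proper subset is not invariant under a generator, so every nonzero element adds at
    least one sum. *)
Lemma ssums_linear s : all (fun x => x != 0%R) s ->
  #|G| <= #|ssums s| \/ size s < #|ssums s|.
Proof.
elim: s => [|x s ih]; first by right; rewrite cards1.
case/andP=> x0 /ih[h|h]; have e := card_ssums_cons x s.
  by left; lia.
have [e'|ne] := eqVneq (ssums s) setT.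
  by left; rewrite e e' cardsT leq_addr.
right; have : 0 < lam (ssums s) x.
  apply: lam_gt0 => //; first exact: genG.
  by apply/set0Pn; exists 0%R; rewrite ssums0.
by move=> l0; rewrite e -[_.+1]addn1 leq_add.
Qed.

(** Otherwise [card_small_lam], applied to [0], [D] and [- D] with [K = (n - 1) / 24], would bound
    the size of [D] by [n - 1]. *)
Lemma exists_big_lam n T D : uniq D -> all (fun x => x != 0%R) D ->
  n <= size D -> 24 < n -> n <= #|T| -> 2 * #|T| < #|G| ->
  exists2 d, d \in D & n <= 24 * lam T d.
Proof.
move=> uD D0 nD n24 nT TG; apply/hasP; rewrite -[has _ _]negbK -all_predC.
apply/negP => /allP h.
pose V := 0%R |: ([set x in D] :|: [set x | (- x)%R \in D]).
have V0 : 0%R \in V by rewrite !inE eqxx.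
have VN v : v \in V -> (- v)%R \in V.
  by rewrite !inE oppr_eq0 opprK [X in _ || X]orbC.
case: D D0 nD h @V V0 VN uD => [|d D]; first by rewrite leqn0; case: n n24 nT.
move=> D0 nD h V V0 VN uD.
have gV : gen V.
  apply: (gen_sub _ (genG (proj1 (andP D0)))).
  by rewrite sub1set !inE eqxx !orbT.
have K0 : 0 < n.-1 %/ 24 by rewrite divn_gt0 //; lia.
have VK v : v \in V -> lam T v <= n.-1 %/ 24.
  have hd x : x \in d :: D -> lam T x <= n.-1 %/ 24.
    by move/h; rewrite /= -ltnNge leq_divRL //; lia.
  by rewrite !inE -!in_cons => /or3P[/eqP->|/hd|/hd] //; rewrite ?lam0 ?lamN.
have le := leq_divM n.-1 24.
have h12 : 12 * (n.-1 %/ 24) <= n by lia.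
have leV := card_small_lam V0 VN gV K0 VK (leq_trans h12 nT) TG.
have leDV : size (d :: D) <= #|V|.
  rewrite -(card_uniqP uD); apply: subset_leq_card; apply/subsetP => x xD.
  by rewrite /V inE; apply/orP; right; rewrite inE; apply/orP; left; rewrite inE.
by have := leq_trans nD (leq_trans leDV leV); lia.
Qed.

Lemma quadratic_growth n k C D : uniq D -> all (fun x => x != 0%R) D ->
  n + k <= size D -> 24 < n -> n <= #|ssums C| ->
  exists D1 D2, [/\ perm_eq D (D1 ++ D2), size D1 = k &
    #|G| <= 2 * #|ssums (D1 ++ C)| \/ n * k <= 24 * #|ssums (D1 ++ C)|].
Proof.
move=> uD D0 nk n24 nC; elim: k nk => [|k ih] nk.
  by exists [::], D; split=> //; right; rewrite muln0.
have [|D1 [D2 [pD sD le]]] := ih; first by lia.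
have sD2 : size D = size D1 + size D2 by rewrite (perm_size pD) size_cat.
set T := ssums (D1 ++ C) in le *.
have TC : #|ssums C| <= #|T| by apply/subset_leq_card/ssums_catr.
have [TG|TG] := leqP #|G| (2 * #|T|).
  case: D2 pD sD2 => [|d D2] pD sD2; first by move: sD2 => /=; lia.
  exists (rcons D1 d), D2; rewrite cat_rcons size_rcons sD; split=> //; left.
  apply: leq_trans TG _; rewrite leq_mul2l; apply/subset_leq_card/sub_ssums => x.
  by rewrite cat_rcons !count_cat /=; lia.
have uD2 : uniq D2 by move: uD; rewrite (perm_uniq pD) cat_uniq => /and3P[].
have D20 : all (fun x => x != 0%R) D2.
  by move: D0; rewrite (perm_all _ pD) all_cat => /andP[].
have [||d dD nd] := @exists_big_lam n T D2 uD2 D20 _ n24 _ TG; [by rewrite sD in sD2; lia | exact: leq_trans nC TC |].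
exists (d :: D1), (rem d D2); split; first 1 last.
- by rewrite /= sD.
- right; rewrite cat_cons card_ssums_cons -/T.
  case: le => [|le]; first by rewrite leqNgt TG.
  by rewrite mulnDr mulnS addnC leq_add.
apply: perm_trans pD _; apply/permP => P; rewrite /= !count_cat.
by rewrite (permP (perm_to_rem dD)) /=; lia.
Qed.

(** The first [n] elements already give the [n] sums that [exists_big_lam] needs. Of the other [2n],
    [n] are moved over greedily, so that [n] candidates remain at each move and each move gains
    [n / 24] sums. *)
Lemma ssums_quadratic n s : uniq s -> all (fun x => x != 0%R) s ->
  size s = 3 * n -> 24 < n -> n <= #|G| ->
  #|G| <= 2 * #|ssums s| \/ n ^ 2 <= 24 * #|ssums s|.
Proof.
move=> us s0 sn n24 nG.
have us' : uniq (drop n s) by rewrite drop_uniq.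
move: s0; rewrite -{1}[s](cat_take_drop n) all_cat => /andP[t0 d0].
have st : size (take n s) = n by rewrite size_takel // sn; lia.
have [||D1 [D2 [pD sD h]]] := @quadratic_growth n n (take n s) _ us' d0 _ n24.
- by rewrite size_drop sn; lia.
- by have [] := ssums_linear t0; rewrite ?st; lia.
have le : #|ssums (D1 ++ take n s)| <= #|ssums s|.
  apply/subset_leq_card/sub_ssums => x; rewrite -{2}[s](cat_take_drop n) !count_cat.
  by rewrite (permP pD) count_cat; lia.
by case: h => h; [left|right]; nia.
Qed.

End PrimeOrder.

Lemma seq_choice (S T : eqType) (f : T -> S) (P : T -> Prop) (s : seq S) :
  (forall x, x \in s -> exists2 z, f z = x & P z) ->
  exists2 u, map f u = s & forall z, z \in u -> P z.
Proof.
elim: s => [|x s ih] h; first by exists [::].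
have [z fz Pz] := h x (mem_head _ _).
case: ih => [y ys|u fu Pu]; first by apply: h; rewrite inE ys orbT.
exists (z :: u); rewrite /= ?fz ?fu // => y; rewrite inE => /orP[/eqP->|] //.
exact: Pu.
Qed.

(** * Lifting generation modulo [a] to small integers *)

Section Residues.
Local Open Scope ring_scope.
Variables (G : finZmodType) (h : int -> G) (T : {set G}).
Hypotheses (h0 : h 0 = 0) (hD : forall x y, h (x + y) = h x + h y).

(* Integers with few translates out of [T], one for each of many residues mod [a]. *)
Lemma lam_residues (a L M t n : nat) (Vs : seq int) :
  (0 < a)%N ->
  (forall v, v \in Vs -> (absz v <= M)%N /\ (lam T (h v) <= L)%N) ->
  (forall g : nat, (1 < g)%N -> has (fun v : int => ~~ (g %| v)%Z) Vs) ->
  (n <= size (undup [seq (v %% a)%Z | v <- Vs]))%N ->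
  exists us : seq int, [/\ uniq [seq (u %% a)%Z | u <- us],
    (minn a (t * n) <= size us)%N &
    forall u, u \in us -> (absz u <= 3 * t * M)%N /\ (lam T (h u) <= 3 * t * L)%N].
Proof.
case: a => // a _ VM gV nV.
have hN x : h (- x) = - h x by apply: (addrI (h x)); rewrite -hD !subrr.
(* The modulus is now [a.+1]. The type ['I_a.+1] is the right group also for modulus 1, where ['Z_1]
   would be the integers mod 2. *)
pose f (z : int) : 'I_a.+1 := Zp1 *~ z.
have fD x y : f (x + y) = f x + f y by rewrite /f mulrzDr.
have fN x : f (- x) = - f x by rewrite /f mulrNz.
have f0 : f 0 = 0 by [].
have fa : f a.+1%:Z = 0.
  by rewrite /f -pmulrn Zp_mulrn; apply/val_inj; rewrite /= modnMml mul1n modnn.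
have fmod x : f (x %% a.+1)%Z = f x.
  have e : f ((x %/ a.+1)%Z * a.+1%:Z) = 0.
    by rewrite /f mulrC mulrzA -/(f a.+1%:Z) fa mul0rz.
  by have := fD ((x %/ a.+1)%Z * a.+1%:Z) (x %% a.+1)%Z; rewrite e add0r -divz_eq.
have fval x : (f x : nat) = absz (x %% a.+1)%Z.
  rewrite -fmod; have := modz_ge0 x (isT : a.+1%:Z != 0).
  have := ltz_pmod x (isT : 0 < a.+1%:Z).
  case: (x %% a.+1)%Z => // k lk _; rewrite /f -pmulrn Zp_mulrn /=.
  by rewrite modnMml mul1n modn_small.
have finj x y : f x = f y -> (x %% a.+1)%Z = (y %% a.+1)%Z.
  move/(congr1 (fun i : 'I__ => (i : nat))); rewrite !fval => e.
  by rewrite -[LHS]gez0_abs ?modz_ge0 // e gez0_abs ?modz_ge0.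
pose V : {set 'I_a.+1} := [set r | [|| r == 0, r \in map f Vs | - r \in map f Vs]].
have VP r : r \in V -> r = 0 \/ exists2 v, v \in Vs & r = f v \/ r = - f v.
  rewrite !inE => /or3P[/eqP|/mapP[v vV ->]|/mapP[v vV e]]; first by left.
    by right; exists v => //; left.
  by right; exists v => //; right; rewrite -e opprK.
have V0 : 0 \in V by rewrite !inE eqxx.
have VV v : v \in Vs -> f v \in V by move=> vV; rewrite inE map_f ?orbT.
have VNV v : v \in Vs -> - f v \in V by move=> vV; rewrite inE opprK map_f ?orbT.
have VN r : r \in V -> - r \in V.
  by case/VP => [->|[v vV [->|->]]]; rewrite ?oppr0 ?opprK //; [apply: VNV|apply: VV].
have genV : gen V.
  move=> W W0 WV.
  (* The integers whose residue translates [W] into itself form a group. Its least positive element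
     [g] divides everything in [Vs], so [gV] forces [g = 1], and [W] is everything. *)
  pose S (z : int) := [forall x in W, x + f z \in W].
  have SP z : reflect (forall x, x \in W -> x + f z \in W) (S z).
    exact: 'forall_implyP.
  have SD y z : S y -> S z -> S (y + z).
    by move=> /SP Sy /SP Sz; apply/SP => x xW; rewrite fD addrA; apply/Sz/Sy.
  have SNn n' z : S z -> S (z *+ n').
    move=> Sz; elim: n' => [|k ih]; last by rewrite mulrS; apply: SD.
    by apply/SP => x xW; rewrite mulr0n f0 addr0.
  have SV v : v \in Vs -> S v by move=> vV; apply/SP => x xW; apply/WV/VV.
  have SVN v : v \in Vs -> S (- v).
    by move=> vV; apply/SP => x xW; rewrite fN; apply/WV/VNV.
  have Sa : S a.+1%:Z by apply/SP => x xW; rewrite fa addr0.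
  have SN z : S z -> S (- z).
    move=> Sz; have -> : - z = z *+ a - z *+ a.+1 by rewrite mulrS; ring.
    apply: SD; first exact: SNn.
    apply/SP => x xW; rewrite fN (_ : f _ = 0) ?subr0 //.
    by rewrite -mulr_natr mulrC natz /f mulrzA -/(f a.+1%:Z) fa mul0rz.
  have exS : exists k, (0 < k)%N && S k%:Z by exists a.+1.
  case: (ex_minnP exS) => g /andP[g0 Sg] gmin.
  have Sdvd z : S z -> (g %| z)%Z.
    move=> Sz; have Sr : S (z %% g)%Z.
      have -> : (z %% g)%Z = z - (z %/ g)%Z * g by rewrite {2}(divz_eq z g) addrC addKr.
      apply: SD => //; case: (z %/ g)%Z => k.
        by rewrite -mulNr mulrC mulrN mulrC; apply: SN; rewrite mulrC -[k%:Z]natz mulr_natr; apply: SNn.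
      rewrite NegzE mulNr opprK mulrC -[k.+1%:Z]natz mulr_natr; exact: SNn.
    have r0 := modz_ge0 z (lt0r_neq0 (g0 : 0 < g%:Z)).
    have rg := ltz_pmod z (g0 : 0 < g%:Z).
    apply/dvdz_mod0P/eqP; apply: contraTT (rg) => nr.
    rewrite -leNgt; case: (z %% g)%Z Sr r0 nr => // k Sk _ nr.
    by rewrite lez_nat; apply: gmin; rewrite Sk andbT lt0n.
  have g1 : g = 1%N.
    apply/eqP; rewrite eqn_leq g0 andbT leqNgt; apply/negP => /gV/hasP[v vV].
    by rewrite (Sdvd v (SV v vV)).
  apply/setP => r; rewrite inE; have /SP/(_ 0 W0) : S (val r)%:Z.
    by rewrite -natz; apply: SNn; move: Sg; rewrite g1.
  rewrite add0r (_ : f _ = r) //; apply: val_inj.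
  by rewrite [LHS]fval modz_nat /= modn_small.
have bP k r : r \in ball V k -> exists2 z, f z = r &
    (absz z <= k * M)%N /\ (lam T (h z) <= k * L)%N.
  elim: k r => [|k ih] r.
    by rewrite inE => /eqP->; exists 0 => //; rewrite h0 lam0.
  case/ballSP => w /ih[z fz [zM zL]] [v /VP vP ->].
  have [y fy [yM yL]] : exists2 y, f y = v & (absz y <= M)%N /\ (lam T (h y) <= L)%N.
    case: vP => [->|[y /VM[yM yL] [->|->]]]; first by exists 0 => //; rewrite h0 lam0.
      by exists y.
    by exists (- y); rewrite ?fN // abszN hN lamN.
  exists (z + y); first by rewrite fD fz fy.
  rewrite hD !mulSn; split.
    by have := leq_add zM yM; lia.
  by apply: leq_trans (lamD _ _ _) _; lia.
have [us fus Pus] := seq_choice (fun r (rb : r \in enum (ball V (3 * t))) =>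
   bP (3 * t)%N r (etrans (esym (mem_enum _ _)) rb)).
exists us; split=> //.
- have := enum_uniq (ball V (3 * t)); rewrite -fus.
  rewrite (_ : map f us = map f [seq (u %% a.+1)%Z | u <- us]); first exact: map_uniq.
  by rewrite -map_comp; apply: eq_map => u /=; rewrite fmod.
have nV' : (n <= #|V|)%N.
  apply: leq_trans nV _; set D := undup _.
  have uD : uniq (map f D).
    rewrite map_inj_in_uniq ?undup_uniq // => x y.
    rewrite !mem_undup => /mapP[x' _ ->] /mapP[y' _ ->]; rewrite !fmod; exact: finj.
  rewrite -(size_map f) -(card_uniqP uD); apply/subset_leq_card/subsetP => r /mapP[x].
  by rewrite mem_undup => /mapP[v vV ->] ->; rewrite fmod; apply: VV.
have := ball_growth V0 VN genV t; rewrite card_ord.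
rewrite -(size_map f) fus -cardE; apply: leq_trans.
by rewrite leq_min geq_minl /= (leq_trans (geq_minr _ _)) // leq_mul2l nV' orbT.
Qed.

End Residues.

Lemma uniq_map_inj (S T : eqType) (f : S -> T) (s : seq S) :
  uniq (map f s) -> {in s &, injective f}.
Proof.
move=> us x y xs ys e; rewrite -(nth_index x xs) -(nth_index x ys); congr nth.
apply/eqP; rewrite -(nth_uniq (f x) _ _ us) ?size_map ?index_mem //.
by rewrite !(nth_map x) ?index_mem // !nth_index // e.
Qed.

(** The sum of [|k|] over [- n <= k <= n], in the enumeration by [Posz] and [Negz] that
    [sharp_growth] uses; [Negz i] is [- (i + 1)]. *)
Lemma sum_iota2 n :
  (\sum_(i <- iota 0 n.+1) i + \sum_(i <- iota 0 n) i.+1 = n * n.+1)%N.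
Proof.
have i1 m : iota 0 m.+1 = rcons (iota 0 m) m by rewrite -[m.+1]addn1 iotaD cats1 add0n.
elim: n => [|n ih]; first by rewrite i1 big_rcons !big_nil.
by move: ih; rewrite (i1 n.+1) big_rcons i1 !big_rcons /=; lia.
Qed.

(** * Lower bounds for [lam T (h a)] from representatives of residues mod [a] *)

Section Translates.
Local Open Scope ring_scope.
Variables (G : finZmodType) (h : int -> G) (p : nat) (T : {set G}).
Hypotheses (h0 : h 0 = 0) (hD : forall x y, h (x + y) = h x + h y).
Hypothesis h_inj : forall x, (absz x < p)%N -> h x = 0 -> x = 0.

Lemma hN x : h (- x) = - h x.
Proof. by apply: (addrI (h x)); rewrite -hD !subrr. Qed.

Lemma h_inj2 B x y : (2 * B < p)%N -> (absz x <= B)%N -> (absz y <= B)%N ->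
  h x = h y -> x = y.
Proof.
move=> Bp xB yB e; apply/eqP; rewrite -subr_eq0; apply/eqP/h_inj.
  by lia.
by rewrite hD hN e subrr.
Qed.

Lemma lam_mul (k : nat) x : (lam T (h (k%:Z * x)) <= k * lam T (h x))%N.
Proof.
elim: k => [|k ih]; first by rewrite mul0r h0 lam0.
rewrite -addn1 PoszD mulrDl mul1r hD mulnDl mul1n.
by apply: leq_trans (lamD _ _ _) _; rewrite leq_add2r.
Qed.

Variables (a B C : nat) (us : seq int).
Hypothesis us_uniq : uniq [seq (u %% a)%Z | u <- us].
Hypothesis usB : forall u, u \in us -> (absz u <= B)%N /\ (lam T (h u) <= C)%N.

(** The size condition makes [h] injective on the integers [u + k a]; the residue mod [a] then
    recovers [u], and afterwards [k]. *)
Lemma uniq_translates (ks : seq int) (H : nat) : (0 < a)%N -> uniq ks ->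
  (forall k, k \in ks -> absz k <= H)%N -> (2 * (B + H * a) < p)%N ->
  uniq [seq h (u + k * a%:Z) | u <- us, k <- ks].
Proof.
move=> a0 uk kH Bp; have uus := map_uniq us_uniq.
apply: (allpairs_uniq uus uk) => -[u' k'] [v' l'] /=.
case/allpairsP=> -[u k] /= [uu kk [-> ->]] /allpairsP[[v l] /= [vv ll [-> ->]]] e.
have {}e : u + k * a%:Z = v + l * a%:Z.
  have bd w m : w \in us -> m \in ks -> (absz (w + m * a%:Z)%R <= B + H * a)%N.
    move=> /usB[wB _] /kH mH; have : (absz (m * a%:Z)%R <= H * a)%N.
      by rewrite abszM leq_mul.
    by move: (m * a%:Z)%R => m'; lia.
  by apply: (h_inj2 Bp _ _ e); apply: bd.
have uv : u = v.
  have : (u %% a)%Z = (v %% a)%Z.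
    by rewrite -(modzMDl k u a) addrC e addrC modzMDl.
  exact: uniq_map_inj us_uniq u v uu vv.
move: e; rewrite uv => /addrI e; congr (_, _); apply: mulIf e.
by case: (a) a0.
Qed.

Lemma lam_translate u (k : int) : u \in us ->
  (lam T (h (u + k * a%:Z)) <= C + absz k * lam T (h a))%N.
Proof.
move=> /usB[_ uC]; rewrite hD; apply: leq_trans (lamD _ _ _) _; apply: leq_add => //.
case: k => k; first exact: lam_mul.
by rewrite NegzE mulNr hN lamN lam_mul.
Qed.

(** The points [u + k a] with [0 <= k < H] are distinct and have [lam] at most
    [C + H * lam T (h a)], so [card_small_lam] bounds their number. *)
Lemma weak_growth (H : nat) : (forall x : G, x != 0 -> gen [set x]) -> (0 < a)%N ->
  (2 * (B + H * a) < p)%N -> (12 * (C + H * lam T (h a)) <= #|T|)%N ->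
  (2 * #|T| < #|G|)%N -> (0 < C)%N -> (size us * H <= 24 * (C + H * lam T (h a)))%N.
Proof.
move=> genG a0 Bp TK TG C0; set K := (C + _)%N in TK *.
pose X := [seq h (u + k * a%:Z) | u <- us, k <- map Posz (iota 0 H)].
have uX : uniq X.
  apply: (@uniq_translates _ H) => //; first by rewrite map_inj_uniq ?iota_uniq // => ? ? [].
  by move=> k /mapP[i]; rewrite mem_iota => /andP[_ iH] -> /=; lia.
have sX : size X = (size us * H)%N by rewrite size_allpairs size_map size_iota.
have XK x : x \in X -> (lam T x <= K)%N.
  case/allpairsP=> -[u k] /= [uu /mapP[i] + ->] ->; rewrite mem_iota => /andP[_ iH].
  by apply: leq_trans (lam_translate _ uu) _; rewrite leq_add2l leq_mul2r /=; lia.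
rewrite -sX; pose V := [set x | [|| x == 0, x \in X | - x \in X]].
have VK x : x \in V -> (lam T x <= K)%N.
  by rewrite inE => /or3P[/eqP->|/XK|/XK]; rewrite ?lam0 ?lamN.
have V0 : 0 \in V by rewrite inE eqxx.
have VN v : v \in V -> - v \in V.
  by rewrite !inE oppr_eq0 opprK [X in _ || X]orbC.
have XV : (size X <= #|V|)%N.
  rewrite -(card_uniqP uX); apply: subset_leq_card; apply/subsetP => x xX.
  by rewrite inE; apply/or3P/Or32.
have K0 : (0 < K)%N by rewrite addn_gt0 C0.
(* A nonzero point makes [V] generate. If [0] is the only point, [X] has at most one entry, being
   free of repetitions. *)
have [/hasP[x xX x0]|] := boolP (has (fun x => x != 0) X).
  apply: leq_trans XV _; apply: (card_small_lam V0 VN _ K0 VK TK TG).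
  by apply: (gen_sub _ (genG x x0)); rewrite sub1set inE; apply/or3P/Or32.
rewrite -all_predC => /allP X0; apply: (@leq_trans 1); last by lia.
rewrite leqNgt; apply/negP => lt; move: uX X0.
move: X lt {sX XK V VK V0 VN XV} => X lt uX X0; move: lt uX X0; case: X => [|x [|y X]] //= _ /andP[xy _] X0; move: xy.
have := X0 x (mem_head _ _); have := X0 y.
rewrite !inE eqxx orbT => /(_ isT); rewrite !negbK => /eqP -> /eqP ->.
by rewrite eqxx.
Qed.

(* [|T|^2] is the sum of all [|T cap (T + x)|]; keep the points
   [x = u + k a] with [|k| <= H]. *)
Lemma sharp_growth (H : nat) : (0 < a)%N -> (2 * (B + H * a) < p)%N ->
  (size us * ((2 * H + 1) * (#|T| - C)) <=
   #|T| ^ 2 + size us * (H * H.+1 * lam T (h a)))%N.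
Proof.
move=> a0 Bp; pose ks := map Posz (iota 0 H.+1) ++ map Negz (iota 0 H).
pose X := [seq h (u + k * a%:Z) | u <- us, k <- ks].
have kH k : k \in ks -> (absz k <= H)%N.
  rewrite mem_cat => /orP[|] /mapP[i]; rewrite mem_iota => /andP[_ iH] -> /=; lia.
have uks : uniq ks.
  rewrite cat_uniq !map_inj_uniq ?iota_uniq //=; try by move=> ? ? [].
  by rewrite andbT; apply/hasPn => _ /mapP[i _ ->]; apply/negP => /mapP[].
have uX : uniq X by apply: (@uniq_translates _ H).
have -> : (#|T| ^ 2 = \sum_x cor T x)%N by rewrite sum_cor.
have le : (\sum_(x <- X) cor T x <= \sum_x cor T x)%N.
  by rewrite big_uniq //= [leqRHS](bigID (mem X)) leq_addr.
apply: leq_trans (leq_add le (leqnn _)); rewrite big_allpairs_dep /=.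
rewrite -!sum1_size !big_distrl /= -big_split /= !big_seq; apply: leq_sum => u uu.
rewrite !mul1n.
have sumk : (\sum_(k <- ks) absz k = H * H.+1)%N.
  by rewrite big_cat !big_map; apply: sum_iota2.
apply: (@leq_trans (\sum_(k <- ks) (cor T (h (u + k * a%:Z)%R) + absz k * lam T (h a)))%N).
  apply: (@leq_trans (\sum_(k <- ks) (#|T| - C))%N).
    rewrite big_const_seq count_predT iter_addn_0 mulnC.
    by rewrite leq_mul // size_cat !size_map !size_iota; lia.
  apply: leq_sum => k _; rewrite leq_subLR -(cor_lam T (h (u + k * a%:Z)%R)).
  by have := lam_translate k uu; lia.
by rewrite big_split /= -big_distrl /= sumk.
Qed.

End Translates.

(** * Robust subsets with small generating kits *)

Section Arith.
Local Open Scope nat_scope.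

(** Here [s = |T|], [l = lam T (h a)], and [H] is about [s' / a] with [s'] close to [s]. The
    inequality of [sharp_growth] then reads [2 s^2 <= s^2 + s^2 l / a] up to relative errors
    [O(1 / D)], that is, [a <= l] up to such an error. *)
Lemma sharp_arith (a s s' l D H : nat) :
  0 < a -> 0 < s -> s' <= s -> D * (s - s') <= s -> D * a <= s -> 5 < D ->
  H * a <= s' < H.+1 * a ->
  a * ((2 * H + 1) * s') <= s ^ 2 + a * (H * H.+1 * l) -> (D - 5) * a <= D.+1 * l.
Proof.
move=> a0 s0 ss Ds Da D5 /andP[Hs sH] main.
have h1 : s' * (2 * s') <= s ^ 2 + a * (H * H.+1 * l) + s' * a.
  apply: leq_trans (leq_add main (leqnn _)).
  have -> : a * ((2 * H + 1) * s') + s' * a = s' * (2 * (H.+1 * a)) by ring.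
  by rewrite leq_mul2l leq_mul2l ltnW ?orbT.
have h2 : a * (a * (H * H.+1 * l)) <= s' * (s' + a) * l.
  have -> : a * (a * (H * H.+1 * l)) = (H * a) * (H.+1 * a) * l by ring.
  by rewrite leq_mul2r leq_mul ?orbT //; lia.
have h3 : a * (2 * s' ^ 2) <= a * s ^ 2 + s' * (s' + a) * l + a * (s' * a).
  have : a * (s' * (2 * s')) <= a * (s ^ 2 + a * (H * H.+1 * l) + s' * a).
    by rewrite leq_mul2l h1 orbT.
  by move: h2; rewrite !mulnDr; lia.
have Ds' : (D - 1) * s <= D * s' by move: Ds; rewrite mulnBr mulnBl mul1n; lia.
have h4 : D ^ 2 * (s' * (s' + a) * l) <= D * D.+1 * (s ^ 2 * l).
  have -> : D ^ 2 * (s' * (s' + a) * l) = (D * s') * (D * (s' + a)) * l by ring.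
  have -> : D * D.+1 * (s ^ 2 * l) = (D * s) * (D.+1 * s) * l by ring.
  rewrite leq_mul2r; apply/orP; right; apply: leq_mul; first by rewrite leq_mul2l ss orbT.
  by rewrite mulnDr mulSn addnC leq_add // leq_mul2l ss orbT.
have h5 : D ^ 2 * (a * (s' * a)) <= D * a * s ^ 2.
  have -> : D ^ 2 * (a * (s' * a)) = D * a * (s' * (D * a)) by ring.
  by rewrite leq_mul2l -mulnn leq_mul ?orbT.
have h6 : 2 * a * ((D - 1) ^ 2 * s ^ 2) <= D ^ 2 * (a * (2 * s' ^ 2)).
  have -> : D ^ 2 * (a * (2 * s' ^ 2)) = 2 * a * (D * s') ^ 2 by ring.
  by rewrite -expnMn leq_mul2l leq_exp2r ?Ds' ?orbT.
have h7 : 2 * a * (D - 1) ^ 2 * s ^ 2 <= (D ^ 2 * a + D * D.+1 * l + D * a) * s ^ 2.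
  have : D ^ 2 * (a * (2 * s' ^ 2)) <=
    D ^ 2 * (a * s ^ 2) + D ^ 2 * (s' * (s' + a) * l) + D ^ 2 * (a * (s' * a)).
    by rewrite -!mulnDr leq_mul2l h3 orbT.
  by lia.
have h8 : 2 * a * (D - 1) ^ 2 <= D ^ 2 * a + D * D.+1 * l + D * a.
  by move: h7; rewrite leq_pmul2r // expn_gt0 s0.
(* The loss of 5 comes from [2 (D - 1)^2 - D^2 - D = D (D - 5) + 2]. *)
have [E DE] : exists E, D = E + 5 by exists (D - 5); lia.
move: h8; rewrite DE addnK => h8.
have h9 : (E + 5) * (E * a) <= (E + 5) * ((E + 5).+1 * l).
  by move: h8; rewrite (_ : E + 5 - 1 = E + 4) -?mulnn; lia.
by move: h9; rewrite leq_pmul2l //; lia.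
Qed.

(** A residue class mod [a] has at most [2 (M / a + 1) <= 4 M / a] members in [[-M, M]]. *)
Lemma card_residues (a M : nat) (s : seq int) : 0 < a <= M ->
  (forall v, v \in s -> absz v <= M) ->
  size (undup s) * a <= size (undup [seq (v %% a)%Z | v <- s]) * (4 * M).
Proof.
case/andP=> a0 aM sM; set R := undup [seq _ | v <- s].
pose c := M %/ a.
pose Qs := map Posz (iota 0 c.+1) ++ map Negz (iota 0 c.+1).
have az : (a%:Z != 0)%R by case: (a) a0.
have sub : {subset undup s <= [seq (q * a%:Z + r)%R | q <- Qs, r <- R]}.
  move=> v; rewrite mem_undup => vs; apply/allpairsP; exists ((v %/ a)%Z, (v %% a)%Z).
  split=> /=; last by rewrite -divz_eq.
    have := sM v vs; rewrite mem_cat; have := divz_eq v a.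
    have := modz_ge0 v az; have := ltz_pmod v (a0 : (0 < a%:Z)%R).
    move: (v %% a)%Z => r; case: (v %/ a)%Z => q r1 r0 e vM.
      apply/orP; left; apply: map_f; rewrite mem_iota add0n ltnS leq_divRL //.
      have : (Posz (q * a) = v - r)%R by rewrite e PoszM addrK.
      by lia.
    apply/orP; right; apply: map_f; rewrite mem_iota add0n ltnS leq_divRL //.
    have : (Posz (q.+1 * a) = r - v)%R by rewrite e PoszM NegzE mulNr opprD opprK addrC subrK.
    by lia.
  by rewrite mem_undup; apply: map_f.
have := uniq_leq_size (undup_uniq s) sub.
rewrite size_allpairs size_cat !size_map !size_iota => h.
have : c * a <= M by apply: leq_divM.
move=> ca; apply: leq_trans (leq_mul h (leqnn a)) _.
rewrite mulnAC mulnC leq_mul2l; apply/orP; right.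
by rewrite mulnDl mulSn; lia.
Qed.

End Arith.

Section Kits.
Local Open Scope ring_scope.
Variables (G : finZmodType) (h : int -> G) (p : nat).
Hypotheses (h0 : h 0 = 0) (hD : forall x y, h (x + y) = h x + h y).
Hypothesis h_inj : forall x, (absz x < p)%N -> h x = 0 -> x = 0.
Hypothesis cardG : #|G| = p.
Hypothesis genG : forall x : G, x != 0 -> gen [set x].

(* [Q] keeps gcd [1] and [n] distinct elements when any [e] of its elements are
   removed, and [Q0] alone already has [s0] subset sums. *)
Record kit (M e n s0 : nat) (Q0 Q : seq int) : Prop := Kit {
  kit_bound : forall v, v \in Q -> (absz v <= M)%N;
  kit_gcd : forall b, size b = size Q -> (size (mask b Q) <= e)%N ->
    forall g : nat, (1 < g)%N -> has (fun v : int => ~~ (g %| v)%Z) (mask (map negb b) Q);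
  kit_dist : forall b, size b = size Q -> (size (mask b Q) <= e)%N ->
    (n <= size (undup (mask (map negb b) Q)))%N;
  kit_sums : (s0 <= #|ssums (map h Q0)|)%N }.

Lemma kit_residues (M e n s0 : nat) Q0 Q (T : {set G}) b L a t :
  kit M e n s0 Q0 Q -> size b = size Q ->
  (size (mask b (map h Q)) * L <= p)%N -> (p < e.+1 * L)%N ->
  (forall q, q \in mask (map negb b) (map h Q) -> lam T q <= L)%N ->
  (0 < a <= M)%N ->
  exists us : seq int, exists k : nat,
  [/\ uniq [seq (u %% a)%Z | u <- us],
    (minn a (t * k) <= size us)%N, (n * a <= k * (4 * M))%N &
    forall u, u \in us -> (absz u <= 3 * t * M)%N /\ (lam T (h u) <= 3 * t * L)%N].
Proof.
move=> kQ sb bp pe TL aM; rewrite -map_mask size_map in bp.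
have be : (size (mask b Q) <= e)%N.
  by rewrite -ltnS -(ltn_pmul2r (_ : 0 < L)%N); lia.
rewrite -map_mask in TL; set Vs := mask (map negb b) Q in TL.
have VM v : v \in Vs -> (absz v <= M)%N /\ (lam T (h v) <= L)%N.
  by move=> vV; split; [apply: (kit_bound kQ); apply: mem_mask vV | apply/TL/map_f].
have [us [uus sus usB]] := @lam_residues G h T h0 hD a L M t _ Vs
   (proj1 (andP aM)) VM (kit_gcd kQ sb be) (leqnn _).
exists us, (size (undup [seq (v %% a)%Z | v <- Vs])); split=> //.
apply: leq_trans (card_residues aM (fun v vV => proj1 (VM v vV))).
by rewrite leq_mul2r (kit_dist kQ sb be) orbT.
Qed.

Lemma kit_growth_weak (M e n s0 L t R R' H l : nat) Q0 Q (A : seq int) :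
  kit M e n s0 Q0 Q -> (p < e.+1 * L)%N ->
  (4 * R <= t * n)%N -> (2 * R' <= R)%N -> (R <= M)%N ->
  (12 * (3 * t * L + H * l) <= s0)%N -> (24 * (3 * t * L + H * l) < R' * H)%N ->
  (2 * (3 * t * M + H * M) < p)%N -> (0 < t)%N ->
  (forall a, a \in A -> M < 2 * absz a <= 2 * M)%N ->
  (p <= 2 * #|ssums (map h (Q0 ++ Q ++ A))|)%N \/
  (l * size A <= #|ssums (map h (Q0 ++ Q ++ A))|)%N.
Proof.
move=> kQ pe Rn RR RM sl lR MH t0 AM; rewrite !map_cat.
have L0 : (0 < L)%N by case: (L) pe; rewrite ?muln0.
have [] := @growth_process G _ h (map h Q0) (map h Q) A (fun=> l) (p.-1 %/ 2) L.
- move=> b T sb QT TB bT TL z zA; rewrite size_map in sb.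
  have TG : (2 * #|T| < #|G|)%N.
    move: TB; rewrite leq_divRL // cardG => TB.
    by have : (0 < p)%N by [lia]; lia.
  have bp : (size (mask b (map h Q)) * L <= p)%N.
    by move: TG; rewrite cardG; lia.
  have sT : (s0 <= #|T|)%N := leq_trans (kit_sums kQ) (subset_leq_card QT).
  pose a := absz z; have -> : lam T (h z) = lam T (h a).
    rewrite /a; case: (z) => k //.
    by rewrite NegzE (hN h0 hD) lamN abszN.
  have aM : (0 < a <= M)%N by have := AM z zA; rewrite -/a; lia.
  have [us [k [uus sus nk usB]]] := kit_residues t kQ sb bp pe TL aM.
  rewrite leqNgt; apply/negP => ll.
  have := weak_growth h0 hD h_inj uus usB genG (proj1 (andP aM)) _ _ TG _ => /(_ H) wg.
  have : (R' * H <= 24 * (3 * t * L + H * l))%N; last by lia.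
  have Rus : (R' <= size us)%N.
    apply: leq_trans sus; rewrite leq_min; have := AM z zA; rewrite -/a => aM2.
    apply/andP; split; first by lia.
    have h1 : (4 * R * a <= t * n * a)%N by rewrite leq_mul2r Rn orbT.
    have h2 : (t * (n * a) <= t * (k * (4 * M)))%N by rewrite leq_mul2l nk orbT.
    have h3 : (R * a <= t * k * M)%N.
      by move: h1 h2; rewrite -!mulnA [(k * (4 * M))%N]mulnCA; lia.
    have h4 : (R * M <= R * (2 * a))%N by rewrite leq_mul2l; apply/orP; right; lia.
    have h5 : (R * M <= 2 * (t * k) * M)%N by lia.
    by move: h5; rewrite leq_pmul2r; lia.
  have Hl : (H * lam T (h a) <= H * l)%N by rewrite leq_mul2l ltnW ?orbT.
  apply: leq_trans (leq_mul Rus (leqnn H)) _; apply: leq_trans (wg _ _ _) _.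
  + have : (H * a <= H * M)%N by rewrite leq_mul2l (proj2 (andP aM)) orbT.
    by lia.
  + by apply: leq_trans sT; lia.
  + by rewrite !muln_gt0 t0.
  by lia.
- by rewrite ltn_divLR // mulnC => lt; left; apply: leq_trans lt; lia.
rewrite big_const_seq count_predT iter_addn_0 => le; right.
by apply: leq_trans le; rewrite leq_addl.
Qed.

Lemma kit_growth_sharp (M e n s0 L t D Bd : nat) Q0 Q (A : seq int) :
  kit M e n s0 Q0 Q -> (p < e.+1 * L)%N ->
  (4 * M <= t * n)%N -> (D * (3 * t * L) <= s0)%N -> (D * M <= s0)%N -> (5 < D)%N ->
  (2 * (3 * t * M + Bd) < p)%N -> (0 < s0)%N ->
  (forall a, a \in A -> 0 < absz a <= M)%N ->
  (Bd < #|ssums (map h (Q0 ++ Q ++ A))|)%N \/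
  ((D - 5) * (\sum_(a <- A) absz a) <= D.+1 * #|ssums (map h (Q0 ++ Q ++ A))|)%N.
Proof.
move=> kQ pe Mn LD MD D5 MB s00 AM; rewrite !map_cat.
have L0 : (0 < L)%N by case: (L) pe; rewrite ?muln0.
(* The ceiling of [(D - 5) |z| / (D + 1)], since [growth_process] counts in natural numbers. *)
pose g (z : int) := (((D - 5) * absz z + D) %/ D.+1)%N.
have [] := @growth_process G _ h (map h Q0) (map h Q) A g Bd L.
- move=> b T sb QT TB bT TL z zA; rewrite size_map in sb.
  have bp : (size (mask b (map h Q)) * L <= p)%N by lia.
  have sT : (s0 <= #|T|)%N := leq_trans (kit_sums kQ) (subset_leq_card QT).
  pose a := absz z; have -> : lam T (h z) = lam T (h a).
    rewrite /a; case: (z) => k //.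
    by rewrite NegzE (hN h0 hD) lamN abszN.
  have aM : (0 < a <= M)%N := AM z zA.
  have [us [k [uus sus nk usB]]] := kit_residues t kQ sb bp pe TL aM.
  have aus : (a <= size us)%N.
    apply: leq_trans sus; rewrite leq_min leqnn /=.
    have h1 : (4 * M * a <= t * n * a)%N by rewrite leq_mul2r Mn orbT.
    have h2 : (t * (n * a) <= t * (k * (4 * M)))%N by rewrite leq_mul2l nk orbT.
    have h3 : (a * (4 * M) <= t * k * (4 * M))%N by lia.
    by move: h3; rewrite leq_pmul2r; lia.
  have [a0 aM'] := andP aM.
  (* One representative per residue is kept, and shifts up to [H = s' / a] are used, so that [H a]
     matches the size of [T]. *)
  pose vs := take a us; pose s' := (#|T| - 3 * t * L)%N; pose H := (s' %/ a)%N.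
  have svs : size vs = a by rewrite size_takel.
  have uvs : uniq [seq (u %% a)%Z | u <- vs] by rewrite map_take take_uniq.
  have vsB u : u \in vs -> (absz u <= 3 * t * M)%N /\ (lam T (h u) <= 3 * t * L)%N.
    by move/mem_take/usB.
  have Ha : (H * a <= s')%N by apply: leq_divM.
  have aH : (s' < H.+1 * a)%N by apply: ltn_ceil.
  have ss : (s' <= #|T|)%N by apply: leq_subr.
  have lt : (2 * (3 * t * M + H * a) < p)%N by lia.
  have := sharp_growth h0 hD h_inj uvs vsB a0 lt; rewrite svs -/s' => main.
  have Ds : (D * (#|T| - s') <= #|T|)%N.
    apply: leq_trans (leq_trans LD sT); rewrite leq_mul2l /s'; apply/orP; right.
    by lia.
  have Da : (D * a <= #|T|)%N.
    by apply: leq_trans (leq_trans MD sT); rewrite leq_mul2l aM' orbT.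
  have T0 : (0 < #|T|)%N by apply: leq_trans sT.
  have := sharp_arith a0 T0 ss Ds Da D5 _ main; rewrite Ha aH => /(_ isT) fin.
  by rewrite /g -ltnS ltn_divLR // -/a; lia.
- by left.
move=> le; right.
have le2 : (\sum_(a <- A) g a <= #|ssums (map h Q0 ++ map h Q ++ map h A)|)%N.
  by apply: leq_trans le; rewrite leq_addl.
apply: leq_trans (leq_mul (leqnn D.+1) le2).
rewrite !big_distrr /=; apply: leq_sum => a _.
have := ltn_ceil ((D - 5) * absz a + D) (ltn0Sn D); rewrite -/(g a).
by rewrite mulSn mulnC; lia.
Qed.

End Kits.

(** * Selecting a kit from a robust sequence *)

Section KitSelection.
Local Open Scope nat_scope.

Lemma uniq_sub_perm (T : eqType) (B C : seq T) : uniq B -> {subset B <= C} ->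
  exists C', perm_eq C (B ++ C').
Proof.
elim: B C => [|x B ih] C /=; first by exists C.
case/andP=> xB uB sBC; have xC : x \in C by apply: sBC; rewrite mem_head.
have [|C' pC'] := ih (rem x C) uB.
  move=> y yB; have yx : y != x by apply: contraNneq xB => <-.
  have : y \in x :: rem x C by rewrite -(perm_mem (perm_to_rem xC)) sBC // inE yB orbT.
  by rewrite inE (negbTE yx).
by exists C'; apply: perm_trans (perm_to_rem xC) _; rewrite perm_cons.
Qed.

Lemma size_le_undup (T : eqType) (m : nat) (s : seq T) :
  (forall x, count_mem x s <= m) -> size s <= size (undup s) * m.
Proof.
move=> sm; rewrite -[leqLHS](perm_size (perm_count_undup s)) size_flatten /shape -map_comp.
elim: (undup s) => //= x u ih; rewrite mulSn leq_add //.
by rewrite size_nseq.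
Qed.

Definition robust E (C : seq int) :=
  forall g : nat, 1 < g -> E < count (fun v : int => ~~ (g %| v)%Z) C.

(** An element not divisible by [k] replaces [k] by a proper divisor [gcd(k, x)], hence by at most
    [k / 2]; after at most [r] choices the gcd is 1. *)
Lemma coprime_block_aux (C : seq int) r k : 0 < k <= 2 ^ r ->
  (forall g : nat, 1 < g -> has (fun v : int => ~~ (g %| v)%Z) C) ->
  exists B : seq int, [/\ {subset B <= C}, size B <= r &
    forall g : nat, 1 < g -> g %| k -> has (fun v : int => ~~ (g %| v)%Z) B].
Proof.
move=> + hC; elim: r k => [|r ih] k /andP[k0 kr].
  exists [::]; split=> // g g1; have -> : k = 1 by lia.
  by rewrite dvdn1 => /eqP e; rewrite e in g1.
have [k1|k1] := leqP k 1.
  exists [::]; split=> // g g1; have -> : k = 1 by lia.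
  by rewrite dvdn1 => /eqP e; rewrite e in g1.
have /hasP[x xC kx] := hC k k1.
have gk : gcdn k (absz x) %| k by apply: dvdn_gcdl.
have gnk : gcdn k (absz x) != k.
  apply: contra kx => /eqP e; rewrite -e; exact: dvdn_gcdr.
have gk0 : 0 < gcdn k (absz x) by rewrite gcdn_gt0 k0.
have [|B [BC sB hB]] := ih (gcdn k (absz x)).
  rewrite gk0 /=; move: gk gnk kr k0; move: (gcdn _ _) => u /dvdnP[[|[|q]] ->].
  - by [].
  - by rewrite mul1n eqxx.
  by rewrite expnS => _; nia.
exists (x :: B); split=> //=.
  by move=> y; rewrite inE => /orP[/eqP->|/BC].
move=> g g1 gdk; have [gx|//] := boolP (g %| x)%Z; rewrite ?gx //=.
by apply: hB => //; rewrite dvdn_gcd gdk.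
Qed.

Lemma coprime_block (C : seq int) r :
  (forall v, v \in C -> 0 < absz v <= 2 ^ r) ->
  (forall g : nat, 1 < g -> has (fun v : int => ~~ (g %| v)%Z) C) ->
  exists B C' : seq int, [/\ perm_eq C (B ++ C'), 0 < size B <= r.+1 &
    forall g : nat, 1 < g -> has (fun v : int => ~~ (g %| v)%Z) B].
Proof.
move=> Cr hC; have /hasP[x xC _] := hC 2 isT.
have [B [BC sB hB]] := coprime_block_aux (Cr x xC) hC.
have [|C' pC'] := @uniq_sub_perm _ (undup (x :: B)) C (undup_uniq _).
  by move=> y; rewrite mem_undup inE => /orP[/eqP->|/BC].
exists (undup (x :: B)), C'; split=> //.
  rewrite (leq_trans (size_undup _)) ?ltnS // andbT.
  by case e: (undup _) => //; have := mem_undup (x :: B) x; rewrite e inE eqxx.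
move=> g g1; have [gx|gx] := boolP (g %| absz x).
  have /hasP[y yB gy] := hB g g1 gx.
  by apply/hasP; exists y; rewrite ?mem_undup ?inE ?yB ?orbT.
by apply/hasP; exists x; rewrite ?mem_undup ?mem_head.
Qed.

Lemma robust_catr E K (C B C' : seq int) :
  perm_eq C (B ++ C') -> size B <= K -> K <= E -> robust E C -> robust (E - K) C'.
Proof.
move=> /permP pC BK KE rC g g1; move: (rC g g1); rewrite pC count_cat.
have := leq_trans (count_size (fun v : int => ~~ (g %| v)%Z) B) BK.
by move: (count _ B) (count _ C') => x y; lia.
Qed.

(** [Q] is a union of [N] disjoint blocks of gcd 1. Every [g > 1] fails to divide some element of
    each block, so fewer than [N] deletions create no common divisor. Robustness of what remains
    allows the extraction to be repeated. *)
Lemma robust_blocks N E r (C : seq int) :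
  (forall v, v \in C -> 0 < absz v <= 2 ^ r) -> robust E C -> N * r.+1 <= E ->
  exists Q C' : seq int, [/\ perm_eq C (Q ++ C'), size Q <= N * r.+1, N <= size Q &
    forall g : nat, 1 < g -> N <= count (fun v : int => ~~ (g %| v)%Z) Q].
Proof.
move=> Cr rC; elim: N => [|N ih] NE; first by exists [::], C.
have [|Q [C' [pC sQ NQ hQ]]] := ih; first by rewrite mulSn in NE; lia.
have NE' : N * r.+1 <= E by rewrite mulSn in NE; lia.
have [||B [C'' [pB /andP[B0 sB] hB]]] := @coprime_block C' r.
- by move=> v vC; apply: Cr; rewrite (perm_mem pC) mem_cat vC orbT.
- move=> g g1; rewrite has_count; have := robust_catr pC sQ NE' rC g1; lia.
exists (Q ++ B), C''; split.
- by apply: perm_trans pC _; rewrite -catA perm_cat2l.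
- by rewrite size_cat mulSn addnC leq_add.
- by rewrite size_cat; lia.
by move=> g g1; have := hB g g1; rewrite has_count count_cat; have := hQ g g1; lia.
Qed.

End KitSelection.

Section Sums.
Local Open Scope ring_scope.

Lemma count_mask_negb (T : Type) (P : pred T) b (s : seq T) : size b = size s ->
  (count P (mask b s) + count P (mask (map negb b) s) = count P s)%N.
Proof.
elim: s b => [|x s ih] [|c b] //= [/ih e]; case: c => /=; rewrite -e; lia.
Qed.

Lemma count_robust_big E K (P : pred int) (C B C' : seq int) :
  perm_eq C (B ++ C') -> (size B <= K)%N -> (K <= E)%N -> (E < count P C)%N ->
  (E - K < count P C')%N.
Proof.
move=> /permP pC BK KE; rewrite pC count_cat.
have := leq_trans (count_size P B) BK.
by move: (count P B) (count P C') => x y; lia.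
Qed.

Lemma mask_sum_bound (s : seq int) b :
  (absz (\sum_(v <- mask b s) v)%R <= \sum_(v <- s) absz v)%N.
Proof.
elim: s b => [|v s ih] [|c b]; rewrite ?mask0s /= ?big_nil //.
have := ih b; case: c; rewrite !big_cons; move: (\sum_(v <- mask b s) v)%R.
  by move=> u; lia.
by move=> u; lia.
Qed.

Lemma mask_sum_pos (s : seq int) b : (forall v, v \in s -> 0 <= v) ->
  0 <= \sum_(v <- mask b s) v <= (\sum_(v <- s) absz v)%N%:Z.
Proof.
move=> s0; have := mask_sum_bound s b.
have : 0 <= \sum_(v <- mask b s) v.
  by rewrite big_seq; apply: sumr_ge0 => v /mem_mask; apply: s0.
by lia.
Qed.

Lemma kit_sum_bound (M K : nat) (s : seq int) b : (size s <= K)%N ->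
  (forall v, v \in s -> absz v <= M)%N ->
  (absz (\sum_(v <- mask b s) v)%R <= K * M)%N.
Proof.
move=> sK sM; apply: leq_trans (mask_sum_bound s b) _.
apply: leq_trans (_ : (\sum_(v <- s) M <= _)%N).
  by rewrite !big_seq; apply: leq_sum.
by rewrite big_const_seq count_predT iter_addn_0 mulnC leq_mul2r sK orbT.
Qed.

(* The subset sums of [s1] and the numbers [- (y + sum s3)], with [y] a subset
   sum of [s2], are disjoint subsets of one interval. *)
Lemma zsf_interval (G : finZmodType) (h : int -> G) (s1 s2 s3 : seq G) (lo : int) len :
  zsf (s1 ++ s2 ++ s3) -> s3 != [::] ->
  (forall x, x \in ssums s1 -> exists2 z, lo <= z < lo + len%:Z & x = h z) ->
  (forall y, y \in ssums s2 ->
     exists2 z, lo <= z < lo + len%:Z & - (y + \sum_(u <- s3) u) = h z) ->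
  (#|ssums s1| + #|ssums s2| <= len)%N.
Proof.
move=> z n3 H1 H2; pose I := [set h (lo + (i : nat)%:Z) | i : 'I_len].
have HI x : (exists2 z, lo <= z < lo + len%:Z & x = h z) -> x \in I.
  case=> u /andP[lu ul] ->; have il : (absz (u - lo)%R < len)%N by lia.
  apply/imsetP; exists (Ordinal il) => //=; congr h; lia.
pose f (y : G) := - (y + \sum_(u <- s3) u).
have fi : injective f by move=> y y' /oppr_inj/addIr.
have : (#|I| <= len)%N by apply: leq_trans (leq_imset_card _ _) _; rewrite card_ord.
apply: leq_trans; rewrite -(card_imset (mem (ssums s2)) fi) -cardsUI.
set X := [set f y | y in _]; have -> : ssums s1 :&: X = set0.
  apply/setP => x; rewrite !inE; apply/negP => /andP[xs /imsetP[y ys e]].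
  by have := zsf_meet z n3 xs ys; rewrite e /f -addrA addNr eqxx.
rewrite cards0 addn0; apply: subset_leq_card; apply/subsetP => x.
rewrite inE => /orP[/H1/HI //|/imsetP[y ys ->]]; exact/HI/H2.
Qed.

End Sums.

Section Structure.
Local Open Scope ring_scope.
Variables (G : finZmodType) (h : int -> G) (p : nat).
Hypotheses (h0 : h 0 = 0) (hD : forall x y, h (x + y) = h x + h y).
Hypothesis h_inj : forall x, (absz x < p)%N -> h x = 0 -> x = 0.
Hypothesis cardG : #|G| = p.
Hypothesis genG : forall x : G, x != 0 -> gen [set x].

(** [Q0] consists of [3k] distinct elements and gets its sums from [ssums_quadratic]; [Q] comes from
    [robust_blocks]. After [e] deletions at least [m n] elements of [Q] remain, hence [n] distinct
    ones, as multiplicities are at most [m]. *)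
Lemma extract_kit (M e n s0 k r E N m : nat) (C : seq int) :
  robust E C -> (forall v, v \in C -> 0 < absz v <= M)%N -> (M <= 2 ^ r)%N ->
  (2 * M < p)%N -> (forall v, count_mem v C <= m)%N -> (0 < m)%N ->
  (e + m * n <= N)%N -> (e < N)%N -> (3 * k * m <= E)%N -> (24 < k <= p)%N ->
  (3 * k + N * r.+1 <= E)%N -> (2 * s0 <= p)%N -> (24 * s0 <= k ^ 2)%N ->
  exists Q0 Q C', [/\ perm_eq C ((Q0 ++ Q) ++ C'), (size (Q0 ++ Q) <= 3 * k + N * r.+1)%N &
    kit h M e n s0 Q0 Q].
Proof.
move=> rC CM Mr Mp Cm m0 eN eN' kE /andP[k24 kp] NE s0p s0k.
have sC : (E < size C)%N by apply: leq_trans (rC 2 isT) (count_size _ _).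
have uC : (3 * k <= size (undup C))%N.
  rewrite -(leq_pmul2r m0); apply: leq_trans kE _; apply: leq_trans (ltnW sC) _.
  exact: size_le_undup.
have [|C1 pC1] := @uniq_sub_perm _ (take (3 * k) (undup C)) C (take_uniq _ (undup_uniq C)).
  by move=> x /mem_take; rewrite mem_undup.
set Q0 := take _ _ in pC1; have sQ0 : size Q0 = (3 * k)%N by rewrite size_takel.
have rC1 : robust (E - 3 * k) C1 by apply: robust_catr pC1 _ _ rC; rewrite ?sQ0; lia.
have C1M v : v \in C1 -> (0 < absz v <= 2 ^ r)%N.
  move=> vC1; have /CM/andP[-> vM] : v \in C by rewrite (perm_mem pC1) mem_cat vC1 orbT.
  exact: leq_trans vM Mr.
have [|Q [C' [pC' sQ NQ hQ]]] := @robust_blocks N _ r C1 C1M rC1; first by lia.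
have pC : perm_eq C ((Q0 ++ Q) ++ C').
  by apply: perm_trans pC1 _; rewrite -catA perm_cat2l.
exists Q0, Q, C'; split=> //; first by rewrite size_cat sQ0 leq_add2l.
have QM v : v \in Q -> (absz v <= M)%N.
  move=> vQ; suff /CM/andP[] : v \in C by [].
  by rewrite (perm_mem pC) !mem_cat vQ orbT.
have Q0M v : v \in Q0 -> (0 < absz v <= M)%N by move=> /mem_take; rewrite mem_undup; apply: CM.
split=> //.
- move=> b sb be g g1; rewrite has_count; set P := fun _ => _.
  rewrite -(ltn_add2l (count P (mask b Q))) addn0 count_mask_negb //.
  apply: leq_ltn_trans (leq_trans (count_size _ _) be) _.
  exact: leq_trans eN' (hQ g g1).
- move=> b sb be; rewrite -(leq_pmul2r m0).
  apply: leq_trans (_ : (size (mask (map negb b) Q) <= _)%N).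
    have := count_mask_negb predT sb; rewrite !count_predT => sz.
    by rewrite mulnC; lia.
  apply: size_le_undup => x; apply: leq_trans (Cm x); rewrite (permP pC) !count_cat.
  by apply: leq_trans (leq_count_mask _ _ _) _; rewrite -addnA addnCA leq_addr.
have uQ : uniq (map h Q0).
  rewrite map_inj_in_uniq ?take_uniq ?undup_uniq // => x y.
  by move=> /Q0M/andP[_ xM] /Q0M/andP[_ yM]; apply: (h_inj2 h0 hD h_inj Mp).
have nzQ : all (fun x => x != 0) (map h Q0).
  rewrite all_map; apply/allP => v /Q0M/andP[v0 vM] /=; apply/eqP => /h_inj v0'.
  by move: v0; rewrite v0' //; lia.
have sz : size (map h Q0) = (3 * k)%N by rewrite size_map.
have kG : (k <= #|G|)%N by rewrite cardG.
case: (ssums_quadratic genG uQ nzQ sz k24 kG) => le.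
  by rewrite -(leq_pmul2l (isT : 0 < 2)%N); apply: leq_trans le; rewrite cardG.
by rewrite -(leq_pmul2l (isT : 0 < 24)%N); apply: leq_trans le.
Qed.

(* Two disjoint subsequences both having more than half of the group as subset
   sums would produce a zero sum. *)
Lemma few_big (M e n s0 L t R R' H l : nat) Q01 Q1 Q02 Q2 (A1 A2 : seq int) x :
  zsf (map h ((Q01 ++ Q1 ++ A1) ++ x :: (Q02 ++ Q2 ++ A2))) -> odd p ->
  kit h M e n s0 Q01 Q1 -> kit h M e n s0 Q02 Q2 -> (p < e.+1 * L)%N ->
  (4 * R <= t * n)%N -> (2 * R' <= R)%N -> (R <= M)%N ->
  (12 * (3 * t * L + H * l) <= s0)%N -> (24 * (3 * t * L + H * l) < R' * H)%N ->
  (2 * (3 * t * M + H * M) < p)%N -> (0 < t)%N ->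
  (forall a, a \in A1 ++ A2 -> M < 2 * absz a <= 2 * M)%N ->
  (p <= l * size A1)%N -> (p <= l * size A2)%N -> False.
Proof.
move=> z op k1 k2 pe Rn RR RM sl lR MH t0 AM l1 l2.
have z0 : h x != 0.
  move: z; rewrite map_cat map_cons => /zsf_neq0; rewrite all_cat => /andP[_ /=].
  by case/andP.
rewrite map_cat map_cons in z.
have AM1 a : a \in A1 -> (M < 2 * absz a <= 2 * M)%N.
  by move=> aA; apply: AM; rewrite mem_cat aA.
have AM2 a : a \in A2 -> (M < 2 * absz a <= 2 * M)%N.
  by move=> aA; apply: AM; rewrite mem_cat aA orbT.
have g1 := kit_growth_weak h0 hD h_inj cardG genG k1 pe Rn RR RM sl lR MH t0 AM1.
have g2 := kit_growth_weak h0 hD h_inj cardG genG k2 pe Rn RR RM sl lR MH t0 AM2.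
have := zsf_card z; rewrite card_ssums_cons cardG.
move: z g1 g2; set s1 := map h (Q01 ++ _); set s2 := map h (Q02 ++ _) => z g1 g2 le.
have M0 : (0 < M)%N.
  by apply: leq_trans RM; case: (R) RR => //; case: (R') lR.
have p6 : (6 < p)%N.
  have : (0 < t * M)%N by rewrite muln_gt0 t0.
  by move: MH; rewrite -mulnA; lia.
have h1 : (p < 2 * #|ssums s1|)%N.
  have : (p <= 2 * #|ssums s1|)%N by case: g1; lia.
  by rewrite leq_eqVlt => /orP[/eqP ep|//]; move: op; rewrite ep oddM.
have h2 : (p < 2 * #|ssums s2|)%N.
  have : (p <= 2 * #|ssums s2|)%N by case: g2; lia.
  by rewrite leq_eqVlt => /orP[/eqP ep|//]; move: op; rewrite ep oddM.
have [es|ne] := eqVneq (ssums s2) setT.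
  by move: le; rewrite es cardsT cardG; lia.
have : (0 < lam (ssums s2) (h x))%N.
  apply: lam_gt0 => //; first exact: genG.
  by apply/set0Pn; exists 0; rewrite ssums0.
by lia.
Qed.

Lemma ssums_map (s : seq int) (y : G) : y \in ssums (map h s) ->
  exists2 b, y = h (\sum_(v <- mask b s) v) & True.
Proof.
case/ssumsP => b ->; exists b => //; rewrite -map_mask big_map.
by elim: (mask b s) => [|v u ih]; rewrite ?big_nil ?h0 // !big_cons hD ih.
Qed.

End Structure.

(** * Zero-sum-free sequences of small integers *)

Lemma prefix_sum (M c : nat) (s : seq int) :
  (forall v, v \in s -> absz v <= M)%N -> (c <= \sum_(v <- s) absz v)%N ->
  exists s1 s2, s = s1 ++ s2 /\ (c <= \sum_(v <- s1) absz v <= c + M)%N.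
Proof.
elim: s c => [|v s ih] c sM.
  by rewrite big_nil leqn0 => /eqP ->; exists [::], [::]; rewrite big_nil.
rewrite big_cons => cs; have vM : (absz v <= M)%N by apply: sM; rewrite mem_head.
have [cv|vc] := leqP c (absz v).
  by exists [:: v], s; rewrite big_seq1; split=> //; lia.
have [||s1 [s2 [e /andP[b1 b2]]]] := ih (c - absz v)%N.
- by move=> u us; apply: sM; rewrite inE us orbT.
- by rewrite leq_subLR.
exists (v :: s1), s2; rewrite e big_cons; split=> //.
by move: b1 b2; move: (\sum_(_ <- s1) _)%N => S; lia.
Qed.

Lemma zsf_sub (G : finZmodType) (s1 s2 : seq G) :
  (forall x, count_mem x s1 <= count_mem x s2)%N -> zsf s2 -> zsf s1.
Proof. by move=> s12 z u us; apply: z => x; apply: leq_trans (us x) (s12 x). Qed.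

Section Signs.
Local Open Scope ring_scope.

Lemma absz_sum_pos (s : seq int) : (forall v, v \in s -> 0 < v) ->
  \sum_(v <- s) v = (\sum_(v <- s) absz v)%N%:Z.
Proof.
elim: s => [|v s ih] s0; first by rewrite !big_nil.
rewrite !big_cons PoszD ih; last by move=> u us; apply: s0; rewrite inE us orbT.
by congr (_ + _); have := s0 v (mem_head _ _); lia.
Qed.

Lemma absz_sum_neg (s : seq int) : (forall v, v \in s -> v < 0) ->
  \sum_(v <- s) v = - (\sum_(v <- s) absz v)%N%:Z.
Proof.
elim: s => [|v s ih] s0; first by rewrite !big_nil.
rewrite !big_cons PoszD ih; last by move=> u us; apply: s0; rewrite inE us orbT.
by rewrite opprD; congr (_ + _); have := s0 v (mem_head _ _); lia.
Qed.

Lemma mask_pos_bound (s : seq int) b : (forall v, v \in s -> 0 < v) ->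
  0 <= \sum_(v <- mask b s) v <= (\sum_(v <- s) absz v)%N%:Z.
Proof. by move=> s0; apply: mask_sum_pos => v /s0/ltW. Qed.

Lemma mask_neg_bound (s : seq int) b : (forall v, v \in s -> v < 0) ->
  - (\sum_(v <- s) absz v)%N%:Z <= \sum_(v <- mask b s) v <= 0.
Proof.
move=> s0; have := mask_sum_bound s b; have : \sum_(v <- mask b s) v <= 0.
  by rewrite big_seq; apply: sumr_le0 => v /mem_mask/s0/ltW.
by move: (\sum_(v <- mask b s) v) => w; lia.
Qed.

End Signs.

Section Structure.
Local Open Scope ring_scope.
Variables (G : finZmodType) (h : int -> G) (p : nat).
Hypotheses (h0 : h 0 = 0) (hD : forall x y, h (x + y) = h x + h y).
Hypothesis h_inj : forall x, (absz x < p)%N -> h x = 0 -> x = 0.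
Hypothesis cardG : #|G| = p.
Hypothesis genG : forall x : G, x != 0 -> gen [set x].
Hypothesis hp : h p%:Z = 0.

Lemma zsf_map_perm (C L L' : seq int) : perm_eq C (L ++ L') -> zsf (map h C) -> zsf (map h L).
Proof.
move=> /(perm_map h) pC z; apply: (@zsf_catl _ _ (map h L')); apply: zsf_perm z.
by rewrite -map_cat.
Qed.

Lemma h_sum (s : seq int) : \sum_(u <- map h s) u = h (\sum_(v <- s) v).
Proof.
by rewrite big_map; elim: s => [|v u ih]; rewrite ?big_nil ?h0 // !big_cons hD ih.
Qed.

Definition small (M K : nat) (s : seq int) :=
  (size s <= K)%N /\ forall v, v \in s -> (absz v <= M)%N.

Section Contra.
Variables (M e n s0 L t e0 K : nat) (Q01 Q1 Q02 Q2 : seq int).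
Hypotheses (k1 : kit h M e n s0 Q01 Q1) (k2 : kit h M e n s0 Q02 Q2).
Hypotheses (sm1 : small M K (Q01 ++ Q1)) (sm2 : small M K (Q02 ++ Q2)).
Hypotheses (pe : (p < e.+1 * L)%N) (Mn : (4 * M <= t * n)%N).
Hypotheses (LD : (30 * (3 * t * L) <= s0)%N) (MD : (30 * M <= s0)%N).
Hypotheses (MB : (2 * (3 * t * M + e0) < p)%N) (s00 : (0 < s0)%N).

(** With [D = 30], [X] and [Y] together with their kits have at least [25 e0 / 31] subset sums each,
    whereas [zsf_interval] allows them [len < 50 e0 / 31] in all. [c], which is [p], [- p] or [0] in
    the uses, moves the negated sums over those of [X]; the margins [K M] absorb what the kits
    contribute. *)
Lemma dense_contra (X Y Z : seq int) (lo c : int) len :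
  (31 * len < 50 * e0)%N -> h c = 0 ->
  zsf (map h ((Q01 ++ Q1 ++ X) ++ (Q02 ++ Q2 ++ Y) ++ Z)) -> Z != [::] ->
  (forall v, v \in X -> 0 < absz v <= M)%N -> (forall v, v \in Y -> 0 < absz v <= M)%N ->
  (e0 <= \sum_(v <- X) absz v)%N -> (e0 <= \sum_(v <- Y) absz v)%N ->
  (forall b, lo + (K * M)%N%:Z <= \sum_(v <- mask b X) v < lo + len%:Z - (K * M)%N%:Z) ->
  (forall b, lo + (K * M)%N%:Z <= c - \sum_(v <- Z) v - \sum_(v <- mask b Y) v
      < lo + len%:Z - (K * M)%N%:Z) -> False.
Proof.
move=> ln hc z Zn XM YM Xe Ye HX HY.
have gX := kit_growth_sharp h0 hD h_inj cardG k1 pe Mn LD MD isT MB s00 XM.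
have gY := kit_growth_sharp h0 hD h_inj cardG k2 pe Mn LD MD isT MB s00 YM.
have split3 (A B W : seq int) y : small M K (A ++ B) -> y \in ssums (map h (A ++ B ++ W)) ->
  exists u b, (absz u <= K * M)%N /\ y = h (u + \sum_(v <- mask b W) v).
  move=> [sK sM] /(ssums_map h0 hD)[b -> _].
  have [b' sb eb] := resize_mask b (A ++ B ++ W); rewrite eb catA.
  rewrite -(cat_take_drop (size (A ++ B)) b') mask_cat; last first.
    by rewrite size_takel // sb catA [leqRHS]size_cat leq_addr.
  rewrite big_cat /=; eexists; eexists; split; last by [].
  exact: kit_sum_bound sK sM.
have le : (#|ssums (map h (Q01 ++ Q1 ++ X))| + #|ssums (map h (Q02 ++ Q2 ++ Y))| <= len)%N.
  apply: (@zsf_interval G h _ _ (map h Z) lo); first by rewrite -!map_cat.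
  - by rewrite -size_eq0 size_map size_eq0.
  - move=> x /(split3 _ _ _ _ sm1)[u [b [uK ->]]]; exists (u + \sum_(v <- mask b X) v) => //.
    by move: (HX b); move: (\sum_(v <- _) v) => w; lia.
  - move=> y /(split3 _ _ _ _ sm2)[u [b [uK ->]]]; rewrite h_sum.
    exists (c - \sum_(v <- Z) v - (u + \sum_(v <- mask b Y) v)).
      by move: (HY b); move: (\sum_(v <- Z) v) (\sum_(v <- _) v) => w w'; lia.
    rewrite -hD -(hN h0 hD); move: (\sum_(v <- Z) v) (u + _) => w w'.
    have -> : c - w - w' = c + - (w' + w) by ring.
    by rewrite [RHS]hD hc add0r.
have {}gX : (25 * e0 <= 31 * #|ssums (map h (Q01 ++ Q1 ++ X))|)%N by case: gX; lia.
have {}gY : (25 * e0 <= 31 * #|ssums (map h (Q02 ++ Q2 ++ Y))|)%N by case: gY; lia.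
by lia.
Qed.

Hypothesis len_e0 : (31 * (e0 + (2 * K + 4) * M).+1 < 50 * e0)%N.
Hypothesis e0p : (e0 + 2 * M < p)%N.

Lemma three_blocks (P : seq int) : (forall v, v \in P -> absz v <= M)%N ->
  (p + e0 + 2 * M <= \sum_(v <- P) absz v)%N ->
  exists X Y Z P', [/\ P = X ++ Y ++ Z ++ P', (e0 <= \sum_(v <- X) absz v <= e0 + M)%N,
    (e0 <= \sum_(v <- Y) absz v <= e0 + M)%N &
    (p - e0 <= \sum_(v <- Z) absz v <= p - e0 + M)%N].
Proof.
move=> PM big.
have [|X [P1 [eP /andP[X1 X2]]]] := @prefix_sum M e0 P PM; first by lia.
have sP : (\sum_(v <- P) absz v = \sum_(v <- X) absz v + \sum_(v <- P1) absz v)%N.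
  by rewrite eP big_cat.
have P1M v : v \in P1 -> (absz v <= M)%N.
  by move=> vP; apply: PM; rewrite eP mem_cat vP orbT.
have [|Y [P2 [eP1 /andP[Y1 Y2]]]] := @prefix_sum M e0 P1 P1M; first by lia.
have sP1 : (\sum_(v <- P1) absz v = \sum_(v <- Y) absz v + \sum_(v <- P2) absz v)%N.
  by rewrite eP1 big_cat.
have P2M v : v \in P2 -> (absz v <= M)%N.
  by move=> vP; apply: P1M; rewrite eP1 mem_cat vP orbT.
have [|Z [P3 [eP2 /andP[Z1 Z2]]]] := @prefix_sum M (p - e0) P2 P2M; first by lia.
by exists X, Y, Z, P3; rewrite eP eP1 eP2 X1 X2 Y1 Y2 Z1 Z2.
Qed.

(** Otherwise [P] contains disjoint [X] and [Y] of sum about [e0] and [Z] of sum about [p - e0], up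
    to sign. The subset sums of [X], and [p] (or [- p]) minus [Z] and a subset sum of [Y], then
    share an interval of length about [e0]. *)
Lemma same_sign_bound (sg : bool) (P : seq int) :
  zsf (map h ((Q01 ++ Q1) ++ (Q02 ++ Q2) ++ P)) ->
  (forall v, v \in P -> if sg then 0 < v <= M%:Z else - M%:Z <= v < 0) ->
  (\sum_(v <- P) absz v < p + e0 + 2 * M)%N.
Proof.
move=> z PM; rewrite ltnNge; apply/negP => big.
have PM' v : v \in P -> (0 < absz v <= M)%N by move/PM; case: (sg); lia.
have PM'' v : v \in P -> (absz v <= M)%N by move/PM'/andP => [].
have [X [Y [Z [P' [eP /andP[X1 X2] /andP[Y1 Y2] /andP[Z1 Z2]]]]]] := three_blocks PM'' big.
have sX : {subset X <= P} by move=> v vX; rewrite eP mem_cat vX.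
have sY : {subset Y <= P} by move=> v vY; rewrite eP !mem_cat vY orbT.
have sZ : {subset Z <= P} by move=> v vZ; rewrite eP !mem_cat vZ !orbT.
have zXYZ : zsf (map h ((Q01 ++ Q1 ++ X) ++ (Q02 ++ Q2 ++ Y) ++ Z)).
  apply: zsf_sub z => x; rewrite eP !map_cat !count_cat.
  by move: (count_mem x) => f; lia.
have Zn : Z != [::] by case: (Z) Z1; rewrite ?big_nil //; lia.
have [X0 Y0] : (forall v, v \in X -> 0 < absz v <= M)%N /\
  (forall v, v \in Y -> 0 < absz v <= M)%N by split=> v; [move/sX/PM'|move/sY/PM'].
case: sg PM => PM.
  have pos (W : seq int) : {subset W <= P} -> forall v, v \in W -> 0 < v.
    by move=> sW v /sW/PM/andP[].
  apply: (@dense_contra X Y Z (- ((K + 2) * M)%N%:Z) p%:Z _ len_e0) => //.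
    move=> b; have := mask_pos_bound b (pos _ sX).
    by move: (\sum_(v <- mask b X) v) => w; lia.
  move=> b; have := mask_pos_bound b (pos _ sY); rewrite (absz_sum_pos (pos _ sZ)).
  by move: (\sum_(v <- mask b Y) v) => w; lia.
have neg (W : seq int) : {subset W <= P} -> forall v, v \in W -> v < 0.
  by move=> sW v /sW/PM/andP[].
apply: (@dense_contra X Y Z (- (e0 + (K + 1) * M)%N%:Z) (- p%:Z) _ len_e0) => //.
- by rewrite (hN h0 hD) hp oppr0.
- move=> b; have := mask_neg_bound b (neg _ sX).
  by move: (\sum_(v <- mask b X) v) => w; lia.
move=> b; have := mask_neg_bound b (neg _ sY); rewrite (absz_sum_neg (neg _ sZ)).
by move: (\sum_(v <- mask b Y) v) => w; lia.
Qed.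

(** Subset sums of a part of [P] and negated subset sums of a part of [N] share an interval of
    length about [e0]. One further element [u] of [P] is set aside to exclude the trivial
    coincidence [0 = 0]; this is why the bound for [P] has the extra [M]. *)
Lemma opposite_sums (P N : seq int) :
  zsf (map h ((Q01 ++ Q1) ++ (Q02 ++ Q2) ++ P ++ N)) ->
  (forall v, v \in P -> 0 < v <= M%:Z) -> (forall v, v \in N -> - M%:Z <= v < 0) ->
  (\sum_(v <- P) absz v <= e0 + M)%N \/ (\sum_(v <- N) absz v <= e0)%N.
Proof.
move=> z PM NM.
have [?|Pbig] := leqP (\sum_(v <- P) absz v) (e0 + M); first by left.
have [?|Nbig] := leqP (\sum_(v <- N) absz v) e0; first by right.
exfalso.
have PM' v : v \in P -> (absz v <= M)%N by move/PM; lia.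
have NM' v : v \in N -> (absz v <= M)%N by move/NM; lia.
have [|X [P1 [eP /andP[X1 X2]]]] := @prefix_sum M e0 P PM'; first by lia.
have sP : (\sum_(v <- P) absz v = \sum_(v <- X) absz v + \sum_(v <- P1) absz v)%N.
  by rewrite eP big_cat.
have [|Y [N1 [eN /andP[Y1 Y2]]]] := @prefix_sum M e0 N NM'; first by lia.
case: P1 eP sP => [|u P1] eP sP; first by rewrite big_nil in sP; lia.
have uP : u \in P by rewrite eP mem_cat mem_head orbT.
have Xpos v : v \in X -> 0 < v by move=> vX; have := PM v; rewrite eP mem_cat vX => /(_ isT)/andP[].
have Yneg v : v \in Y -> v < 0 by move=> vY; have := NM v; rewrite eN mem_cat vY => /(_ isT)/andP[].
apply: (@dense_contra X Y [:: u] (- ((K + 2) * M)%N%:Z) 0 (e0 + (2 * K + 4) * M).+1) => //.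
- apply: zsf_sub z => x; rewrite eP eN !map_cat !count_cat map_cons /=.
  by move: (count_mem x) => f; lia.
- by move=> v vX; have := PM v; rewrite eP mem_cat vX => /(_ isT); lia.
- by move=> v vY; have := NM v; rewrite eN mem_cat vY => /(_ isT); lia.
- move=> b; have := mask_pos_bound b Xpos.
  by move: (\sum_(v <- mask b X) v) => w; lia.
move=> b; have := mask_neg_bound b Yneg; rewrite big_seq1; have := PM u uP.
by move: (\sum_(v <- mask b Y) v) => w; lia.
Qed.

End Contra.

(* [C] is robust: it keeps gcd [1] and a large element when [E] elements are removed.
   Two disjoint kits are set apart; then [few_big] forces [M < R], and the remaining
   elements of each sign have small sum. *)
Theorem structure_int (M r E m e n s0 k N K L t R R' H l q e0 : nat) (C : seq int) :
  odd p -> zsf (map h C) -> robust E C ->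
  (forall v, v \in C -> 0 < absz v <= M)%N -> (E < count (fun v => M < 2 * absz v) C)%N ->
  (forall v, count_mem v C <= m)%N -> (0 < m)%N ->
  (M <= 2 ^ r)%N -> K = (3 * k + N * r.+1)%N ->
  (e + m * n <= N)%N -> (e < N)%N -> (3 * k * m <= E - K)%N -> (2 * K <= E)%N ->
  (24 < k <= p)%N -> (2 * s0 <= p)%N -> (24 * s0 <= k ^ 2)%N ->
  (p < e.+1 * L)%N -> (4 * R <= t * n)%N -> (2 * R' <= R)%N ->
  (12 * (3 * t * L + H * l) <= s0)%N -> (24 * (3 * t * L + H * l) < R' * H)%N ->
  (2 * (3 * t * M + H * M) < p)%N -> (0 < t)%N ->
  (p <= l * q)%N -> (2 * q < E - 2 * K)%N ->
  (30 * (3 * t * L) <= s0)%N -> (30 * R <= s0)%N -> (0 < s0)%N ->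
  (2 * (3 * t * R + e0) < p)%N ->
  (31 * (e0 + (2 * K + 4) * R).+1 < 50 * e0)%N ->
  exists K' P N', [/\ perm_eq C (K' ++ P ++ N'), (size K' <= 2 * K)%N,
    (forall v, v \in P -> 0 < v) /\ (forall v, v \in N' -> v < 0),
    (\sum_(v <- P) absz v <= p + 2 * e0)%N /\ (\sum_(v <- N') absz v <= p + 2 * e0)%N &
    (\sum_(v <- P) absz v <= 2 * e0)%N \/ (\sum_(v <- N') absz v <= 2 * e0)%N].
Proof.
move=> op z rC CM Cbig Cm m0 Mr KE eN eN' kE KE2 kp s0p s0k pe Rn RR sl lR MH t0 lq qE
  LD MD s00 MB len0.
have Mp : (2 * M < p)%N.
  apply: leq_ltn_trans MH; rewrite leq_mul2l; apply/orP; right.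
  by apply: leq_trans (leq_addr _ _); rewrite leq_pmull // muln_gt0 t0.
have nKE : (3 * k + N * r.+1 <= E)%N by lia.
have kE' : (3 * k * m <= E)%N by lia.
have [Q01 [Q1 [C1 [pC sK1 k1]]]] := extract_kit h0 hD h_inj cardG genG rC CM Mr Mp Cm m0
  eN eN' kE' kp nKE s0p s0k.
rewrite -KE in sK1; have KEle : (K <= E)%N by lia.
have rC1 := robust_catr pC sK1 KEle rC.
have sub1 : {subset C1 <= C} by move=> v vC; rewrite (perm_mem pC) mem_cat vC orbT.
have C1M v : v \in C1 -> (0 < absz v <= M)%N by move/sub1/CM.
have C1m v : (count_mem v C1 <= m)%N.
  by apply: leq_trans (Cm v); rewrite (permP pC) count_cat leq_addl.
have nKE1 : (3 * k + N * r.+1 <= E - K)%N by lia.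
have [Q02 [Q2 [C2 [pC1 sK2 k2]]]] := extract_kit h0 hD h_inj cardG genG rC1 C1M Mr Mp C1m m0
  eN eN' kE kp nKE1 s0p s0k.
rewrite -KE in sK2.
have pC2 : perm_eq C ((Q01 ++ Q1) ++ (Q02 ++ Q2) ++ C2).
  by apply: perm_trans pC _; rewrite perm_cat2l.
have C2M v : v \in C2 -> (0 < absz v <= M)%N.
  by move=> vC; apply: C1M; rewrite (perm_mem pC1) mem_cat vC orbT.
have MR : (M < R)%N.
  rewrite ltnNge; apply/negP => RM.
  pose big := [pred v : int | M < 2 * absz v]%N.
  have pC2' : perm_eq C (((Q01 ++ Q1) ++ (Q02 ++ Q2)) ++ C2) by rewrite -catA.
  have sQQ : (size ((Q01 ++ Q1) ++ (Q02 ++ Q2)) <= 2 * K)%N.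
    by rewrite size_cat mul2n -addnn leq_add.
  have nbig : (E - 2 * K < count big C2)%N := count_robust_big pC2' sQQ KE2 Cbig.
  (* More than [2q] elements exceed [M / 2]: one is set aside as [x], and the others form two groups
     of at least [q], each able to create [l q >= p] sums. *)
  pose B := filter big C2; have sB : (2 * q < size B)%N.
    by rewrite size_filter; apply: ltn_trans qE nbig.
  case eB: B sB => [|x B'] //; rewrite /= ltnS => sB.
  pose A1 := take q B'; pose A2 := drop q B'.
  have sA1 : (size A1 = q)%N by rewrite size_takel //; lia.
  have sA2 : (q <= size A2)%N by rewrite size_drop; lia.
  apply: (@few_big G h p h0 hD h_inj cardG genG M e n s0 L t R R' H l Q01 Q1 Q02 Q2 A1 A2 x)
    => //.
  - apply: zsf_sub z => y; rewrite !count_map (permP pC2) !count_cat /= !count_cat.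
    have : (count (preim h (pred1 y)) B <= count (preim h (pred1 y)) C2)%N.
      by apply: leq_count_subseq; apply: filter_subseq.
    rewrite eB /= -[B'](cat_take_drop q) -/A1 -/A2 count_cat.
    by move: (count (preim h (pred1 y))) => f; lia.
  - move=> a; rewrite cat_take_drop => aB; have : a \in B by rewrite eB inE aB orbT.
    by rewrite mem_filter => /andP[/= ab /C2M/andP[_ aM]]; rewrite ab leq_mul2l aM orbT.
  - by rewrite sA1.
  by apply: leq_trans lq _; rewrite leq_mul2l sA2 orbT.
have MR' : (M <= R)%N := ltnW MR.
have Mn : (4 * M <= t * n)%N by apply: leq_trans Rn; rewrite leq_mul2l.
have MD' : (30 * M <= s0)%N by apply: leq_trans MD; rewrite leq_mul2l.
have MB' : (2 * (3 * t * M + e0) < p)%N.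
  by apply: leq_ltn_trans MB; rewrite leq_mul2l leq_add2r leq_mul2l MR' orbT.
have KM : ((2 * K + 4) * M <= (2 * K + 4) * R)%N by rewrite leq_mul2l MR' orbT.
have len1 : (31 * (e0 + (2 * K + 4) * M).+1 < 50 * e0)%N.
  by apply: leq_ltn_trans len0; rewrite leq_mul2l ltnS leq_add2l.
have M2e : (2 * M <= e0)%N by move: len1 KM; rewrite mulnDl; lia.
have e0p : (e0 + 2 * M < p)%N.
  have : (M <= 3 * t * M)%N by rewrite leq_pmull // muln_gt0 t0.
  by move: MB'; clear; lia.
have CM' v : v \in C -> (absz v <= M)%N by move/CM/andP => [].
have sm1 : small M K (Q01 ++ Q1).
  by split=> // v vQ; apply: CM'; rewrite (perm_mem pC) mem_cat vQ.
have sm2 : small M K (Q02 ++ Q2).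
  by split=> // v vQ; apply/CM'/sub1; rewrite (perm_mem pC1) mem_cat vQ.
pose P := [seq v <- C2 | 0 < v]; pose N' := [seq v <- C2 | ~~ (0 < v)].
have pPN : perm_eq C2 (P ++ N') by rewrite perm_sym perm_filterC.
have PM v : v \in P -> 0 < v <= M%:Z by rewrite mem_filter => /andP[v0 /C2M]; clear -v0; lia.
have NM v : v \in N' -> - M%:Z <= v < 0.
  by rewrite mem_filter => /andP[v0 /C2M]; clear -v0; lia.
have pC3 : perm_eq C ((Q01 ++ Q1) ++ (Q02 ++ Q2) ++ P ++ N').
  by apply: perm_trans pC2 _; rewrite !perm_cat2l.
have zP : zsf (map h ((Q01 ++ Q1) ++ (Q02 ++ Q2) ++ P)).
  by apply: (zsf_map_perm (L' := N') _ z); rewrite -!catA in pC3 *.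
have zN : zsf (map h ((Q01 ++ Q1) ++ (Q02 ++ Q2) ++ N')).
  apply: (zsf_map_perm (L' := P) _ z); rewrite -!catA.
  apply: perm_trans pC3 _; rewrite -!catA !perm_cat2l; exact/permPl/perm_catC.
have zPN : zsf (map h ((Q01 ++ Q1) ++ (Q02 ++ Q2) ++ P ++ N')).
  by apply: (zsf_map_perm (L' := [::]) _ z); rewrite cats0.
exists ((Q01 ++ Q1) ++ (Q02 ++ Q2)), P, N'; split.
- by rewrite -catA.
- by rewrite size_cat mul2n -addnn leq_add.
- by split=> v; [case/PM/andP | case/NM/andP].
- have bd := same_sign_bound k1 k2 sm1 sm2 pe Mn LD MD' MB' s00 len1.
  split.
    have := bd e0p true P zP PM; clear -M2e; move: (\sum_(_ <- P) _)%N => S; lia.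
  have := bd e0p false N' zN NM; clear -M2e; move: (\sum_(_ <- N') _)%N => S; lia.
have := opposite_sums k1 k2 sm1 sm2 pe Mn LD MD' MB' s00 len1 e0p zPN PM NM.
by case=> le; [left|right]; apply: leq_trans le _; clear -M2e; lia.
Qed.

End Structure.

(** * The best dilation of a sequence in the prime field *)

Section PrimeField.
Local Open Scope ring_scope.
Variable p : nat.
Hypotheses (p_pr : prime p) (p_odd : odd p).
Let p_gt1 : (1 < p)%N := prime_gt1 p_pr.

Definition rep (x : 'Z_p) : int :=
  if (2 * val x < p)%N then (val x)%:Z else (val x)%:Z - p%:Z.

Definition hZ (z : int) : 'Z_p := z%:~R.

Lemma ltn_valZp (x : 'Z_p) : (val x < p)%N.
Proof. by rewrite -[X in (_ < X)%N](Zp_cast p_gt1) ltn_ord. Qed.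

Lemma hZ_nat n : hZ n%:Z = n%:R. Proof. by []. Qed.

Lemma hZ0 : hZ 0 = 0. Proof. by []. Qed.

Lemma hZD x y : hZ (x + y) = hZ x + hZ y. Proof. exact: intrD. Qed.

Lemma hZp : hZ p%:Z = 0. Proof. by rewrite hZ_nat pchar_Zp. Qed.

Lemma hZM x y : hZ (x * y) = hZ x * hZ y. Proof. exact: intrM. Qed.

Lemma hZ_val (x : 'Z_p) : hZ (val x)%:Z = x. Proof. exact: natr_Zp. Qed.

Lemma val_hZ (n : nat) : (n < p)%N -> val (hZ n%:Z) = n.
Proof. by move=> np; rewrite hZ_nat /= val_Zp_nat // modn_small. Qed.

Lemma hZ_inj x : (absz x < p)%N -> hZ x = 0 -> x = 0.
Proof.
have nat_case n : (n < p)%N -> hZ n%:Z = 0 -> n = 0%N.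
  by move=> np /(congr1 val); rewrite val_hZ.
case: x => n np; first by move/(nat_case n np) ->.
by rewrite NegzE (hN hZ0 hZD) => /eqP; rewrite oppr_eq0 => /eqP/(nat_case _ np).
Qed.

Lemma cardZp : #|'Z_p| = p. Proof. by rewrite card_ord Zp_cast. Qed.

Lemma Zp_unit (x : 'Z_p) : x != 0 -> x \is a GRing.unit.
Proof.
move=> x0; rewrite -[x]natr_Zp unitZpE // prime_coprime //.
apply: contra x0 => px.
have [v0|v0] := posnP (val x); first exact/eqP/val_inj.
by have := dvdn_leq v0 px; rewrite leqNgt ltn_valZp.
Qed.

Lemma genZp (x : 'Z_p) : x != 0 -> gen [set x].
Proof.
move=> x0 W W0 Wx; apply/setP => y; rewrite inE.
have -> : y = x *+ val (y / x).
  by rewrite -mulr_natr natr_Zp mulrC divrK // Zp_unit.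
elim: (val _) => [|k ih]; first by rewrite mulr0n.
by rewrite mulrSr; apply: Wx; rewrite ?set11.
Qed.

Lemma hZ_rep x : hZ (rep x) = x.
Proof.
rewrite /rep; case: ifP => _; first exact: hZ_val.
by rewrite hZD (hN hZ0 hZD) hZp subr0 hZ_val.
Qed.

Lemma rep_bound x : (2 * absz (rep x) < p)%N.
Proof.
have := ltn_valZp x; rewrite /rep; case: ifP => //= h1 h2.
have : (2 * val x)%N != p by apply: contraTneq p_odd => <-; rewrite oddM.
by move: h1 h2; move: (val x) => v; lia.
Qed.

Lemma rep_hZ z : (2 * absz z < p)%N -> rep (hZ z) = z.
Proof.
move=> zp; have Bp : (2 * p.-1./2 < p)%N by lia.
apply: (h_inj2 hZ0 hZD hZ_inj Bp); last by rewrite hZ_rep.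
  by have := rep_bound (hZ z); lia.
by lia.
Qed.

Lemma zsf_mul (d : 'Z_p) s : d != 0 -> zsf s -> zsf (map ( *%R d) s).
Proof.
move=> d0 z u us un; have du := Zp_unit d0.
have e : \sum_(x <- u) x = d * \sum_(x <- map ( *%R d^-1) u) x.
  by rewrite big_map big_distrr /=; apply: eq_bigr => x _; rewrite mulrA divrr ?mul1r.
have: \sum_(x <- map ( *%R d^-1) u) x != 0.
  apply: z; last by case: (u) un.
  move=> x; apply: (@leq_trans (count_mem (d * x) u)).
    rewrite count_map; apply: sub_count => y /= /eqP <-.
    by rewrite mulrA divrr ?mul1r.
  apply: leq_trans (us _) _; rewrite count_map; apply: sub_count => y /= /eqP e'.
  by apply/eqP; apply: (mulrI du).
by rewrite e; apply: contra => /eqP dx; apply/eqP/(mulrI du); rewrite dx mulr0.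
Qed.

Section Extremal.
Variables (M0 E r m : nat) (A : seq 'Z_p).
Hypotheses (zA : zsf A) (mA : forall x, (count_mem x A <= m)%N) (M0r : (M0 < 2 ^ r)%N).
Hypothesis bigA : (r.+1 * E < size A)%N.

Let far k (d : 'Z_p) := count (fun a : 'Z_p => M0 %/ 2 ^ k < absz (rep (d * a)%R))%N A.
Let near_all k := [exists d : 'Z_p, (d != 0) && (far k d <= k.+1 * E)%N].

(** Level [r] fails because [M0 / 2^r = 0], no element of [A] is dilated to [0], and [A] has more
    than [(r + 1) E] elements. The allowance grows by [E] at each halving, so that failure at level
    [k + 1] leaves more than [E] elements to argue with in [near_count]. *)
Lemma extremal_dilation : near_all 0 ->
  exists2 k, (k < r)%N & near_all k && ~~ near_all k.+1.
Proof.
move=> n0.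
have nr : ~~ near_all r.
  apply/existsP => -[d /andP[d0]]; rewrite leqNgt => /negP; apply.
  apply: leq_trans bigA _; rewrite -(count_predT A) /far divn_small //.
  rewrite -!size_filter; apply: eq_leq; congr size; apply: eq_in_filter => a aA.
  rewrite lt0n absz_eq0; apply/esym; apply/negP => /eqP r0.
  have : d * a = 0 by rewrite -[LHS]hZ_rep r0.
  move/(congr1 ( *%R d^-1)); rewrite mulrA mulVr ?Zp_unit // mul1r mulr0 => a0.
  by have /allP/(_ a aA) := zsf_neq0 zA; rewrite a0 eqxx.
have ex : exists k, ~~ near_all k by exists r.
case: (ex_minnP ex) => -[|k] nk kmin; first by rewrite n0 in nk.
exists k; first exact: kmin.
by rewrite nk andbT; apply: contraT => /kmin; rewrite ltnn.
Qed.

Variables (k : nat) (d : 'Z_p).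
Hypotheses (d0 : d != 0) (fard : (far k d <= k.+1 * E)%N) (nk : ~~ near_all k.+1).
Hypothesis M0p : (2 * M0 < p)%N.

Let M := (M0 %/ 2 ^ k)%N.
Let M1 := (M0 %/ 2 ^ k.+1)%N.
Let f (a : 'Z_p) := rep (d * a).
Let near := [seq a <- A | absz (f a) <= M]%N.
Let C := map f near.

Let M1E : M1 = (M %/ 2)%N. Proof. by rewrite /M1 expnSr divnMA. Qed.
Let M_le : (M <= M0)%N. Proof. exact: leq_div. Qed.

Lemma far_count (d' : 'Z_p) : d' != 0 -> (k.+2 * E < far k.+1 d')%N.
Proof.
move=> d'0; rewrite ltnNge; apply: contra nk => le.
by apply/existsP; exists d'; rewrite d'0.
Qed.

(* Elements that [d'] brings below [M / 2] would contradict the maximality of [k]. *)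
Lemma near_count (P : pred int) (d' : 'Z_p) : d' != 0 ->
  (forall a, absz (f a) <= M -> ~~ P (f a) -> absz (rep (d' * a)%R) <= M1)%N ->
  (E < count P C)%N.
Proof.
move=> d'0 H; have := far_count d'0; rewrite /far -/M1 => lt.
have : (count (fun a : 'Z_p => M1 < absz (rep (d' * a)%R)) A <=
    count (fun a => M < absz (f a)) A + count (fun a => P (f a)) near)%N.
  rewrite count_filter -count_predUI; apply: leq_trans (leq_addr _ _).
  apply: sub_count => a /= M1a; case: leqP => //= fa.
  have [//|Pf] := boolP (P (f a)).
  by move: M1a; rewrite ltnNge (H a fa Pf).
rewrite count_map; move: fard; rewrite /far -/M.
rewrite (_ : count (fun a => P (f a)) near = count (preim f P) near) //.
by move: lt; rewrite mulSn; move: (count _ _) (count _ _) (count _ _) => x y z; lia.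
Qed.

Let p2 n : (1 < n < p)%N -> hZ n%:Z != 0.
Proof.
by case/andP=> n1 np; apply/eqP => /(hZ_inj (np : absz n%:Z < p)%N) [n0]; rewrite n0 in n1.
Qed.

(** If [g] divides [f a], the dilation by [d / g] sends [a] to [f a / g], which is at most [M / 2];
    so if all but [E] elements were divisible, [d / g] would succeed at level [k + 1]. For [g > M]
    divisibility means [f a = 0], and [d] itself serves. *)
Lemma near_robust : robust E C.
Proof.
move=> g g1; have [gM|Mg] := leqP g M.
  have g0 : hZ g%:Z != 0 by apply: p2; rewrite g1; lia.
  have d'0 : d / hZ g%:Z != 0.
    apply: contra d0 => /eqP e; rewrite -[d](divrK (Zp_unit g0)) e.
    by rewrite mul0r.
  apply: (near_count d'0) => a fM; rewrite negbK => /dvdzP[b fb].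
  have bM1 : (absz b <= M1)%N.
    move: fM; rewrite fb abszM /= M1E leq_divRL // => le.
    by apply: leq_trans le; rewrite leq_mul2l g1 orbT.
  suff -> : rep (d / hZ g%:Z * a) = b by [].
  have -> : d / hZ g%:Z * a = hZ b.
    rewrite mulrAC -[d * a]hZ_rep -/(f a) fb hZM mulrK //; exact: Zp_unit.
  by apply: rep_hZ; move: bM1; rewrite M1E; have := leq_div M 2; lia.
apply: (near_count d0) => a fM; rewrite negbK => gf.
rewrite -/(f a); have [-> //|f0] := eqVneq (f a) 0.
have : (g <= absz (f a))%N by apply: dvdn_leq; rewrite ?absz_gt0.
by lia.
Qed.

Lemma near_big : (E < count (fun v => M < 2 * absz v)%N C)%N.
Proof.
apply: (near_count d0) => a _; rewrite -leqNgt M1E leq_divRL // mulnC; exact.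
Qed.

Lemma near_bound v : v \in C -> (0 < absz v <= M)%N.
Proof.
case/mapP=> a; rewrite mem_filter => /andP[aM aA] ->; rewrite aM andbT absz_gt0.
apply/eqP => fa0; have : d * a = 0 by rewrite -[LHS]hZ_rep -/(f a) fa0.
move/(congr1 ( *%R d^-1)); rewrite mulrA mulVr ?Zp_unit // mul1r mulr0 => a0.
by have /allP/(_ a aA) := zsf_neq0 zA; rewrite a0 eqxx.
Qed.

Lemma near_mult v : (count_mem v C <= m)%N.
Proof.
apply: leq_trans (mA (d^-1 * hZ v)); rewrite count_map.
apply: leq_trans (leq_count_subseq _ (filter_subseq _ _)); apply: sub_count => a /= /eqP <-.
by rewrite /f hZ_rep mulrA mulVr ?mul1r // Zp_unit.
Qed.

Lemma near_zsf : zsf (map hZ C).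
Proof.
rewrite -map_comp (@eq_map _ _ _ ( *%R d)); last by move=> a /=; rewrite /f hZ_rep.
apply: zsf_mul => //; apply: zsf_sub zA => x.
exact: leq_count_subseq (filter_subseq _ _).
Qed.

End Extremal.

Lemma val_sum_pos (d : 'Z_p) (P : seq int) : d != 0 -> (forall v, v \in P -> 0 < v) ->
  (forall v, v \in P -> absz v < p)%N ->
  (\sum_(x <- [seq (d^-1 * hZ v)%R | v <- P]) val (d * x)%R = \sum_(v <- P) absz v)%N.
Proof.
move=> d0 P0 Pp; rewrite big_map !big_seq; apply: eq_bigr => v vP.
rewrite mulrA mulrV ?Zp_unit // mul1r; have := P0 v vP; have := Pp v vP.
by case: v {vP} => // n np _; rewrite val_hZ.
Qed.

Theorem structure_Zp (M0 r E m e n s0 k N K L t R R' H l q e0 : nat) (A : seq 'Z_p) :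
  zsf A -> (forall x, count_mem x A <= m)%N -> (M0 < 2 ^ r)%N -> (r.+1 * E < size A)%N ->
  (exists2 d : 'Z_p, d != 0 & (count (fun a => M0 < absz (rep (d * a)%R)) A <= E)%N) ->
  (0 < m)%N -> K = (3 * k + N * r.+1)%N ->
  (e + m * n <= N)%N -> (e < N)%N -> (3 * k * m <= E - K)%N -> (2 * K <= E)%N ->
  (24 < k <= p)%N -> (2 * s0 <= p)%N -> (24 * s0 <= k ^ 2)%N ->
  (p < e.+1 * L)%N -> (4 * R <= t * n)%N -> (2 * R' <= R)%N ->
  (12 * (3 * t * L + H * l) <= s0)%N -> (24 * (3 * t * L + H * l) < R' * H)%N ->
  (2 * (3 * t * M0 + H * M0) < p)%N -> (0 < t)%N ->
  (p <= l * q)%N -> (2 * q < E - 2 * K)%N ->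
  (30 * (3 * t * L) <= s0)%N -> (30 * R <= s0)%N -> (0 < s0)%N ->
  (2 * (3 * t * R + e0) < p)%N ->
  (31 * (e0 + (2 * K + 4) * R).+1 < 50 * e0)%N ->
  exists2 d : 'Z_p, d != 0 & exists X P N', [/\ perm_eq A (X ++ P ++ N'),
    (size X <= 2 * K + r * E)%N,
    (\sum_(x <- P) val (d * x)%R <= p + 2 * e0)%N /\
    (\sum_(x <- N') val (- d * x)%R <= p + 2 * e0)%N &
    (\sum_(x <- P) val (d * x)%R <= 2 * e0)%N \/
    (\sum_(x <- N') val (- d * x)%R <= 2 * e0)%N].
Proof.
move=> zA mA M0r bA [xi xi0 fxi] m0 KE eN eN' kE KE2 kp s0p s0k pe Rn RR sl lR MH t0 lq qE
  LD MD s00 MB len0.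
have M0p : (2 * M0 < p)%N.
  apply: leq_ltn_trans MH; rewrite leq_mul2l; apply/orP; right.
  by apply: leq_trans (leq_addr _ _); rewrite leq_pmull // muln_gt0 t0.
have n0 : [exists d : 'Z_p, (d != 0) &&
    (count (fun a : 'Z_p => M0 %/ 2 ^ 0 < absz (rep (d * a)%R)) A <= 1 * E)%N].
  by apply/existsP; exists xi; rewrite xi0 mul1n expn0 divn1.
have [j jr /andP[/existsP[d /andP[d0 fard]] nk]] := extremal_dilation zA M0r bA n0.
have rC := near_robust M0r bA d0 fard nk M0p.
have bC := near_big M0r bA d0 fard nk M0p.
have CM := near_bound zA (M0 := M0) (k := j) d0.
have Cm := near_mult M0 mA j d0.
have zC := near_zsf (M0 := M0) zA (k := j) d0.
set M := (M0 %/ 2 ^ j)%N in fard rC bC CM Cm zC.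
set C := (map _ _) in rC bC CM Cm zC.
have MM0 : (M <= M0)%N by apply: leq_div.
have MH' : (2 * (3 * t * M + H * M) < p)%N.
  by apply: leq_ltn_trans MH; rewrite leq_mul2l leq_add // leq_mul2l MM0 orbT.
have Mr : (M <= 2 ^ r)%N by apply: leq_trans MM0 (ltnW M0r).
have [K' [P [N' [pC sK [P0 N0] sums small]]]] := structure_int hZ0 hZD hZ_inj cardZp genZp
  hZp p_odd zC rC CM bC Cm m0 Mr KE eN eN' kE KE2 kp s0p s0k pe Rn RR sl lR MH' t0 lq qE
  LD MD s00 MB len0.
have Cp v : v \in C -> (absz v < p)%N by move/CM/andP => [_ vM]; lia.
have Pp v : v \in P -> (absz v < p)%N.
  by move=> vP; apply: Cp; rewrite (perm_mem pC) !mem_cat vP orbT.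
have Np v : v \in N' -> (absz v < p)%N.
  by move=> vP; apply: Cp; rewrite (perm_mem pC) !mem_cat vP !orbT.
pose g v := d^-1 * hZ v.
have sumP : (\sum_(x <- map g P) val (d * x)%R = \sum_(v <- P) absz v)%N.
  exact: val_sum_pos.
have sumN : (\sum_(x <- map g N') val (- d * x)%R = \sum_(v <- N') absz v)%N.
  rewrite big_map !big_seq; apply: eq_bigr => v vN.
  rewrite mulNr /g mulrA mulrV ?Zp_unit // mul1r -(hN hZ0 hZD).
  by move: (N0 v vN) (Np v vN); case: (v) => // n' _ np; rewrite NegzE opprK val_hZ.
exists d => //.
pose F := [seq a : 'Z_p <- A | ~~ (absz (rep (d * a)%R) <= M)%N].
exists (F ++ map g K'), (map g P), (map g N').
rewrite sumP sumN; split=> //.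
  rewrite -catA -!map_cat; apply: (@perm_trans _ (map g C ++ F)); last first.
    by rewrite perm_catC perm_cat2l; apply: perm_map.
  rewrite /C -map_comp map_id_in; first by rewrite perm_sym; apply/permPl/perm_filterC.
  move=> a _ /=; rewrite /g hZ_rep mulrA mulVr ?mul1r //; exact: Zp_unit.
rewrite size_cat size_map addnC leq_add // size_filter.
apply: leq_trans (_ : (j.+1 * E <= _)%N); last by rewrite leq_mul2r jr orbT.
by apply: leq_trans fard; apply: sub_count => a; rewrite -ltnNge.
Qed.

End PrimeField.

From mathcomp Require Import finmap multiset.
From mathcomp Require Import all_classical all_reals all_analysis.
From mathcomp Require Import lra.
Import numFieldNormedType.Exports.
Local Open Scope classical_set_scope.
Local Open Scope ring_scope.

(** * Trigonometric bounds and the dilation of most elements near zero *)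

Section Trig.
Variable R : realType.
Implicit Types x y : R.

Lemma le_of_derive_ge0 (f df : R -> R) (a b : R) : a <= b ->
  (forall x, a <= x <= b -> is_derive x 1 f (df x)) ->
  (forall x, a <= x <= b -> 0 <= df x) -> f a <= f b.
Proof.
move=> ab fd df0.
have cf : {within `[a, b], continuous f}%classic.
  apply: derivable_within_continuous => x; rewrite in_itv /= => xab.
  by have [] := fd x xab.
have [|c cab e] := @MVT_segment R f df a b ab _ cf.
  by move=> x; rewrite in_itv /= => /andP[ax xb]; apply: fd; rewrite !ltW.
rewrite -subr_ge0 e mulr_ge0 ?subr_ge0 //.
by apply: df0; move: cab; rewrite in_itv.
Qed.

Lemma sin_le x : 0 <= x -> sin x <= x.
Proof.
move=> x0; rewrite -subr_ge0.
have := @le_of_derive_ge0 (fun x => x - sin x) (fun x => 1 - cos x) 0 x x0.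
rewrite sin0 subr0; apply.
by move=> y _; rewrite subr_ge0 cos_le1.
Qed.

Lemma mul_cos_le_sin x : 0 <= x <= pi -> x * cos x <= sin x.
Proof.
move=> /andP[x0 xpi]; rewrite -subr_ge0.
have := @le_of_derive_ge0 (fun x => sin x - x * cos x) (fun x => x * sin x) 0 x x0.
rewrite sin0 mul0r subr0; apply.
  move=> y _; apply: is_derive_eq; rewrite /GRing.scale /=; ring.
move=> y /andP[y0 yx]; rewrite mulr_ge0 // sin_ge0_pi // y0.
exact: le_trans yx xpi.
Qed.

Lemma sin2_le x : sin x ^+ 2 <= x ^+ 2.
Proof.
wlog x0 : x / 0 <= x.
  move=> h; have [|/ltW x0] := leP 0 x; first exact: h.
  by have := h (- x); rewrite oppr_ge0 sinN !sqrrN; apply.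
have [x1|x1] := leP x 1; last first.
  apply: le_trans (_ : 1 <= _); last by rewrite expr_ge1 // ltW.
  by rewrite sin2cos2 gerBl sqr_ge0.
rewrite ler_sqr ?nnegrE ?sin_le // sin_ge0_pi // x0.
by rewrite (le_trans x1) // (le_trans _ (pi_ge2 R)) // ler1n.
Qed.

Lemma sin2_ge x : `|x| <= pi / 2 -> x ^+ 2 * cos x ^+ 2 <= sin x ^+ 2.
Proof.
wlog x0 : x / 0 <= x.
  move=> h; have [|/ltW x0] := leP 0 x; first exact: h.
  by have := h (- x); rewrite oppr_ge0 normrN sinN cosN !sqrrN; apply.
rewrite ger0_norm // => xpi; have pi2 := pi_gt0 R.
have c0 : 0 <= cos x by apply: cos_ge0_pihalf; lra.
have xs : x * cos x <= sin x by apply: mul_cos_le_sin; lra.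
by rewrite -exprMn ler_sqr ?nnegrE ?mulr_ge0 // (le_trans _ xs) ?mulr_ge0.
Qed.

(** [sin2_ge] gives [sin^2 >= x^2 / (1 + x^2)], which is at least [x^2 / 5] as [pi / 2 < 2]; then
    [1 - y <= exp(- y)]. *)
Lemma cos2_le_expR x : `|x| <= pi / 2 -> cos x ^+ 2 <= expR (- (x ^+ 2 / 5)).
Proof.
move=> xpi; have := sin2_ge xpi; rewrite !cos2sin2; set s := sin x ^+ 2 => h.
have x2 : x ^+ 2 <= 4.
  have := pihalf_lt2 R; have := normr_ge0 x; rewrite -(real_normK (num_real x)); nra.
apply: le_trans (expR_ge1Dx _).
have s0 : 0 <= s by apply: sqr_ge0.
have xs : x ^+ 2 <= s * 5 by have := sqr_ge0 x; nra.
by lra.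
Qed.

End Trig.

(** * Counting zero sums with characters *)

Section CosineSums.
Variable R : realType.
Implicit Types (u : R).

Lemma cosD_cosB u (a : R) : cos (u - a) + cos (u + a) = 2 * cos a * cos u.
Proof. by rewrite cosB cosD; ring. Qed.

(** The sum of [cos (u + sum B)] over all subsequences [B], that is, the real part of [exp(iu)]
    times the product of the [1 + exp(ia)]. The factors [2 cos(a / 2)] are the moduli of
    [1 + exp(ia)] up to sign. *)
Fixpoint csum (s : seq R) u : R := if s is a :: s' then csum s' u + csum s' (u + a) else cos u.

Lemma csumE (s : seq R) u :
  csum s u = (\prod_(a <- s) (2 * cos (a / 2))) * cos (u + (\sum_(a <- s) a) / 2).
Proof.
elim: s u => [|a s ih] u /=; first by rewrite !big_nil mul0r addr0 mul1r.
rewrite !ih !big_cons -mulrDr.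
set w := u + (a + \sum_(b <- s) b) / 2; set S := \sum_(b <- s) b.
have -> : u + S / 2 = w - a / 2 by rewrite /w -/S; field.
have -> : u + a + S / 2 = w + a / 2 by rewrite /w -/S; field.
by rewrite cosD_cosB; ring.
Qed.

Lemma csum_le (s : seq R) u : `|csum s u| <= \prod_(a <- s) `|2 * cos (a / 2)|.
Proof. by rewrite csumE normrM normr_prod ler_piMr ?cos_max // prodr_ge0. Qed.

Variable p : nat.
Hypothesis p0 : (0 < p)%N.
Let pR : p%:R != 0 :> R. Proof. by rewrite pnatr_eq0 -lt0n. Qed.
Let al : R := pi *+ 2 / p%:R.

Lemma cos_mod (n : nat) : cos (al * n%:R) = cos (al * (n %% p)%:R).
Proof.
rewrite [in LHS](divn_eq n p) natrD natrM mulrDr addrC.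
have -> : al * ((n %/ p)%:R * p%:R) = pi *+ 2 *+ (n %/ p).
  by rewrite /al -[RHS]mulr_natr; field.
by rewrite periodicn //; exact: cosD2pi.
Qed.

Lemma sum_cos0 (t : nat) : ~~ (p %| t)%N -> \sum_(k < p) cos (al * (k * t)%N%:R) = 0.
Proof.
move=> pt; pose be : R := pi * t%:R / p%:R.
have sb : sin be != 0.
  have -> : be = pi * (t %% p)%:R / p%:R + pi *+ (t %/ p).
    by rewrite /be {1}(divn_eq t p) natrD natrM -[pi *+ _]mulr_natr; field.
  rewrite alternatingn; last exact: sinDpi.
  rewrite mulf_neq0 ?expf_neq0 ?oppr_eq0 ?oner_eq0 //.
  rewrite gt_eqF // sin_gt0_pi //; have tp := ltn_pmod t p0.
  have t0 : (0 < t %% p)%N by rewrite lt0n; apply: contra pt.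
  rewrite divr_gt0 ?mulr_gt0 ?pi_gt0 ?ltr0n //=.
  by rewrite ltr_pdivrMr ?ltr0n // ltr_pM2l ?pi_gt0 // ltr_nat.
apply: (mulfI sb); apply: (mulfI (_ : 2 != 0 :> R)); first by rewrite pnatr_eq0.
rewrite !mulr0 big_distrr big_distrr /=.
(* The sum telescopes after multiplication by [2 sin be], since [2 sin(be) cos(2 be k) = sin(2 be k
   + be) - sin(2 be k - be)]. *)
pose f (k : nat) := sin (2 * be * k%:R - be).
rewrite (eq_bigr (fun k : 'I_p => f k.+1 - f k)); last first.
  move=> k _; rewrite /f (_ : 2 * be * k.+1%:R - be = 2 * be * k%:R + be); last first.
    by rewrite -natr1; ring.
  rewrite sinB sinD (_ : al * (k * t)%:R = 2 * be * k%:R); first by ring.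
  by rewrite /al /be natrM -mulr_natr; field.
rewrite -(big_mkord xpredT (fun k => f k.+1 - f k)) telescope_sumr // /f.
have -> : 2 * be * p%:R - be = - be + pi *+ 2 *+ t.
  have eb : be * p%:R = pi * t%:R by rewrite /be divfK.
  by rewrite addrC; congr (_ + _); rewrite -mulrA eb -[RHS]mulr_natr -[pi *+ 2]mulr_natr mulrA [2 * pi]mulrC.
rewrite periodicn; last exact: sinD2pi.
by rewrite mulr0 add0r subrr.
Qed.

Fixpoint zero_sums (s : seq nat) (t : nat) : nat :=
  if s is a :: s' then zero_sums s' t + zero_sums s' (t + a) else (p %| t)%N.

(** Orthogonality of characters: a subsequence contributes [p] or [0] according to whether [p]
    divides its shifted sum. *)
Lemma sum_csum (s : seq nat) (t : nat) :
  \sum_(k < p) csum [seq al * (k * a)%N%:R | a : nat <- s] (al * (k * t)%N%:R) =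
  (p * zero_sums s t)%N%:R.
Proof.
elim: s t => [|a s ih] t /=.
  have [pt|pt] := boolP (p %| t)%N; last by rewrite sum_cos0 // muln0.
  rewrite (eq_bigr (fun _ => 1)); last first.
    move=> k _; rewrite cos_mod; have /eqP -> : (p %| k * t)%N by rewrite dvdn_mull.
    by rewrite mulr0 cos0.
  by rewrite sumr_const card_ord muln1.
rewrite big_split /= mulnDr natrD ih; congr (_ + _); rewrite -ih.
by apply: eq_bigr => k _; rewrite mulnDr natrD mulrDr.
Qed.

Lemma csum_zero (s : seq R) : all (pred1 0) s -> csum s 0 = 2 ^+ size s.
Proof.
elim: s => [|a s ih] /=; first by rewrite cos0.
by case/andP => /eqP -> /ih e; rewrite addr0 e exprS mulr_natl mulr2n.
Qed.

Lemma zero_sums_eq0 (s : seq nat) (t : nat) :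
  (forall b, ~~ (p %| t + \sum_(x <- mask b s) x)%N) -> zero_sums s t = 0%N.
Proof.
elim: s t => [|a s ih] t h /=.
  by have := h [::]; rewrite big_nil addn0 => /negbTE ->.
rewrite !ih //.
  by move=> b; have := h (true :: b); rewrite /= big_cons addnA.
by move=> b; exact: (h (false :: b)).
Qed.

(* The [p] terms sum to [p], and the one at [k = 0] is [2 ^ size s]. *)
Lemma exists_large_product (s : seq nat) : zero_sums s 0 = 1%N -> (2 * p <= 2 ^ size s)%N ->
  exists2 k, (0 < k < p)%N &
    2 ^+ size s / (2 * p%:R) <= \prod_(a <- s) `|2 * cos (al * (k * a)%N%:R / 2)| :> R.
Proof.
move=> z1 sz; set B := _ / _.
have B0 : 0 <= B by rewrite divr_ge0 // ?exprn_ge0 // mulr_ge0.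
pose P k : R := \prod_(a <- s) `|2 * cos (al * (k * a)%N%:R / 2)|.
suff /existsP[k /andP[k0 Bk]] : [exists k : 'I_p, (0 < k)%N && (B <= P k)].
  by exists k => //; rewrite k0 ltn_ord.
apply: contraT; rewrite negb_exists => /forallP h.
pose F (k : 'I_p) := csum [seq al * (k * a)%N%:R | a : nat <- s] (al * (k * 0)%N%:R).
have FP k : `|F k| <= P k by rewrite (le_trans (csum_le _ _)) // /P big_map.
pose o := Ordinal p0.
have Fo : F o = 2 ^+ size s.
  have -> : F o = csum [seq al * (o * a)%N%:R | a : nat <- s] 0.
    by congr csum; exact: mulr0.
  rewrite csum_zero ?size_map //; apply/allP => x /mapP[a _ ->]; apply/eqP.
  exact: mulr0.
have : \sum_k F k = p%:R by rewrite sum_csum z1 muln1.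
rewrite (bigD1 o) //= Fo => e.
have le1 : - \sum_(k < p | k != o) F k <= \sum_(k < p | k != o) B.
  rewrite -sumrN; apply: ler_sum => k ko; apply: le_trans (ler_norm _) _.
  rewrite normrN (le_trans (FP k)) // ltW // ltNge.
  have := h k; rewrite negb_and => /orP[|//]; rewrite -eqn0Ngt => /eqP k0.
  by case/eqP: ko; apply: val_inj.
have : \sum_(k < p) B = p%:R * B by rewrite sumr_const card_ord mulr_natl.
rewrite (bigD1 o) //= => e2.
have pB : p%:R * B = 2 ^+ size s / 2 by rewrite /B; field.
have : p%:R *+ 2 <= 2 ^+ size s :> R by rewrite -natrX -mulr_natl -natrM ler_nat.
have Bgt : 0 < B by rewrite divr_gt0 ?exprn_gt0 // mulr_gt0 // ltr0n.
by move: e le1 e2 pB; rewrite -[_ *+ 2]mulr_natr; lra.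
Qed.

End CosineSums.

Section Fourier.
Variables (R : realType) (p : nat).
Hypotheses (p_pr : prime p) (p_odd : odd p).
Let p0 : (0 < p)%N := prime_gt0 p_pr.
Let p1 : (1 < p)%N := prime_gt1 p_pr.
Let al : R := pi *+ 2 / p%:R.
Let pR : p%:R != 0 :> R. Proof. by rewrite pnatr_eq0 -lt0n. Qed.

Lemma sum_valZp (s : seq 'Z_p) :
  (\sum_(n <- map val s) n)%N%:R = \sum_(x <- s) x :> 'Z_p.
Proof.
elim: s => [|x s ih]; first by rewrite /= !big_nil.
by rewrite /= !big_cons natrD ih natr_Zp.
Qed.

Lemma dvdn_sum_val (s : seq 'Z_p) : (p %| \sum_(n <- map val s) n)%N = (\sum_(x <- s) x == 0).
Proof.
rewrite -sum_valZp -(inj_eq val_inj) /= val_Zp_nat //.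
Qed.

(** The one zero sum left is that of the empty subsequence. *)
Lemma zero_sums_zsf (A : seq 'Z_p) : zsf A -> zero_sums p (map val A) 0 = 1%N.
Proof.
elim: A => [|a A ih] zA /=; first by rewrite dvdn0.
rewrite ih; last by apply: (zsf_catr (s1 := [:: a])).
rewrite zero_sums_eq0 // => b; rewrite add0n -map_mask.
have := dvdn_sum_val (a :: mask b A); rewrite map_cons big_cons => ->.
apply: zA => // x; rewrite /= leq_add2l; exact: leq_count_mask.
Qed.

(** [cos^2] is even with period [pi], so only the least absolute residue of [k a] matters. *)
Lemma cos_half (k : nat) (a : 'Z_p) :
  cos (al * (k * val a)%N%:R / 2) ^+ 2 =
  cos (pi * `|rep (k%:R * a)|%:~R / p%:R) ^+ 2 :> R.
Proof.
have dbl x : cos x ^+ 2 = (cos (x *+ 2) + 1) / 2 :> R by rewrite cos_mulr2n -mulr_natr; field.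
rewrite !dbl; congr ((_ + 1) / 2).
have -> : al * (k * val a)%N%:R / 2 *+ 2 = al * (k * val a)%N%:R.
  by rewrite -[_ *+ 2]mulr_natr divfK.
have -> : pi * `|rep (k%:R * a)|%:~R / p%:R *+ 2 = al * `|rep (k%:R * a)|%:~R :> R.
  by rewrite /al -[LHS]mulr_natr -[pi *+ 2]mulr_natr; ring.
have -> : cos (al * `|rep (k%:R * a)|%:~R) = cos (al * (rep (k%:R * a))%:~R) :> R.
  case: (ger0P (rep (k%:R * a))) => // _.
  by rewrite rmorphN mulrN cosN.
rewrite cos_mod //.
have <- : val (k%:R * a : 'Z_p) = (k * val a %% p)%N.
  by rewrite -{1}[a]natr_Zp -natrM [LHS]/= val_Zp_nat.
rewrite /rep; case: ifP => _ //.
rewrite intrD rmorphN /= mulrDr mulrN.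
have -> : al * p%:~R = pi *+ 2 by rewrite /al divfK.
by rewrite -[RHS]cosD2pi subrK.
Qed.

(* A product of cosines as large as [exists_large_product] gives forces [rep (d * a)]
   to be small on average, since [cos ^ 2] is at most a Gaussian. *)
Lemma exists_near_dilation (M0 E j : nat) (A : seq 'Z_p) : zsf A ->
  (2 * p <= 2 ^ size A)%N -> (5 * p ^ 2 * j <= 4 * (E.+1 * M0 ^ 2))%N ->
  (4 * p ^ 2 < 2 ^ j)%N ->
  exists2 d : 'Z_p, d != 0 & (count (fun a : 'Z_p => M0 < absz (rep (d * a)%R))%N A <= E)%N.
Proof.
move=> zA sA jE pj.
have sA' : (2 * p <= 2 ^ size (map val A))%N by rewrite size_map.
have [k /andP[k0 kp]] := exists_large_product R p0 (zero_sums_zsf zA) sA'.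
rewrite size_map => big; exists (k%:R : 'Z_p).
  by rewrite -(inj_eq val_inj) /= val_Zp_nat // modn_small // -lt0n.
rewrite leqNgt; apply/negP => Ec.
pose r (a : 'Z_p) := (absz (rep (k%:R * a)%R) ^ 2)%N.
pose S := (\sum_(a <- A) r a)%N.
(* The [1 / 5] is that of [cos2_le_expR], and the [4] bounds [pi^2] from below. *)
pose c : R := 4 / 5 / p%:R ^+ 2.
have c0 : 0 <= c by rewrite divr_ge0 ?sqr_ge0.
have term (a : 'Z_p) : `|2 * cos (al * (k * val a)%N%:R / 2)| ^+ 2 <= 4 * expR (- (c * (r a)%:R)).
  rewrite (real_normK (num_real _)) exprMn cos_half -abszE -pmulrn.
  set n := absz (rep (k%:R * a)).
  have np : (2 * n < p)%N by apply: rep_bound.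
  have n0 : 0 <= n%:R / p%:R :> R by rewrite divr_ge0.
  have pi0 := pi_gt0 R; have pi2 := pi_ge2 R.
  have n2 : n%:R / p%:R <= 1 / 2 :> R.
    by rewrite ler_pdivrMr ?ltr0n // mulrAC mul1r ler_pdivlMr // -natrM ler_nat mulnC ltnW.
  rewrite -mulrA (_ : 2 ^+ 2 = 4); last by rewrite -natrX.
  rewrite ler_pM2l //; apply: le_trans (cos2_le_expR _) _.
    rewrite ger0_norm; last by rewrite mulr_ge0 // ltW.
    by rewrite ler_pM2l // -[2^-1]mul1r.
  rewrite ler_expR lerN2 /r -/n natrX.
  have -> : c * n%:R ^+ 2 = 4 * (n%:R / p%:R) ^+ 2 / 5 by rewrite /c; field.
  rewrite ler_pM2r ?invr_gt0 // [leRHS]exprMn ler_wpM2r ?sqr_ge0 //.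
  by nra.
have SE : (E.+1 * M0 ^ 2 <= S)%N.
  apply: leq_trans (_ : (\sum_(a <- A | M0 < absz (rep (k%:R * a)%R)) M0 ^ 2 <= _)%N).
    rewrite big_const_seq iter_addn_0 mulnC leq_mul2l; apply/orP; right; exact: Ec.
  rewrite /S [leqRHS](bigID (fun a : 'Z_p => M0 < absz (rep (k%:R * a)%R))%N) /=.
  apply: leq_trans (leq_addr _ _); apply: leq_sum => a /ltnW.
  by rewrite /r leq_exp2r.
have prod_le : \prod_(a <- A) `|2 * cos (al * (k * val a)%N%:R / 2)| ^+ 2 <=
    4 ^+ size A * expR (- (c * S%:R)) :> R.
  rewrite /S; elim: (A) => [|a u ih]; first by rewrite !big_nil mulr0 oppr0 expR0 mulr1.
  rewrite !big_cons /= [4 ^+ _]exprS natrD mulrDr opprD expRD mulrACA ler_pM ?exprn_ge0 ?term //.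
  by apply: prodr_ge0 => b _; rewrite exprn_ge0.
have cS : j%:R <= c * S%:R.
  have -> : c * S%:R = (4 * S%:R) / (5 * p%:R ^+ 2) by rewrite /c; field.
  rewrite ler_pdivlMr; last by rewrite mulr_gt0 // exprn_gt0 // ltr0n.
  rewrite -natrX -!natrM ler_nat mulnC; apply: leq_trans jE _.
  by rewrite leq_mul2l SE orbT.
have big2 : (2 ^+ size A / (2 * p%:R)) ^+ 2 <= 4 ^+ size A * expR (- j%:R) :> R.
  apply: le_trans (_ : 4 ^+ size A * expR (- (c * S%:R)) <= _).
    apply: le_trans prod_le; rewrite prodrXl; rewrite big_map in big.
    by rewrite ler_sqr ?nnegrE ?divr_ge0 ?exprn_ge0 ?mulr_ge0 ?prodr_ge0.
  by rewrite ler_pM2l ?exprn_gt0 // ler_expR lerN2.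
have e2 : 2 ^+ j <= expR (j%:R) :> R.
  rewrite -[j%:R]mulr1 expRM_natl lerXn2r ?nnegrE ?expR_ge0 //.
  by apply: le_trans (expR_ge1Dx 1).
have : (4 * p ^ 2)%N%:R < 2 ^+ j :> R by rewrite -natrX ltr_nat.
rewrite natrM natrX => pj'.
have x0 : 0 < expR (- j%:R) :> R := expR_gt0 _.
have xe : expR (- j%:R) * expR j%:R = 1 :> R by rewrite -expRD addNr expR0.
have big3 : (2 * p%:R) ^- 2 <= expR (- j%:R) :> R.
  have A0 : 0 < 4 ^+ size A :> R by rewrite exprn_gt0.
  rewrite -(ler_pM2l A0); apply: le_trans big2; rewrite expr_div_n -exprM mulnC exprM.
  by rewrite (_ : 2 ^+ 2 = 4) // -natrX.
have : 1 <= 4 * p%:R ^+ 2 * expR (- j%:R) :> R.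
  have p20 : 0 < (2 * p%:R) ^+ 2 :> R by rewrite exprn_gt0 // mulr_gt0 // ltr0n.
  move: big3; rewrite -(ler_pM2l p20) divff ?gt_eqF // exprMn.
  by rewrite (_ : 2 ^+ 2 = 4) // -natrX.
have : 4 * p%:R ^+ 2 * expR (- j%:R) < expR j%:R * expR (- j%:R) :> R.
  by rewrite ltr_pM2r // (lt_le_trans pj').
by rewrite [X in _ < X]mulrC xe => h1 h2; have := le_lt_trans h2 h1; rewrite ltxx.
Qed.

End Fourier.

(** * The value of zeta(2) *)

Section Basel.
Variable R : realType.
Implicit Types x y : R.

Definition zeta2 (J : nat) : R := \sum_(j < J) (j.+1%:R ^+ 2)^-1.

Definition csc2 (N : nat) : R := \sum_(k < N.-1) (sin (k.+1%:R * pi / (2 * N%:R)) ^+ 2)^-1.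

Lemma csc2_double x : sin x != 0 -> cos x != 0 ->
  (sin x ^+ 2)^-1 + (cos x ^+ 2)^-1 = 4 * (sin (2 * x) ^+ 2)^-1.
Proof.
move=> s0 c0; rewrite [2 * x]mulr_natl sin_mulr2n -[_ *+ 2]mulr_natr.
have := cos2Dsin2 x => e.
have -> : (sin x ^+ 2)^-1 + (cos x ^+ 2)^-1 =
  (cos x ^+ 2 + sin x ^+ 2) * ((sin x ^+ 2)^-1 * (cos x ^+ 2)^-1) by field; rewrite s0 c0.
by rewrite e; field; rewrite s0 c0.
Qed.

(* [csc2_double] pairs the angles [x] and [pi / 2 - x], leaving [pi / 4] alone. *)
Lemma csc2_rec N : (0 < N)%N -> csc2 (2 * N) = 4 * csc2 N + 2.
Proof.
case: N => // M _; rewrite /csc2.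
have -> : (2 * M.+1).-1 = (M + M.+1)%N by rewrite mul2n -addnn addSn.
rewrite big_split_ord big_ord_recl /=.
have MR : M.+1%:R != 0 :> R by rewrite pnatr_eq0.
have e2 : (2 * M.+1)%N%:R = 2 * M.+1%:R :> R by rewrite natrM.
have -> : (sin ((M + 0).+1%:R * pi / (2 * (2 * M.+1)%:R)) ^+ 2)^-1 = 2 :> R.
  rewrite addn0 e2 (_ : _ / _ = pi / 4); last by field.
  have := cos2Dsin2 (pi / 4 : R).
  have := cosBpihalf (pi / 4 : R); rewrite (_ : pi / 4 - pi / 2 = - (pi / 4)); last by field.
  rewrite cosN => ->; rewrite -mulr2n -mulr_natr => h.
  by rewrite -[RHS]invrK; congr (_^-1); lra.
rewrite [X in _ + (_ + X)](reindex_inj rev_ord_inj) /= addrCA [RHS]addrC; congr (2 + _).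
rewrite -big_split big_distrr; apply: eq_bigr => i _ /=.
pose x : R := i.+1%:R * pi / (4 * M.+1%:R).
have iM : i.+1%:R < M.+1%:R :> R by rewrite ltr_nat ltnS.
have i0 : 0 < i.+1%:R :> R by rewrite ltr0n.
have pi0 := pi_gt0 R.
have x0 : 0 < x by rewrite divr_gt0 ?mulr_gt0 ?ltr0n.
have x2 : x < pi / 2.
  rewrite /x ltr_pdivrMr ?mulr_gt0 ?ltr0n // (_ : pi / 2 * _ = 2 * M.+1%:R * pi); last by field.
  by rewrite ltr_pM2r //; lra.
have s0 : sin x != 0 by rewrite gt_eqF // sin_gt0_pihalf // x0.
have c0 : cos x != 0 by rewrite gt_eqF // cos_gt0_pihalf // x2 andbT; lra.
have -> : i.+1%:R * pi / (2 * (2 * M.+1)%:R) = x by rewrite e2 /x; field.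
have -> : i.+1%:R * pi / (2 * M.+1%:R) = 2 * x by rewrite /x; field.
have -> : (M + lift ord0 (rev_ord i)).+1%:R * pi / (2 * (2 * M.+1)%:R) = - (x - pi / 2) :> R.
  have -> : (M + lift ord0 (rev_ord i)).+1%:R = 2 * M.+1%:R - i.+1%:R :> R.
    apply/eqP; rewrite eq_sym subr_eq -e2 -natrD eqr_nat; apply/eqP.
    rewrite /= /bump /=; have := ltn_ord i; lia.
  by rewrite e2 /x; field.
by rewrite sinN sinBpihalf opprK csc2_double.
Qed.

Lemma csc2_pow2 n : csc2 (2 ^ n) = 2 * ((2 ^+ n) ^+ 2 - 1) / 3.
Proof.
elim: n => [|n ih]; first by rewrite /csc2 big_ord0 expr0 expr1n subrr mulr0 mul0r.
by rewrite expnS csc2_rec ?expn_gt0 // ih [2 ^+ n.+1]exprS exprMn; field.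
Qed.

(* Squeezes [1 / sin x ^ 2] between [1 / x ^ 2] and [1 / x ^ 2 + 1]. *)
Lemma csc2_bounds N (c : R) : (0 < N)%N -> c = 4 * N%:R ^+ 2 / pi ^+ 2 ->
  c * zeta2 N.-1 <= csc2 N <= c * zeta2 N.-1 + N.-1%:R.
Proof.
move=> N0 cE; have pi0 := pi_gt0 R.
have NR : 0 < N%:R :> R by rewrite ltr0n.
have bd (k : 'I_N.-1) : c * (k.+1%:R ^+ 2)^-1 <=
    (sin (k.+1%:R * pi / (2 * N%:R)) ^+ 2)^-1 <=
    c * (k.+1%:R ^+ 2)^-1 + 1.
  have k0 : 0 < k.+1%:R :> R by rewrite ltr0n.
  pose x : R := k.+1%:R * pi / (2 * N%:R).
  have x0 : 0 < x by rewrite divr_gt0 ?mulr_gt0.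
  have kN : k.+1%:R < N%:R :> R by rewrite ltr_nat; have := ltn_ord k; lia.
  have x2 : x < pi / 2.
    rewrite /x ltr_pdivrMr ?mulr_gt0 // (_ : pi / 2 * _ = N%:R * pi); last by field.
    by rewrite ltr_pM2r.
  have sx : 0 < sin x by rewrite sin_gt0_pihalf // x0.
  have -> : c * (k.+1%:R ^+ 2)^-1 = (x ^+ 2)^-1.
    have [N' k' p'] : [/\ N%:R != 0 :> R, k.+1%:R != 0 :> R & pi != 0 :> R].
      by rewrite !gt_eqF.
    rewrite cE /x; move: k' N' p'; move: (k.+1%:R : R) (N%:R : R) (pi : R) => a b d a0 b0 d0.
    by field; rewrite a0 b0 d0.
  rewrite -/x; apply/andP; split.
    by rewrite lef_pV2 ?posrE ?exprn_gt0 // sin2_le.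
  have xpi : `|x| <= pi / 2 by rewrite ger0_norm ltW.
  have := sin2_ge xpi; rewrite cos2sin2 => h.
  have xx : 0 < x ^+ 2 by rewrite exprn_gt0.
  have ss : 0 < sin x ^+ 2 by rewrite exprn_gt0.
  have h2 : 1 - sin x ^+ 2 <= sin x ^+ 2 / x ^+ 2 by rewrite ler_pdivlMr // mulrC.
  rewrite -[leLHS]mul1r ler_pdivrMr // mulrDl mul1r [X in _ <= X + _]mulrC.
  by lra.
rewrite /csc2 /zeta2 big_distrr /=; apply/andP; split.
  by apply: ler_sum => k _; have /andP[] := bd k.
rewrite -[X in _ <= _ + X%:R]card_ord -sum1_card natr_sum -big_split /=.
by apply: ler_sum => k _; have /andP[] := bd k.
Qed.

Lemma zeta2_mono J K : (J <= K)%N -> zeta2 J <= zeta2 K.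
Proof.
move=> JK; rewrite /zeta2 -(subnKC JK) big_split_ord /= lerDl.
by apply: sumr_ge0 => k _; rewrite invr_ge0 sqr_ge0.
Qed.

Lemma zeta2_pow2 n : zeta2 (2 ^ n).-1 <= pi ^+ 2 / 6.
Proof.
have N0 : (0 < 2 ^ n)%N by rewrite expn_gt0.
have /andP[+ _] := csc2_bounds N0 erefl; rewrite csc2_pow2 natrX.
set y : R := 2 ^+ n; have y0 : 0 < y by rewrite exprn_gt0.
have pi0 : 0 < pi ^+ 2 :> R by rewrite exprn_gt0 // pi_gt0.
move: (zeta2 _) => z; rewrite [4 * _ / _ * _]mulrAC ler_pdivrMr // => h.
have y2 : 0 < y ^+ 2 by rewrite exprn_gt0.
rewrite -(ler_pM2l y2); nra.
Qed.

Lemma zeta2_le J : zeta2 J <= pi ^+ 2 / 6.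
Proof.
apply: le_trans (zeta2_pow2 J.+1); apply: zeta2_mono.
by have := ltn_expl J.+1 (isT : 1 < 2)%N; lia.
Qed.

Lemma zeta2_ge n : pi ^+ 2 / 6 - 8 / 2 ^+ n <= zeta2 (2 ^ n).-1.
Proof.
have N0 : (0 < 2 ^ n)%N by rewrite expn_gt0.
have /andP[_] := csc2_bounds N0 erefl; rewrite csc2_pow2 natrX.
have -> : ((2 ^ n).-1%:R : R) = 2 ^+ n - 1.
  by rewrite -[in RHS]natrX -[in RHS](prednK N0) -natr1 addrK.
set y : R := 2 ^+ n; have y1 : 1 <= y by apply: exprn_ege1; rewrite ler1n.
have pi0 := pi_gt0 R; have pi4 : pi < 4 :> R by have := pihalf_lt2 R; lra.
have p2 : 0 < pi ^+ 2 :> R by rewrite exprn_gt0.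
have p16 : pi ^+ 2 <= 16 :> R by nra.
have y0 : 0 < y by lra.
have y2 : 0 < y ^+ 2 by rewrite exprn_gt0.
move: (zeta2 _) => z; set P := pi ^+ 2 in p2 p16 *.
rewrite [4 * _ / _ * _]mulrAC -lerBlDr ler_pdivlMr // => h.
have Py : P * y <= 16 * y by rewrite ler_pM2r.
rewrite lerBlDr -(ler_pM2r y2) mulrDl (_ : 8 / y * y ^+ 2 = 8 * y); last by field; rewrite gt_eqF.
move: h; rewrite mulrBl; nra.
Qed.

End Basel.

(** * Generating function of bounded partitions *)

Section LogSeries.
Variable R : realType.
Implicit Types q y t : R.

Lemma is_derive_log_tail J q : q < 1 ->
  is_derive q 1 (fun x : R => - ln (1 - x) - \sum_(j < J) x ^+ j.+1 / j.+1%:R) (q ^+ J / (1 - q)).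
Proof.
move=> q1; have q0 : 0 < 1 - q by rewrite subr_gt0.
elim: J => [|J ih].
  rewrite (_ : (fun _ => _) = (fun x : R => - ln (1 - x))); last first.
    by apply/funext => x; rewrite big_ord0 subr0.
  have d1 : is_derive q 1 (fun x : R => 1 - x) (-1).
    by apply: is_derive_eq; rewrite add0r mul1r.
  have d2 := is_derive1_ln q0.
  have d3 := @is_derive1_comp R (@ln R) (fun x => 1 - x) q _ _ d2 d1.
  have d4 := is_deriveN d3; apply: (is_derive_eq d4).
  by rewrite expr0 /GRing.scale /=; field; rewrite gt_eqF.
rewrite (_ : (fun _ => _) = (fun x : R => (- ln (1 - x) - \sum_(j < J) x ^+ j.+1 / j.+1%:R) -
   x ^+ J.+1 * J.+1%:R^-1)); last first.
  by apply/funext => x; rewrite big_ord_recr /= opprD addrA.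
have d1 : is_derive q 1 (fun x : R => x ^+ J.+1 * J.+1%:R^-1) (q ^+ J).
  rewrite (_ : (fun _ => _) = (J.+1%:R^-1 \*: (@id R ^+ J.+1))); last first.
    by apply/funext => x; rewrite /= exprfctE mulrC.
  have dX := is_deriveZ J.+1%:R^-1 (@is_deriveX R R (@id R) J.+1 q 1 1 (is_derive_id _ _)).
  by apply: (is_derive_eq dX); rewrite /GRing.scale /= mulr1 mulrA mulVf ?mul1r.
have d := is_deriveB ih d1; apply: (is_derive_eq d).
by rewrite exprS; field; rewrite gt_eqF.
Qed.

(** The remainder has derivative [x^J / (1 - x)], which lies between [0] and [x^J / (1 - a)]; both
    bounds come from integrating from [0] to [q]. *)
Lemma log_tail_bounds J (a q : R) : 0 <= q <= a -> a < 1 ->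
  0 <= - ln (1 - q) - \sum_(j < J) q ^+ j.+1 / j.+1%:R <= ((1 - a) * J.+1%:R)^-1.
Proof.
move=> /andP[q0 qa] a1; have a0 : 0 < 1 - a by rewrite subr_gt0.
pose f (x : R) := - ln (1 - x) - \sum_(j < J) x ^+ j.+1 / j.+1%:R.
have f0 : f 0 = 0.
  rewrite /f subr0 ln1 oppr0 big1 ?subrr // => j _.
  by rewrite exprS !mul0r.
have df (x : R) : 0 <= x <= q -> is_derive x 1 f (x ^+ J / (1 - x)).
  move=> /andP[_ xq]; apply: is_derive_log_tail.
  exact: le_lt_trans xq (le_lt_trans qa a1).
rewrite -/(f q); apply/andP; split.
  rewrite -f0; apply: le_of_derive_ge0 q0 df _ => x /andP[x0 xq].
  by rewrite divr_ge0 ?exprn_ge0 // subr_ge0; lra.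
pose g (x : R) := x ^+ J.+1 / J.+1%:R / (1 - a).
have dg (x : R) : is_derive x 1 g (x ^+ J / (1 - a)).
  rewrite (_ : g = (J.+1%:R^-1 / (1 - a) \*: (@id R ^+ J.+1))); last first.
    by apply/funext => y; rewrite /g /= exprfctE /GRing.scale /=; ring.
  have dX := is_deriveZ (J.+1%:R^-1 / (1 - a))
    (@is_deriveX R R (@id R) J.+1 x 1 1 (is_derive_id _ _)).
  apply: (is_derive_eq dX); rewrite /GRing.scale /= mulr1.
  rewrite [RHS]mulrC mulrAC mulrC; congr (_ * _).
  by rewrite mulrA mulVf ?mul1r // pnatr_eq0.
have : f q <= g q.
  rewrite -subr_ge0; have := @le_of_derive_ge0 R (fun x => g x - f x)
    (fun x => x ^+ J / (1 - a) - x ^+ J / (1 - x)) 0 q q0.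
  have g0 : g 0 = 0 by rewrite /g exprS !mul0r.
  rewrite f0 g0 subr0; apply.
    by move=> x xq; apply: is_deriveB (dg x) (df x xq).
  move=> x /andP[x0 xq]; rewrite subr_ge0 ler_wpM2l ?exprn_ge0 //.
  by rewrite lef_pV2 ?posrE ?subr_gt0; lra.
move=> fg; apply: le_trans fg _; rewrite /g invfM mulrC ler_pM2l ?invr_gt0 //.
rewrite -[leRHS]mul1r ler_pM2r ?invr_gt0 ?ltr0n //.
by rewrite exprn_ile1 // (le_trans qa) // ltW.
Qed.

Lemma geometric_sum (x : R) K : (1 - x) * (\sum_(k < K) x ^+ k.+1) = x * (1 - x ^+ K).
Proof.
elim: K => [|K ih]; first by rewrite big_ord0 expr0 subrr !mulr0.
by rewrite big_ord_recr /= mulrDr ih !exprS; ring.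
Qed.

Lemma geometric_bounds y K : 0 < y ->
  (1 - expR (- (K%:R * y))) * (1 - y) / y <= \sum_(k < K) expR (- (k.+1%:R * y)) <= y^-1.
Proof.
move=> y0; pose x := expR (- y).
have x0 : 0 < x := expR_gt0 _.
have e k : expR (- (k%:R * y)) = x ^+ k by rewrite -mulrN expRM_natl.
under eq_bigr do rewrite e.
rewrite e; have x1 : x < 1 by rewrite -expR0 ltr_expR oppr_lt0.
have xy : 1 - y <= x by have := expR_ge1Dx (- y); rewrite -/x.
have xy2 : x * (1 + y) <= 1.
  have := expR_ge1Dx y; rewrite -(ler_pM2l x0) => h; apply: le_trans h _.
  by rewrite /x -expRD addNr expR0.
have xK : 0 <= x ^+ K <= 1 by rewrite exprn_ge0 ?exprn_ile1 // ltW.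
have := geometric_sum x K; move: (\sum_(k < K) _) => S h.
have S0 : 0 <= S.
  have : 0 <= (1 - x) * S by rewrite h mulr_ge0 ?subr_ge0; lra.
  by rewrite pmulr_rge0 // subr_gt0.
move: xK => /andP[xK0 xK1]; move: (x ^+ K) xK0 xK1 h => z z0 z1 h.
apply/andP; split.
  rewrite ler_pdivrMr //; apply: le_trans (_ : (1 - z) * x <= _).
    by rewrite ler_wpM2l // subr_ge0.
  rewrite mulrC -h mulrC ler_wpM2l //; lra.
rewrite -(ler_pM2r y0) mulVf ?gt_eqF //.
have : (1 - x) * (S * y) <= (1 - x) * 1.
  rewrite mulr1 mulrA h; apply: le_trans (_ : x * 1 * y <= _).
    by rewrite ler_pM2r // ler_pM2l //; lra.
  by lra.
by rewrite ler_pM2l // subr_gt0.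
Qed.

Definition psi (x : R) : R := - ln (1 - expR (- x)).
(** The logarithm of the generating function, at [exp(- t)], of partitions into parts at most
    [K]. *)
Definition Psi (K : nat) (t : R) : R := \sum_(k < K) psi (k.+1%:R * t).

(** Expanding the logarithm and summing over [k] first, the [j]-th term is at most [1 / (j^2 t)].
    For fixed [K] and [t] the truncation error tends to [0] as [J] grows, so the bound is uniform in
    [K]. *)
Lemma Psi_le K t : 0 < t -> Psi K t <= pi ^+ 2 / 6 / t.
Proof.
move=> t0; pose a := expR (- t).
have a1 : a < 1 by rewrite -expR0 ltr_expR oppr_lt0.
have a0 : 0 < 1 - a by rewrite subr_gt0.
have main J : Psi K t <= pi ^+ 2 / 6 / t + K%:R / (1 - a) / J.+1%:R.
  apply: (@le_trans _ _ (\sum_(k < K) (\sum_(j < J) expR (- (k.+1%:R * (j.+1%:R * t))) / j.+1%:R +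
      ((1 - a) * J.+1%:R)^-1))).
    apply: ler_sum => k _; rewrite /psi -lerBlDl.
    have qa : 0 <= expR (- (k.+1%:R * t)) <= a.
      by rewrite expR_ge0 ler_expR lerN2 ler_peMl ?ler1n // ltW.
    have /andP[_] := log_tail_bounds J qa a1; apply: le_trans.
    rewrite lerD2l lerN2; apply: ler_sum => j _.
    by rewrite -expRM_natl mulrN mulrCA.
  rewrite big_split /= exchange_big /=; apply: lerD; last first.
    by rewrite sumr_const card_ord -[_ *+ K]mulr_natl invfM mulrA lexx.
  apply: (@le_trans _ _ (zeta2 R J / t)); last first.
    by rewrite ler_pM2r ?invr_gt0 // zeta2_le.
  rewrite /zeta2 mulr_suml; apply: ler_sum => j _; rewrite -mulr_suml.
  have jt : 0 < j.+1%:R * t by rewrite mulr_gt0 ?ltr0n.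
  have /andP[_ h] := geometric_bounds K jt.
  apply: le_trans (_ : (j.+1%:R * t)^-1 / j.+1%:R <= _).
    by rewrite ler_pM2r // invr_gt0 ltr0n.
  by rewrite invfM expr2 invfM mulrAC.
apply/ler_addgt0Pr => e e0; set B := K%:R / (1 - a).
have B0 : 0 <= B by rewrite divr_ge0 // ltW.
have := main (Num.bound (B / e)); move/le_trans; apply; rewrite lerD2l -/B.
rewrite ler_pdivrMr ?ltr0n // mulrC -ler_pdivrMr //.
have := archi_boundP (divr_ge0 B0 (ltW e0)) => /ltW /le_trans; apply.
by rewrite ler_nat.
Qed.


Lemma Psi_ge (e : R) : 0 < e -> exists2 t0, 0 < t0 & exists2 T, 0 < T &
  forall t K, 0 < t < t0 -> T <= K%:R * t -> (pi ^+ 2 / 6 - e) / t <= Psi K t.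
Proof.
wlog e1 : e / e <= 1.
  move=> h e0; have [e1|e1] := leP e 1; first exact: h.
  have [t0 t00 [T T0 hT]] := h 1 (lexx _) ltr01.
  exists t0 => //; exists T => // t K tt KT; apply: le_trans (hT _ _ tt KT).
  by rewrite ler_pM2r ?invr_gt0; [lra | case/andP: tt].
(* The budget is [e / 3] for truncating [zeta(2)] after [2^n - 1] terms, and [e / 3] for each of the
   factors [1 - exp(- K t)] and [1 - J t]: they are within [e / 9] of 1, and [pi^2 / 6 < 3]. *)
move=> e0; pose n := Num.bound (24 / e); pose J := (2 ^ n).-1.
have nE : 8 / 2 ^+ n <= e / 3.
  have y0 : 0 < 2 ^+ n :> R by rewrite exprn_gt0.
  have : 24 / e <= n%:R by apply/ltW/archi_boundP; rewrite divr_ge0 // ltW.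
  have : n%:R <= 2 ^+ n :> R by rewrite -natrX ler_nat ltnW // ltn_expl.
  move: (n%:R : R) (2 ^+ n : R) y0 => a b b0 ab; rewrite !ler_pdivrMr // => h.
  by have : a * e <= b * e by [rewrite ler_pM2r]; lra.
have zJ : pi ^+ 2 / 6 - e / 3 <= zeta2 R J by have := zeta2_ge R n; rewrite -/J; lra.
have z3 : pi ^+ 2 / 6 < 3 :> R.
  have pi0 := pi_gt0 R; have pi4 : pi < 4 :> R by have := pihalf_lt2 R; lra.
  by nra.
exists (e / 9 / J.+1%:R); first by rewrite !divr_gt0 ?ltr0n.
exists (9 / e); first by rewrite divr_gt0.
move=> t K /andP[t0 tJ] TK.
have z0 : 0 <= zeta2 R J by apply: sumr_ge0 => j _; rewrite invr_ge0 sqr_ge0.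
have b9 : J%:R * t <= e / 9.
  move: tJ; rewrite ltr_pdivlMr ?ltr0n // mulrC => /ltW; apply: le_trans.
  by rewrite ler_pM2r // ler_nat.
have b0 : 0 <= J%:R * t by rewrite mulr_ge0 // ltW.
have Kt : 0 < K%:R * t by apply: lt_le_trans TK; rewrite divr_gt0.
have a9 : expR (- (K%:R * t)) <= e / 9.
  rewrite expRN -[leRHS]invrK lef_pV2 ?posrE ?expR_gt0 ?invr_gt0 ?divr_gt0 //.
  apply: le_trans (ltW (expR_gt1Dx _)); last by rewrite gt_eqF.
  by rewrite invf_div; lra.
have a0 := expR_gt0 (- (K%:R * t)).
apply: (@le_trans _ _ ((1 - expR (- (K%:R * t))) * (1 - J%:R * t) * zeta2 R J / t)).
  rewrite ler_pM2r ?invr_gt0 //.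
  move: (expR _) (J%:R * t) (zeta2 _ _) a9 a0 b9 b0 zJ z0 => a b z a9 a0 b9 b0 zJ z0.
  apply: (@le_trans _ _ ((1 - a - b) * z)); last first.
    rewrite ler_wpM2r // mulrBr mulr1 mulrBl mul1r.
    have : 0 <= a * b by rewrite mulr_ge0 // ltW.
    by lra.
  apply: (@le_trans _ _ ((1 - a - b) * (pi ^+ 2 / 6 - e / 3))); last first.
    by rewrite ler_wpM2l //; lra.
  by move: (pi ^+ 2 / 6) z3 {zJ} => P z3; nra.
apply: (@le_trans _ _ (\sum_(k < K) \sum_(j < J) expR (- (k.+1%:R * (j.+1%:R * t))) / j.+1%:R)); last first.
  apply: ler_sum => k _; rewrite /psi.
  have qa : 0 <= expR (- (k.+1%:R * t)) <= expR (- (k.+1%:R * t)) by rewrite expR_ge0 lexx.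
  have q1 : expR (- (k.+1%:R * t)) < 1 by rewrite -expR0 ltr_expR oppr_lt0 mulr_gt0 ?ltr0n.
  have /andP[+ _] := log_tail_bounds J qa q1; rewrite subr_ge0; apply: le_trans.
  apply: ler_sum => j _.
  by rewrite -expRM_natl mulrN mulrCA.
rewrite exchange_big /= /zeta2 mulr_sumr mulr_suml; apply: ler_sum => j _; rewrite -mulr_suml.
have jt : 0 < j.+1%:R * t by rewrite mulr_gt0 ?ltr0n.
have /andP[h _] := geometric_bounds K jt.
rewrite ler_pdivlMr ?ltr0n //; apply: le_trans h.
have -> : (1 - expR (- (K%:R * t))) * (1 - J%:R * t) * (j.+1%:R ^+ 2)^-1 / t * j.+1%:R =
    (1 - expR (- (K%:R * t))) * (1 - J%:R * t) / (j.+1%:R * t).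
  have : j.+1%:R != 0 :> R by rewrite pnatr_eq0.
  have : t != 0 by rewrite gt_eqF.
  move: (expR _) (j.+1%:R : R) (J%:R : R) => u a b t' a'.
  by field; rewrite a' t'.
rewrite ler_pM2r ?invr_gt0 //.
have j1 : 1 <= j.+1%:R :> R by rewrite ler1n.
apply: ler_pM; rewrite ?subr_ge0.
- by apply: le_trans a9 _; lra.
- by apply: le_trans b9 _; lra.
- rewrite lerD2l lerN2 ler_expR lerN2 ler_pM2l ?ler_peMl // ?(ltW t0) //.
  by rewrite -(pmulr_lgt0 _ t0).
- by rewrite lerD2l lerN2 ler_pM2r // ler_nat.
Qed.

End LogSeries.

(** * Chernoff bounds for an integer weight *)

Section Chernoff.
Variables (R : realType) (I : finType) (W : I -> nat).
Implicit Types t th y : R.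

Definition genfun (t : R) : R := \sum_i expR (- (t * (W i)%:R)).

Lemma genfun_upper t n : 0 <= t ->
  #|[pred i | W i <= n]%N|%:R <= expR (t * n%:R) * genfun t.
Proof.
move=> t0; rewrite -sum1_card natr_sum mulr_sumr.
rewrite [leRHS](bigID [pred i | W i <= n]%N) /= -[leLHS]addr0; apply: lerD.
  apply: ler_sum => i; rewrite inE => Wi; rewrite -expRD -[leLHS]expR0 ler_expR.
  by rewrite subr_ge0; apply: ler_wpM2l => //; rewrite ler_nat.
by apply: sumr_ge0 => i _; rewrite mulr_ge0 ?expR_ge0.
Qed.

(* The terms with [W i < y] or [W i > n] carry at most half of [genfun t],
   and each of the others is at most [expR (- (t * y))]. *)
Lemma genfun_lower t th y n : 0 < t -> 0 <= th ->
    expR (th * y) * genfun (t + th) <= genfun t / 4 ->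
    expR (- (th * n%:R)) * genfun (t - th) <= genfun t / 4 ->
  expR (t * y) * (genfun t / 2) <= #|[pred i | W i <= n]%N|%:R.
Proof.
move=> t0 th0 lo hi.
pose w i : R := expR (- (t * (W i)%:R)).
have w0 i : 0 <= w i by rewrite expR_ge0.
have E : genfun t <= expR (th * y) * genfun (t + th) + expR (- (th * n%:R)) * genfun (t - th) +
    \sum_(i | (W i <= n)%N) expR (- (t * y)).
  rewrite /genfun !mulr_sumr [X in _ <= _ + X]big_mkcond -!big_split /=.
  apply: ler_sum => i _; rewrite -!expRD.
  have [Wn|Wn] := leqP; last first.
    rewrite addr0 ler_wpDl ?expR_ge0 // ler_expR.
    have : n%:R <= (W i)%:R :> R by rewrite ler_nat ltnW.
    by move=> /(ler_wpM2l th0); lra.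
  have [Wy|Wy] := leP y (W i)%:R.
    rewrite ler_wpDl ?addr_ge0 ?expR_ge0 // ler_expR lerN2.
    by rewrite ler_pM2l.
  rewrite -addrA ler_wpDr ?addr_ge0 ?expR_ge0 // ler_expR.
  by have := ler_wpM2l th0 (ltW Wy); lra.
rewrite sumr_const -[X in _ + X]mulr_natr in E.
rewrite -(ler_pM2l (expR_gt0 (- (t * y)))) !mulrA -expRD addNr expR0 mul1r.
have -> : #|[pred i | W i <= n]%N| = #|(fun i => W i <= n)%N| by apply: eq_card => i; rewrite !inE.
by move: (genfun t) E lo hi => g; lra.
Qed.
End Chernoff.

Section BoundedParts.
Variable R : realType.
Implicit Types e t x : R.

Definition weight K m (f : {ffun 'I_K -> 'I_m.+1}) : nat := \sum_k f k * k.+1.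

(** The part [k + 1] contributes [1 + q + ... + q^m = (1 - q^(m + 1)) / (1 - q)]; replacing [q] by
    [q^(m + 1)] is replacing [t] by [(m + 1) t]. *)
Lemma genfun_weight K m (t : R) : 0 < t ->
  genfun (@weight K m) t = expR (Psi K t - Psi K (m.+1%:R * t)).
Proof.
move=> t0; rewrite /genfun /Psi -sumrB expR_sum.
transitivity (\prod_(k < K) \sum_(i < m.+1) expR (- (t * (i * k.+1)%:R))).
  rewrite bigA_distr_bigA /=; apply: eq_bigr => f _.
  by rewrite -expR_sum sumrN -mulr_sumr /weight natr_sum.
apply: eq_bigr => k _; rewrite /psi.
set q : R := expR (- (k.+1%:R * t)).
have q1 : q < 1 by rewrite -expR0 ltr_expR oppr_lt0 mulr_gt0 ?ltr0n.
have q0 : 0 < q := expR_gt0 _.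
have -> : expR (- (k.+1%:R * (m.+1%:R * t))) = q ^+ m.+1.
  by rewrite -expRM_natl mulrN mulrCA.
have qm : q ^+ m.+1 < 1 by rewrite exprn_ilt1 // ltW.
rewrite opprK addrC expRD expRN !lnK ?posrE ?subr_gt0 //.
rewrite -[LHS](mulfK (_ : 1 - q != 0)) ?subr_eq0 ?gt_eqF //.
congr (_ / _); rewrite -[1 in RHS](expr1n _ m.+1) subrXX mulrC; congr (_ * _).
apply: eq_bigr => i _; rewrite expr1n mul1r /q -expRM_natl.
by congr expR; rewrite natrM; ring.
Qed.

Definition Cm m : R := pi ^+ 2 / 6 * (1 - m.+1%:R^-1).

Lemma genfun_weight_bounds m e : 0 < e -> exists2 t0, 0 < t0 & exists2 T, 0 < T &
  forall t K, 0 < t < t0 -> T <= K%:R * t ->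
    expR ((Cm m - e) / t) <= genfun (@weight K m) t <= expR ((Cm m + e) / t).
Proof.
move=> e0; have [t0 t00 [T T0 h]] := Psi_ge e0.
have M1 : 1 <= m.+1%:R :> R by rewrite ler1n.
have M0 : 0 < m.+1%:R :> R by rewrite ltr0n.
(* So that [(m + 1) t] also stays below [t0]. *)
exists (t0 / m.+1%:R); first by rewrite divr_gt0.
exists T => // t K /andP[tp]; rewrite ltr_pdivlMr // mulrC => tt KT.
have Mtp : 0 < m.+1%:R * t by rewrite mulr_gt0.
have tMt : t <= m.+1%:R * t by rewrite ler_peMl // ltW.
have h1 := h t K _ KT; have h2 := h (m.+1%:R * t) K.
rewrite genfun_weight // !ler_expR.
have u1 := Psi_le K tp; have u2 := Psi_le K Mtp.
have {}h1 : (pi ^+ 2 / 6 - e) / t <= Psi K t by apply: h1; rewrite tp (le_lt_trans tMt).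
have {}h2 : (pi ^+ 2 / 6 - e) / (m.+1%:R * t) <= Psi K (m.+1%:R * t).
  apply: h2; rewrite ?Mtp ?tt //; apply: le_trans KT _.
  by rewrite ler_wpM2l ?ler0n.
move: h1 h2 u1 u2; rewrite /Cm invfM !mulrA; move: (Psi K t) (Psi _ _) => a b.
have i0 : 0 < t^-1 by rewrite invr_gt0.
have j0 : 0 < m.+1%:R^-1 :> R by rewrite invr_gt0.
have j1 : m.+1%:R^-1 <= 1 :> R by rewrite invf_le1.
move: (t^-1) (m.+1%:R^-1 : R) i0 j0 j1 => i j i0 j0 j1.
have ei : 0 <= e * i * (1 - j) by rewrite !mulr_ge0 ?subr_ge0 // ltW.
move: (pi ^+ 2 / 6) => P h1 h2 u1 u2; apply/andP; split; lra.
Qed.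

Definition cnt K m n : nat := #|[pred f | @weight K m f <= n]%N|.

Lemma cnt_upper m e : (0 < m)%N -> 0 < e -> exists2 A, 0 < A &
  forall x K n, A <= x -> A * x <= K%:R -> n%:R <= x ^+ 2 ->
    (cnt K m n)%:R <= expR ((2 * Num.sqrt (Cm m) + e) * x).
Proof.
move=> m0 e0; set c := Num.sqrt (Cm m).
have C0 : 0 < Cm m.
  rewrite mulr_gt0 ?divr_gt0 ?exprn_gt0 ?pi_gt0 // subr_gt0 invf_lt1 ?ltr0n //.
  by rewrite ltr1n.
have c0 : 0 < c by rewrite sqrtr_gt0.
have cc : Cm m = c ^+ 2 by rewrite sqr_sqrtr // ltW.
have [t0 t00 [T T0 h]] := genfun_weight_bounds m (mulr_gt0 e0 c0).
have ct0 : 0 < c / t0 by rewrite divr_gt0.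
have Tc0 : 0 < T / c by rewrite divr_gt0.
exists (c / t0 + T / c + 1); first by lra.
move=> x K n Ax AK nx; have x0 : 0 < x by lra.
(* [t = c / x] minimises [t * x ^+ 2 + c ^+ 2 / t]. *)
have t0' : 0 < c / x by rewrite divr_gt0.
apply: le_trans (genfun_upper (@weight K m) n (ltW t0')) _.
have /andP[_ u] : expR ((Cm m - e * c) / (c / x)) <= genfun (@weight K m) (c / x) <=
    expR ((Cm m + e * c) / (c / x)).
  apply: h; rewrite ?t0' /=.
    by rewrite ltr_pdivrMr // mulrC -ltr_pdivrMr //; lra.
  rewrite mulrA ler_pdivlMr // -ler_pdivrMr // mulrAC; apply: le_trans AK.
  by rewrite ler_pM2r //; lra.
apply: le_trans (ler_wpM2l (expR_ge0 _) u) _; rewrite -expRD ler_expR.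
apply: (@le_trans _ _ (c / x * x ^+ 2 + (Cm m + e * c) / (c / x))).
  by rewrite lerD2r ler_pM2l.
by rewrite cc (_ : _ + _ = (2 * c + e) * x) //; field; rewrite !gt_eqF.
Qed.

Lemma cnt_lower m e : (0 < m)%N -> 0 < e -> exists2 A, 0 < A &
  forall x K n, A <= x -> A * x <= K%:R -> x ^+ 2 <= n%:R ->
    expR ((2 * Num.sqrt (Cm m) - e) * x) <= (cnt K m n)%:R.
Proof.
move=> m0 e0; set c := Num.sqrt (Cm m).
have C0 : 0 < Cm m.
  rewrite mulr_gt0 ?divr_gt0 ?exprn_gt0 ?pi_gt0 // subr_gt0 invf_lt1 ?ltr0n //.
  by rewrite ltr1n.
have c0 : 0 < c by rewrite sqrtr_gt0.
have cc : Cm m = c ^+ 2 by rewrite sqr_sqrtr // ltW.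
(* The final exponent is at least [c x (2 - 7 d) - 1], so [7 d c <= e / 2] suffices once
   [1 <= e x / 2]. *)
pose d := Num.min 1 (e / (14 * c)).
have d0 : 0 < d by rewrite lt_min ltr01 divr_gt0 // mulr_gt0.
have d1 : d <= 1 by rewrite ge_min lexx.
have de : 7 * d * c <= e / 2.
  have : d <= e / (14 * c) by rewrite ge_min lexx orbT.
  by rewrite ler_pdivlMr ?mulr_gt0 //; lra.
(* In [lo] the second-order gain [c^2 d^2 / 4] must pay for four terms [e']: one error in each of
   the two estimates of the generating function, and two for the [2 <= 2 e' / t] that yields the
   factor [1 / 4]. *)
pose e' := c ^+ 2 * d ^+ 2 / 16.
have e'0 : 0 < e' by rewrite divr_gt0 ?mulr_gt0 ?exprn_gt0.
have [t0 t00 [T T0 h]] := genfun_weight_bounds m e'0.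
pose t1 := Num.min (t0 / 2) e'.
have t10 : 0 < t1 by rewrite lt_min e'0 andbT divr_gt0.
have ct1 : 0 < 2 * c / t1 by rewrite divr_gt0 ?mulr_gt0.
have Tc0 : 0 < 2 * T / c by rewrite divr_gt0 ?mulr_gt0.
have ie : 0 < 2 / e by rewrite divr_gt0.
exists (2 * c / t1 + 2 * T / c + 2 / e + 1); first by lra.
move=> x K n Ax AK nx; have x0 : 0 < x by lra.
(* The tilted mean of [weight], about [c ^+ 2 / t ^+ 2], lies in [[(1 - 3 d) x ^+ 2, x ^+ 2]]. *)
pose t := c * (1 + d) / x; pose th := d / 2 * t.
have tp : 0 < t by rewrite divr_gt0 // mulr_gt0 //; lra.
have thp : 0 < th by rewrite mulr_gt0 //; lra.
have tht : th <= t / 2 by rewrite /th mulrAC ler_pM2r ?invr_gt0 // ler_piMl // ltW.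
have tt1 : t <= t1.
  rewrite ler_pdivrMr // [t1 * x]mulrC -ler_pdivrMr //.
  apply: (@le_trans _ _ (2 * c / t1)); last by lra.
  by rewrite ler_pM2r ?invr_gt0 // [2 * c]mulrC ler_pM2l //; lra.
have tt0 : t <= t0 / 2 by apply: le_trans tt1 _; rewrite ge_min lexx.
have tte : t <= e' by apply: le_trans tt1 _; rewrite ge_min lexx orbT.
have KT (s : R) : t / 2 <= s -> T <= K%:R * s.
  move=> ts; apply: (@le_trans _ _ (K%:R * (t / 2))); last by rewrite ler_wpM2l.
  have hK : 2 * T / c * x <= K%:R.
    by apply: le_trans AK; rewrite ler_pM2r //; lra.
  apply: (@le_trans _ _ (2 * T / c * x * (t / 2))); last by apply: ler_wpM2r hK; lra.
  rewrite (_ : _ * _ = T * (1 + d)); first by have := mulr_gt0 T0 d0; lra.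
  by rewrite /t; field; rewrite !gt_eqF.
pose y := (1 - 3 * d) * x ^+ 2.
pose g : R -> R := genfun (@weight K m).
have /andP[gl _] : expR ((Cm m - e') / t) <= g t <= expR ((Cm m + e') / t).
  by apply: h; [rewrite tp /=; lra | apply: KT; lra].
have /andP[_ gu1] : expR ((Cm m - e') / (t + th)) <= g (t + th) <= expR ((Cm m + e') / (t + th)).
  by apply: h; [apply/andP; split; lra | apply: KT; lra].
have /andP[_ gu2] : expR ((Cm m - e') / (t - th)) <= g (t - th) <= expR ((Cm m + e') / (t - th)).
  by apply: h; [apply/andP; split; lra | apply: KT; lra].
have e2 : expR (- 2) <= 1 / 4 :> R.
  rewrite (_ : - 2 = - 1 + - 1 :> R); last by ring.
  rewrite expRD expRN.
  have := expR_ge1Dx (1 : R) => h1.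
  have h2 : (expR 1)^-1 <= 2^-1 :> R by rewrite lef_pV2 ?posrE ?expR_gt0 //; lra.
  have h3 : 0 <= (expR 1)^-1 :> R by rewrite invr_ge0 expR_ge0.
  by nra.
have tail a : a <= (Cm m - e') / t - 2 -> expR a <= g t / 4.
  move=> /(le_trans _) ha; rewrite -[X in X / 4]mulr1 -mulrA.
  apply: le_trans (ler_pM (expR_ge0 _) (expR_ge0 _) gl e2).
  by rewrite -expRD ler_expR; apply: ha.
have xt : x ^+ 2 = c ^+ 2 * (1 + d) ^+ 2 / t ^+ 2.
  by rewrite /t; field; rewrite !gt_eqF //; lra.
have te : 2 <= 2 * e' / t by rewrite ler_pdivlMr // ler_pM2l.
have lo : expR (th * y) * g (t + th) <= g t / 4.
  apply: le_trans (ler_wpM2l (expR_ge0 _) gu1) _; rewrite -expRD; apply: tail.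
  have thy : th * y = d / 2 * (1 - 3 * d) * (1 + d) ^+ 2 * c ^+ 2 * t^-1.
    by rewrite /th /y xt; field; rewrite gt_eqF.
  have inv : (t + th)^-1 <= (1 - d / 2 + d ^+ 2 / 4) * t^-1.
    rewrite -[leLHS]mul1r ler_pdivrMr; last lra.
    rewrite -mulrA (_ : t^-1 * (t + th) = 1 + d / 2); last by rewrite /th; field; rewrite gt_eqF.
    by have : 0 <= d ^+ 3 by [rewrite exprn_ge0 // ltW]; lra.
  have : (Cm m + e') / (t + th) <= (c ^+ 2 * (1 - d / 2 + d ^+ 2 / 4) + e') * t^-1.
    apply: (@le_trans _ _ ((Cm m + e') * ((1 - d / 2 + d ^+ 2 / 4) * t^-1))).
      by rewrite ler_pM2l //; lra.
    rewrite cc mulrA ler_pM2r ?invr_gt0 // mulrDl lerD2l ler_piMr ?ltW //.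
    by have : d ^+ 2 <= d by [rewrite expr2 ler_piMl // ltW]; lra.
  rewrite thy cc => {}inv.
  have i0 : 0 < t^-1 by rewrite invr_gt0.
  suff : 0 <= c ^+ 2 * (d ^+ 3 * (5 + 3 * d)) / 2 * t^-1 by rewrite /e' in inv te *; lra.
  by apply/ltW; rewrite !mulr_gt0 ?exprn_gt0 //; lra.
have hi : expR (- (th * n%:R)) * g (t - th) <= g t / 4.
  apply: le_trans (ler_wpM2l (expR_ge0 _) gu2) _; rewrite -expRD; apply: tail.
  have thn : d / 2 * (1 + d) ^+ 2 * c ^+ 2 * t^-1 <= th * n%:R.
    apply: le_trans (ler_wpM2l (ltW thp) nx); rewrite xt /th.
    rewrite (_ : _ * t^-1 = d / 2 * t * (c ^+ 2 * (1 + d) ^+ 2 / t ^+ 2)) //.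
    by field; rewrite gt_eqF.
  have inv : (t - th)^-1 <= (1 + d / 2 + d ^+ 2 / 2) * t^-1.
    rewrite -[leLHS]mul1r ler_pdivrMr; last lra.
    rewrite -mulrA (_ : t^-1 * (t - th) = 1 - d / 2); last by rewrite /th; field; rewrite gt_eqF.
    have : 0 <= d ^+ 2 * (1 - d) by rewrite mulr_ge0 ?exprn_ge0 ?subr_ge0 // ltW.
    by lra.
  have : (Cm m + e') / (t - th) <= (c ^+ 2 * (1 + d / 2 + d ^+ 2 / 2) + 2 * e') * t^-1.
    apply: (@le_trans _ _ ((Cm m + e') * ((1 + d / 2 + d ^+ 2 / 2) * t^-1))).
      by rewrite ler_pM2l //; lra.
    rewrite cc mulrA ler_pM2r ?invr_gt0 // mulrDl lerD2l mulrC ler_pM2r //.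
    by have : d ^+ 2 <= d by [rewrite expr2 ler_piMl // ltW]; lra.
  rewrite cc => {}inv.
  have i0 : 0 < t^-1 by rewrite invr_gt0.
  suff : 0 <= c ^+ 2 * (d ^+ 3 + d ^+ 2 / 8) * t^-1 by rewrite /e' in inv te *; lra.
  by apply/ltW; rewrite !mulr_gt0 ?exprn_gt0 // addr_gt0 ?divr_gt0 ?exprn_gt0.
have := genfun_lower tp (ltW thp) lo hi; rewrite -/(cnt K m n); apply: le_trans.
have e1 : expR (-1) <= 1 / 2 :> R.
  have := expR_ge1Dx (1 : R) => h1.
  by rewrite expRN mul1r lef_pV2 ?posrE ?expR_gt0 //; lra.
apply: (@le_trans _ _ (expR (t * y) * (expR ((Cm m - e') / t) * expR (-1)))); last first.
  rewrite ler_pM2l ?expR_gt0 //; apply: ler_pM; rewrite ?expR_ge0 //; lra.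
rewrite -!expRD ler_expR.
have -> : t * y = c * x * (1 - 2 * d - 3 * d ^+ 2).
  by rewrite /t /y; field; rewrite gt_eqF.
have : c * x * (1 - d - d ^+ 2 / 16) <= (Cm m - e') / t.
  have -> : (Cm m - e') / t = c * x * (1 - d ^+ 2 / 16) / (1 + d).
    by rewrite /t /e' cc; field; rewrite !gt_eqF //; lra.
  rewrite -[in leRHS]mulrA ler_pM2l ?mulr_gt0 // ler_pdivlMr; last lra.
  have : 0 <= d ^+ 3 by rewrite exprn_ge0 // ltW.
  by have : 0 <= d ^+ 2 by [rewrite exprn_ge0 // ltW]; lra.
have d2 : c * x * d ^+ 2 <= c * x * d.
  by rewrite ler_pM2l ?mulr_gt0 // expr2 ler_piMl // ltW.
have ex : 1 <= e / 2 * x.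
  have : 2 / e <= x by lra.
  by rewrite ler_pdivrMr //; lra.
have : 7 * d * c * x <= e / 2 * x by rewrite ler_pM2r.
have : 0 <= c * x * d by rewrite !mulr_ge0 // ltW.
lra.
Qed.
End BoundedParts.

(** * Structure of zero-sum-free sequences *)

Section Thresholds.
Local Open Scope nat_scope.

(** With [q = w / (2 (k + 1))] one has [w < (q + 1)^2], so [w^k] is at most
    [(q + 1)^(2k) <= 2^(2kq) < 2^w]. *)
Lemma expn_lt_exp2 k : exists W, forall w, W <= w -> w ^ k < 2 ^ w.
Proof.
exists (2 * k.+1 * (2 * k.+1)) => w Ww; pose q := w %/ (2 * k.+1).
have qk : 2 * k.+1 <= q by rewrite leq_divRL.
have wq : w < q.+1 * (2 * k.+1) by apply: ltn_ceil.
have wq2 : w < q.+1 ^ 2 by apply: leq_trans wq _; rewrite -mulnn leq_mul2l; lia.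
apply: (@leq_ltn_trans (q.+1 ^ (2 * k))); first by rewrite expnM; case: (k) => // k'; rewrite leq_exp2r // ltnW.
apply: (@leq_ltn_trans ((2 ^ q) ^ (2 * k))).
  by case: (k) => // k'; rewrite mulnS leq_exp2r // ltn_expl.
rewrite -expnM ltn_exp2l //; apply: leq_trans (leq_divM w (2 * k.+1)).
by rewrite -/q ltn_pmul2l; [lia | apply: leq_trans qk; rewrite muln_gt0].
Qed.

(** Bernoulli's inequality for [(1 - 1 / (w + 1))^n], cleared of denominators. *)
Lemma ltn_expn_succ w n : n <= w.+1 -> w.+1 ^ n * (w.+1 - n) <= w ^ n * w.+1.
Proof.
elim: n => [|n ih] nw; first by rewrite subn0.
have : w.+1 * (w.+1 - n.+1) <= w * (w.+1 - n) by nia.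
move=> h; rewrite !expnSr -mulnA; apply: (@leq_trans (w.+1 ^ n * (w * (w.+1 - n)))).
  by rewrite leq_mul2l h orbT.
by rewrite mulnCA [w ^ n * w]mulnC -[leqRHS]mulnA leq_mul2l ih ?orbT // ltnW.
Qed.

Lemma expn_succ_le2 w n : 2 * n <= w.+1 -> w.+1 ^ n <= 2 * w ^ n.
Proof.
move=> nw; have := @ltn_expn_succ w n; move: (w.+1 ^ n) (w ^ n) => x y h.
have {}h : x * (w.+1 - n) <= y * w.+1 by apply: h; lia.
rewrite -(leq_pmul2r (ltn0Sn w)).
have : x * w.+1 <= 2 * (x * (w.+1 - n)) by nia.
by move=> h2; nia.
Qed.

(* [f] stands for [expn w]: keeping it abstract prevents the evaluation of huge powers.
   All the thresholds of the argument are powers of [w], where [p] is about [w ^ 200]. *)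
Lemma parameter_bounds (f : nat -> nat) (w p m D K : nat) :
  (forall a b, f a * f b = f (a + b)) -> f 1 = w -> (forall a, 0 < f a) ->
  (forall a b, a <= b -> f a <= f b) ->
  200 <= w -> m <= w -> 400 * D <= w -> 3 < D -> f 200 <= p <= 2 * f 200 ->
  K = 3 * f 90 + 2 * f 90 * w.+1 ->
  [/\ [/\ f 90 + m * f 89 <= 2 * f 90, f 90 < 2 * f 90, 3 * f 90 * m <= f 96 - K,
        2 * K <= f 96 & 24 < f 90 <= p],
      [/\ 2 * f 179 <= p, 24 * f 179 <= f 90 ^ 2, p < (f 90).+1 * (2 * f 110),
        4 * f 107 <= 4 * f 18 * f 89 & 2 * f 106 <= f 107],
      [/\ 12 * (3 * (4 * f 18) * (2 * f 110) + f 46 * f 105) <= f 179,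
        24 * (3 * (4 * f 18) * (2 * f 110) + f 46 * f 105) < f 106 * f 46,
        2 * (3 * (4 * f 18) * f 153 + f 46 * f 153) < p & 0 < 4 * f 18],
      [/\ p <= f 105 * (2 * f 95), 2 * (2 * f 95) < f 96 - 2 * K,
        30 * (3 * (4 * f 18) * (2 * f 110)) <= f 179, 30 * f 107 <= f 179 & 0 < f 179] &
      [/\ 2 * (3 * (4 * f 18) * f 107 + p %/ D) < p,
        31 * (p %/ D + (2 * K + 4) * f 107).+1 < 50 * (p %/ D),
        2 * K + w * f 96 <= f 98 & w.+1 * f 96 <= f 98]].
Proof.
move=> fD f1 f0 fm w200 mw wD D3 /andP[p1 p2] KE.
have fS a : f a.+1 = w * f a by rewrite -add1n -fD f1.
have st a : 200 * f a <= f a.+1 by rewrite fS leq_mul2r w200 orbT.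
have s90 := st 90; have K91 : K <= 3 * f 91.
  by have e := fS 90; rewrite KE; clear -s90 e; nia.
have mf a : m * f a <= f a.+1 by rewrite fS leq_mul2r mw orbT.
have l9196 : f 92 <= f 96 by apply: fm.
have e107 : f 18 * f 89 = f 107 := fD 18 89.
have e128 : f 18 * f 110 = f 128 := fD 18 110.
have e151 : f 46 * f 105 = f 151 := fD 46 105.
have e152 : f 106 * f 46 = f 152 := fD 106 46.
have e171 : f 18 * f 153 = f 171 := fD 18 153.
have e199 : f 46 * f 153 = f 199 := fD 46 153.
have e200 : f 105 * f 95 = f 200 := fD 105 95.
have e200' : f 90 * f 110 = f 200 := fD 90 110.
have e180 : f 90 ^ 2 = f 180 by rewrite -mulnn; apply: (fD 90 90).
have e125 : f 18 * f 107 = f 125 := fD 18 107.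
have e198 : f 91 * f 107 = f 198 := fD 91 107.
have E128 : 3 * (4 * f 18) * (2 * f 110) = 24 * f 128 by rewrite -e128; ring.
have E171 : 3 * (4 * f 18) * f 153 = 12 * f 171 by rewrite -e171; ring.
have E125 : 3 * (4 * f 18) * f 107 = 12 * f 125 by rewrite -e125; ring.
split; split.
- by move: (mf 89); clear; lia.
- by move: (f0 90); clear; lia.
- by move: (mf 90) (st 91) l9196 K91; rewrite mulnAC -mulnA; clear; lia.
- by move: (st 91) l9196 K91; clear; lia.
- have : f 90 <= f 200 by apply: fm.
  have : f 1 <= f 90 by apply: fm.
  by rewrite f1; clear -w200 p1; lia.
- have : f 180 <= f 200 by apply: fm.
  by move: (st 179); clear -p1; lia.
- by rewrite e180; move: (st 179); clear; lia.
- rewrite mulSn mulnCA e200'; move: (f0 110); clear -p2; lia.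
- by rewrite -mulnA e107.
- by move: (st 106); clear; lia.
- have : f 152 <= f 179 by apply: fm.
  have : f 129 <= f 151 by apply: fm.
  by rewrite E128 e151; move: (st 151) (st 128); clear; lia.
- have : f 129 <= f 151 by apply: fm.
  by rewrite E128 e151 e152; move: (st 151) (st 128) (f0 151); clear; lia.
- have : f 172 <= f 199 by apply: fm.
  rewrite E171 e199; move: (st 199) (st 171) (f0 199); clear -p1; lia.
- by move: (f0 18); clear; lia.
- by rewrite mulnCA e200.
- by move: (st 95) (st 91) (f0 95) K91 (fm 92 95 isT); clear; lia.
- have : f 130 <= f 179 by apply: fm.
  by rewrite E128; move: (st 128) (st 129); clear; lia.
- have : f 108 <= f 179 by apply: fm.
  by move: (st 107); clear; lia.
- exact: f0.
- have : f 126 <= f 200 by apply: fm.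
  have : p %/ D * 4 <= p.
    by apply: leq_trans (leq_divM p D); rewrite leq_mul2l D3 orbT.
  by rewrite E125; move: (st 125) (f0 125); clear -p1; lia.
- have pD : p < (p %/ D).+1 * D by rewrite ltn_ceil // (leq_trans _ D3).
  have fe : f 199 * 400 <= p %/ D.
    rewrite -ltnS -(ltn_pmul2r (leq_trans _ D3 : 0 < D)) //; apply: leq_ltn_trans pD.
    by apply: leq_trans p1; rewrite (fS 199) -mulnA mulnC leq_mul2r wD orbT.
  have : (2 * K + 4) * f 107 <= 7 * f 198.
    rewrite -e198 mulnA leq_mul2r; apply/orP; right.
    by move: (st 90) (f0 90) K91; clear; lia.
  by move: fe (st 198) (f0 198); clear; lia.
- have : f 92 <= f 97 by apply: fm.
  by rewrite -(fS 96); move: (st 97) (st 91) K91; clear; lia.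
- by rewrite mulSn -(fS 96); move: (st 97) (st 96); clear; lia.
Qed.

End Thresholds.

Section Structure.
Local Open Scope nat_scope.
Variable R : realType.

(** The exceptional [w^98] elements are negligible against [sqrt p], about [w^100], even after
    multiplication by [ln p]. *)
Theorem zsf_structure (m D : nat) : 0 < m -> 3 < D -> exists W, forall w p (A : seq 'Z_p),
  W <= w -> prime p -> w ^ 200 <= p <= 2 * w ^ 200 -> zsf A ->
  (forall x, count_mem x A <= m) ->
  size A <= w ^ 98 \/
  exists2 d : 'Z_p, d != 0%R & exists X P N, [/\ perm_eq A (X ++ P ++ N), size X <= w ^ 98,
    \sum_(x <- P) val (d * x)%R <= p + 2 * (p %/ D) /\
    \sum_(x <- N) val (- d * x)%R <= p + 2 * (p %/ D) &
    \sum_(x <- P) val (d * x)%R <= 2 * (p %/ D) \/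
    \sum_(x <- N) val (- d * x)%R <= 2 * (p %/ D)].
Proof.
move=> m0 D3; have [W0 HW0] := expn_lt_exp2 401.
exists (W0 + m + 200 + 400 * D) => w p A Ww p_pr wpw zA mA.
have [w200 mw wD W0w] : [/\ 200 <= w, m <= w, 400 * D <= w & W0 <= w].
  by move: Ww; clear; split; lia.
have w2 : w ^ 401 < 2 ^ w := HW0 w W0w.
have w0 : 0 < w by apply: leq_trans w200.
have : exists f : nat -> nat, f = expn w by exists (expn w).
case=> f fE; rewrite -[w ^ 98]/(expn w 98) -fE; rewrite -[w ^ 401]/(expn w 401) -fE in w2.
rewrite -[w ^ 200]/(expn w 200) -fE in wpw.
have fD a b : f a * f b = f (a + b) by rewrite fE expnD.
have f1 : f 1 = w by rewrite fE expn1.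
have f0 a : 0 < f a by rewrite fE expn_gt0 w0.
have fm a b : a <= b -> f a <= f b by rewrite fE; apply: leq_pexp2l.
have [[b1 b2 b3 b4 b5] [b6 b7 b8 b9 b10] [b11 b12 b13 b14] [b15 b16 b17 b18 b19]
  [b20 b21 b22 b23]] := parameter_bounds fD f1 f0 fm w200 mw wD D3 wpw erefl.
have fS a : f a.+1 = w * f a by rewrite -add1n -fD f1.
have st a : 200 * f a <= f a.+1 by rewrite fS leq_mul2r w200 orbT.
have /andP[p1 p2] := wpw.
have p_odd : odd p.
  case: (even_prime p_pr) => // e; move: p1 (st 199) (f0 199); rewrite e; clear; lia.
have [sA|sA] := leqP (size A) (f 98); [by left | right].
have pp : p ^ 2 <= 4 * f 400.
  have -> : 4 * f 400 = (2 * f 200) ^ 2 by rewrite -mulnn mulnACA fD.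
  by rewrite leq_exp2r.
(* Up to constants, [exists_near_dilation] with [j = w] asks that [E M0^2] exceed [p^2 w]; in
   exponents of [w], [96 + 2 * 153 = 402] against [401]. *)
have near : exists2 d : 'Z_p, d != 0%R &
    count (fun a : 'Z_p => f 153 < absz (rep (d * a)%R)) A <= f 96.
  apply: (@exists_near_dilation R p p_pr p_odd (f 153) (f 96) w A zA).
  - apply: (@leq_trans (2 ^ w)).
      have := fm 201 401 isT; move: (st 200) w2 p2; clear; lia.
    rewrite leq_exp2l //; apply: leq_trans (ltnW sA).
    by rewrite -[leqLHS]f1; apply: fm.
  - apply: (@leq_trans (4 * (f 96 * f 153 ^ 2))); last by rewrite leq_mul2l leq_mul2r leqnSn orbT.
    apply: (@leq_trans (20 * f 401)).
      rewrite (fS 400) (mulnC w) mulnA leq_mul2r; apply/orP; right.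
      by move: pp; clear; lia.
    rewrite -mulnn (fD 153 153 : _ = f 306) (fD 96 306 : _ = f 402).
    by move: (st 401); clear; lia.
  by move: w2 pp (st 400); clear; lia.
have M0r : f 153 < 2 ^ w by apply: leq_ltn_trans w2; apply: fm.
(* The values are [E = w^96], [e = k = w^90], [n = w^89], [N = 2 w^90], [s0 = w^179], [L = 2 w^110],
   [t = 4 w^18], [R = w^107], [R' = w^106], [H = w^46], [l = w^105], [q = 2 w^95], [r = w] and
   [e0 = p / D]. *)
have [d d0 [X [P [N [pA sX sums small]]]]] := structure_Zp p_pr p_odd zA mA M0r
  (leq_ltn_trans b23 sA) near m0 erefl b1 b2 b3 b4 b5 b6 b7 b8 b9 b10 b11 b12 b13 b14 b15
  b16 b17 b18 b19 b20 b21.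
by exists d => //; exists X, P, N; split=> //; apply: leq_trans sX b22.
Qed.

End Structure.

(** * Counting *)

Section Counting.
Local Open Scope nat_scope.

Lemma card_fset_code (K : choiceType) (T : finType) (dec : T -> K) (X : {fset K}) :
  (forall A, A \in X -> exists c, dec c = A) -> #|` X| <= #|T|.
Proof.
move=> h.
have ex (A : X) : exists c, dec c == val A by have [c <-] := h _ (valP A); exists c.
rewrite cardfE; apply: (@leq_card _ _ (fun A => xchoose (ex A))) => A B AB.
by apply: val_inj; rewrite -(eqP (xchooseP (ex A))) AB (eqP (xchooseP (ex B))).
Qed.

Lemma card_fset_inj (K : choiceType) (T : finType) (f : T -> K) (X : {fset K}) :
  injective f -> (forall c, f c \in X) -> #|T| <= #|` X|.
Proof.
move=> fI fX; rewrite cardfE; apply: (@leq_card _ _ (fun c => FSetSub (fX c))) => c d.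
by move=> /(congr1 val) /= /fI.
Qed.

Variables (p m : nat).
Hypothesis p_pr : prime p.
Let p0 : 0 < p := prime_gt0 p_pr.
Let p1 : 1 < p := prime_gt1 p_pr.

Definition parts (u : 'Z_p) (f : {ffun 'I_p.-1 -> 'I_m.+1}) : seq 'Z_p :=
  flatten [seq nseq (f k) (u * (val k).+1%:R)%R | k <- enum 'I_p.-1].

Lemma big_parts u f (F : 'Z_p -> nat) :
  \sum_(x <- parts u f) F x = \sum_(k < p.-1) f k * F (u * k.+1%:R)%R.
Proof.
rewrite big_flatten big_map big_enum; apply: eq_bigr => k _.
by rewrite big_nseq iter_addn_0 mulnC.
Qed.

Lemma count_parts u f (a : pred 'Z_p) :
  count a (parts u f) = \sum_(k < p.-1) f k * a (u * k.+1%:R)%R.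
Proof. by rewrite -sum1_count big_mkcond big_parts; apply: eq_bigr => k _; case: (a _). Qed.

Lemma val_succ (k : 'I_p.-1) : val (k.+1%:R : 'Z_p)%R = k.+1.
Proof. by rewrite /= val_Zp_nat // modn_small //; have := ltn_ord k; lia. Qed.

Lemma count_mem_parts u d f (k : 'I_p.-1) : (d * u = 1)%R ->
  count_mem (u * k.+1%:R)%R (parts u f) = f k.
Proof.
move=> du; rewrite count_parts (bigD1 k) //= eqxx muln1 big1 ?addn0 // => i ik.
case: eqP => [/(congr1 ( *%R d))|]; last by rewrite muln0.
rewrite !mulrA du !mul1r => /(congr1 val); rewrite !val_succ => -[] /val_inj e.
by rewrite e eqxx in ik.
Qed.

Lemma sum_val_parts u d f : (d * u = 1)%R ->
  \sum_(x <- parts u f) val (d * x)%R = weight f.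
Proof.
by move=> du; rewrite big_parts; apply: eq_bigr => k _; rewrite mulrA du mul1r val_succ.
Qed.

Lemma Zp_succ (x : 'Z_p) : (x != 0)%R -> exists k : 'I_p.-1, x = k.+1%:R%R.
Proof.
move=> x0; have xp : (val x).-1 < p.-1.
  have v0 : val x != 0 by apply: contra x0 => /eqP v; apply/eqP/val_inj.
  have : val x < p by apply: leq_trans (ltn_ord x) _; rewrite Zp_cast.
  by move: (val x) v0 => v; case: v => [|k] // _; lia.
exists (Ordinal xp); rewrite -[LHS]natr_Zp /= prednK // lt0n.
by apply: contra x0 => /eqP v; apply/eqP/val_inj.
Qed.

Lemma parts_of_seq (s : seq 'Z_p) (u d : 'Z_p) : (d * u = 1)%R ->
    all (fun x => x != 0%R) s -> (forall x, count_mem x s <= m) ->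
  exists2 f, perm_eq s (parts u f) & weight f = \sum_(x <- s) val (d * x)%R.
Proof.
move=> du s0 sm.
pose f : {ffun 'I_p.-1 -> 'I_m.+1} := [ffun k : 'I_p.-1 => inord (count_mem (u * k.+1%:R)%R s)].
have ps : perm_eq s (parts u f).
  apply/allP => x _ /=; apply/eqP; have [->|x0] := eqVneq x 0%R.
    rewrite [RHS]count_parts big1 => [|k _ /=]; last first.
      case: eqP => [/(congr1 ( *%R d))|]; last by rewrite muln0.
      by rewrite mulrA du mul1r mulr0 => /(congr1 val); rewrite val_succ.
    by apply/count_memPn; apply/negP => /(allP s0); rewrite eqxx.
  have ud : (u * d = 1)%R by rewrite mulrC.
  have [|k xk] := @Zp_succ (d * x)%R.
    by apply: contra x0 => /eqP /(congr1 ( *%R u)); rewrite mulrA ud mul1r mulr0 => ->.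
  have -> : x = (u * k.+1%:R)%R by rewrite -xk mulrA ud mul1r.
  by rewrite (count_mem_parts _ _ du) ffunE inordK // ltnS.
exists f => //; rewrite -(sum_val_parts f du); apply: perm_big; by rewrite perm_sym.
Qed.

Lemma zero_sum_freeP (A : zseq p) : zero_sum_free A -> zsf (enum_mset A).
Proof.
move=> zA s sA s0; apply/eqP => se; apply: (zA (seq_mset s)).
- by apply/msubsetP => x; rewrite mset_seqE -[A x]count_mem_mset.
- move=> e; case: s s0 e {sA se} => // x s _ /msetP /(_ x).
  by rewrite mset_seqE mset0E /= eqxx.
- by rewrite (perm_big _ (perm_eq_seq_mset s)).
Qed.

Lemma max_multP (A : zseq p) : max_mult A <= m -> forall x, count_mem x (enum_mset A) <= m.
Proof.
move=> Am x; rewrite count_mem_mset; apply: leq_trans Am.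
by rewrite /max_mult (bigD1 x) //= leq_maxl.
Qed.

(** As integers, the elements of a nonempty [B] are positive and sum to at most [weight f < p], so
    [p] does not divide their sum. *)
Lemma zero_sum_free_parts f : weight f < p -> zero_sum_free (seq_mset (parts 1%R f)).
Proof.
move=> wf B /msubsetP BA B0 sB.
have cB x : count_mem x (enum_mset B) <= count_mem x (parts 1%R f).
  by rewrite count_mem_mset -mset_seqE.
have B00 : 0%R \notin enum_mset B.
  rewrite -has_pred1 has_count -leqNgt; apply: leq_trans (cB 0%R) _.
  rewrite count_parts big1 // => k _ /=; case: eqP => [|]; last by rewrite muln0.
  by rewrite mul1r => /(congr1 val); rewrite val_succ.
have sum_count (s : seq 'Z_p) : \sum_(x <- s) val x = \sum_(x : 'Z_p) count_mem x s * val x.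
  elim: s => [|y s ih]; first by rewrite big_nil big1.
  rewrite big_cons ih (bigD1 y) //= [in RHS](bigD1 y) //= eqxx mulnDl mul1n addnA; congr (_ + _).
  by apply: eq_bigr => x xy; rewrite eq_sym (negPf xy).
have le : \sum_(x <- enum_mset B) val x <= weight f.
  have <- := @sum_val_parts 1%R 1%R f (mulr1 _).
  have -> : \sum_(x <- parts 1%R f) val (1 * x)%R = \sum_(x <- parts 1%R f) val x.
    by apply: eq_bigr => x _; rewrite mul1r.
  by rewrite !sum_count; apply: leq_sum => x _; rewrite leq_mul2r cB orbT.
have /dvdnP[q] : p %| \sum_(x <- enum_mset B) val x.
  by have := dvdn_sum_val p_pr (enum_mset B); rewrite big_map sB eqxx => ->.
move: B00 le; have : enum_mset B != [::].
  apply: contra_notN B0 => /eqP e; apply/msetP => x.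
  by rewrite -count_mem_mset e mset0E.
case: (enum_mset B) => // x s _; rewrite inE negb_or big_cons => /andP[x0 _] le eq.
have : 0 < val x by rewrite lt0n; apply: contra x0 => /eqP v; apply/eqP/val_inj.
by case: q eq => [|q]; lia.
Qed.

Lemma max_mult_parts f : max_mult (seq_mset (parts 1%R f)) <= m.
Proof.
apply/bigmax_leqP => x _; rewrite mset_seqE; have [->|x0] := eqVneq x 0%R.
  rewrite count_parts big1 // => k _ /=; case: eqP => [|]; last by rewrite muln0.
  by rewrite mul1r => /(congr1 val); rewrite val_succ.
have [k ->] := Zp_succ x0; rewrite -[X in count_mem X](mul1r (k.+1%:R)%R).
by rewrite (count_mem_parts _ _ (mulr1 _)) -ltnS.
Qed.

Lemma cnt_le_N1 n : n < p -> cnt p.-1 m n <= N1 m p.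
Proof.
move=> np; pose T := {f : {ffun 'I_p.-1 -> 'I_m.+1} | weight f <= n}.
have -> : cnt p.-1 m n = #|{: T}| by rewrite card_sig; apply: eq_card => f; rewrite !inE.
apply: (@card_fset_inj _ _ (fun f : T => seq_mset (parts 1%R (val f)))) => [f g fg|f].
  apply/val_inj/ffunP => k; apply: val_inj.
  rewrite /= -(count_mem_parts _ k (mulr1 1%R)) -mset_seqE fg mset_seqE.
  by rewrite (count_mem_parts _ k (mulr1 1%R)).
rewrite in_fset_set; last exact: finite_zsf_bounded.
rewrite inE; split; last exact: max_mult_parts.
by apply: zero_sum_free_parts; apply: leq_ltn_trans np; apply: (valP f).
Qed.


(** A sequence is decoded from its exceptional elements, a dilation and two bounded partitions, one
    of them of small weight. *)
Lemma N1_le E a b :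
    (forall s : seq 'Z_p, zsf s -> (forall x, count_mem x s <= m) ->
      size s <= E \/
      exists2 d : 'Z_p, d != 0%R & exists X P N, [/\ perm_eq s (X ++ P ++ N), size X <= E,
        \sum_(x <- P) val (d * x)%R <= a /\ \sum_(x <- N) val (- d * x)%R <= a &
        \sum_(x <- P) val (d * x)%R <= b \/ \sum_(x <- N) val (- d * x)%R <= b]) ->
  N1 m p <= p.+1 ^ E + p * p.+1 ^ E * (cnt p.-1 m a * cnt p.-1 m b).
Proof.
move=> st.
pose Ta := {f : {ffun 'I_p.-1 -> 'I_m.+1} | weight f <= a}.
pose Tb := {f : {ffun 'I_p.-1 -> 'I_m.+1} | weight f <= b}.
(* Shorter lists are padded with [None], which accounts for the base [p + 1]. *)
pose O := (E.-tuple (option 'Z_p))%type.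
pose ch (t : O) : seq 'Z_p := pmap id t.
have chE (s : seq 'Z_p) : size s <= E -> exists t, ch t = s.
  move=> sE; have sz : size (map Some s ++ nseq (E - size s) None) == E.
    by rewrite size_cat size_map size_nseq subnKC.
  exists (Tuple sz); rewrite /ch /= pmap_cat map_pK //.
  by elim: (E - size s) => [|k ih]; rewrite /= ?cats0.
pose dec (c : O + 'Z_p * O * (Ta * Tb)) : zseq p := match c with
  | inl t => seq_mset (ch t)
  | inr (u, t, (f, g)) => seq_mset (ch t ++ parts u (val f) ++ parts (- u)%R (val g))
  end.
have oO : #|{: O}| = p.+1 ^ E by rewrite card_tuple card_option card_ord Zp_cast.
have cab n : #|{: {f : {ffun 'I_p.-1 -> 'I_m.+1} | weight f <= n}}| = cnt p.-1 m n.
  by rewrite card_sig; apply: eq_card => f; rewrite !inE.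
have -> : p.+1 ^ E + p * p.+1 ^ E * (cnt p.-1 m a * cnt p.-1 m b) =
    #|{: O + 'Z_p * O * (Ta * Tb)}|.
  by rewrite card_sum !card_prod oO !cab card_ord Zp_cast.
apply: (@card_fset_code _ _ dec) => A; rewrite in_fset_set; last exact: finite_zsf_bounded.
rewrite inE => -[/zero_sum_freeP zA /max_multP mA].
have AE s : perm_eq (enum_mset A) s -> seq_mset s = A.
  by move=> /eq_seq_msetP <-; rewrite seq_mset_id.
case: (st _ zA mA) => [/chE[t tA]|[d d0 [X [P [N [pA /chE[t tX] PNa PNb]]]]]].
  by exists (inl t); rewrite /= tA AE.
have du : (d * d^-1 = 1)%R by rewrite divrr // (Zp_unit p_pr).
have du' : (- d * - d^-1 = 1)%R by rewrite mulrNN.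
have := zsf_neq0 zA; rewrite (perm_all _ pA) !all_cat => /and3P[_ P0 N0].
have cP x : count_mem x P <= m.
  by apply: leq_trans (mA x); rewrite (permP pA) !count_cat addnCA leq_addr.
have cN x : count_mem x N <= m.
  by apply: leq_trans (mA x); rewrite (permP pA) !count_cat addnA leq_addl.
have [f fP fw] := parts_of_seq du P0 cP.
have [g gN gw] := parts_of_seq du' N0 cN.
rewrite -fw -gw in PNa PNb; case: PNa => fa ga; case: PNb => h.
  (* Here [N] may be the heavy part; changing the sign of the dilation puts it first. *)
  exists (inr (- d^-1, t, (exist _ g ga, exist _ f h)))%R.
  rewrite /= opprK; apply: AE; apply: (perm_trans pA); rewrite tX perm_cat2l.
  by rewrite perm_catC; apply: perm_cat.
exists (inr (d^-1, t, (exist _ f fa, exist _ g h)))%R.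
rewrite /=; apply: AE; apply: (perm_trans pA); rewrite tX perm_cat2l.
by apply: perm_cat.
Qed.
End Counting.

(** * Asymptotics of the count *)

Lemma exists_near_power (n W : nat) : (0 < n)%N -> exists P0 : nat, forall p : nat, (P0 <= p)%N ->
  exists2 w : nat, (W <= w)%N & (w ^ n <= p <= 2 * w ^ n)%N.
Proof.
move=> n0; exists ((W + 2 * n) ^ n)%N => p Wp.
have ex : exists w, (w ^ n <= p)%N by exists (W + 2 * n)%N.
have bd w : (w ^ n <= p)%N -> (w <= p)%N.
  by apply: leq_trans; case: n n0 {Wp ex} => // n _; case: w => // w; rewrite expnS leq_pmulr ?expn_gt0.
(* For the largest [w] with [w^n <= p], one has [p < (w + 1)^n <= 2 w^n], as [w + 1 >= 2n]. *)
case: (ex_maxnP ex bd) => w wp wmax; have Ww := wmax _ Wp.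
exists w; first by apply: leq_trans Ww; rewrite leq_addr.
rewrite wp /=; apply: leq_trans (expn_succ_le2 _); last first.
  by apply: leq_trans (leqnSn _); apply: leq_trans Ww; rewrite leq_addl.
by rewrite leqNgt; apply/negP => /ltnW /wmax; rewrite ltnn.
Qed.

(** For large [w], [p + 1 <= 2^w <= exp w], so the exponent on the left is at most
    [w (w^j + 1) <= 2 w^(j + 1)]; then [2 <= e w] and [w^(j + 2) <= sqrt p]. *)
Lemma power_le_expR (R : realType) (j k : nat) (e : R) : (j.+2 <= k)%N -> 0 < e ->
  exists W : nat, forall w p : nat, (W <= w)%N -> (w ^ (2 * k) <= p <= 2 * w ^ (2 * k))%N ->
    p.+1%:R ^+ (w ^ j).+1 <= expR (e * Num.sqrt p%:R).
Proof.
move=> jk e0; have [W0 h0] := expn_lt_exp2 (2 * k).+1.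
exists (W0 + 3 + Num.bound (2 / e))%N => w p Ww /andP[wp pw].
have [W0w w3 we] : [/\ (W0 <= w)%N, (3 <= w)%N & (Num.bound (2 / e) <= w)%N].
  by move: Ww; clear; split; lia.
have w0 : (0 < w)%N by apply: leq_trans w3.
have p2 : (p.+1 <= 2 ^ w)%N.
  apply: leq_trans (h0 w W0w); rewrite expnS.
  have := expn_gt0 w (2 * k); rewrite w0 /=; move: (w ^ (2 * k))%N pw => q; clear -w3; nia.
have p3 : p.+1%:R <= expR w%:R :> R.
  apply: (@le_trans _ _ (2 ^+ w)); first by rewrite -natrX ler_nat.
  rewrite -[w%:R]mulr1 expRM_natl lerXn2r ?nnegrE ?expR_ge0 //.
  by have := expR_ge1Dx (1 : R).
apply: (@le_trans _ _ (expR w%:R ^+ (w ^ j).+1)).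
  by rewrite lerXn2r ?nnegrE ?expR_ge0.
rewrite -expRM_natl ler_expR.
have sp : (w ^ j.+2)%:R <= Num.sqrt p%:R :> R.
  rewrite -[leLHS](ger0_norm (ler0n R _)) -sqrtr_sqr ler_wsqrtr // -natrX ler_nat.
  apply: leq_trans wp; rewrite -expnM; apply: leq_pexp2l => //; lia.
have le2 : 2 <= e * w%:R.
  rewrite mulrC -ler_pdivrMr //; apply: (@le_trans _ _ (Num.bound (2 / e))%:R).
    by apply/ltW/archi_boundP; rewrite divr_ge0 // ltW.
  by rewrite ler_nat.
apply: (@le_trans _ _ (e * (w ^ j.+2)%:R)); last by rewrite ler_pM2l.
have wj : (1 : R) <= (w ^ j)%:R by rewrite ler1n expn_gt0 w0.
rewrite !expnS !natrM -natr1; have : 0 < w%:R :> R by rewrite ltr0n.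
move: (w%:R : R) ((w ^ j)%:R : R) le2 wj => a b le2 wj a0.
rewrite (_ : e * (a * (a * b)) = (e * a) * (a * b)); last by ring.
apply: (@le_trans _ _ (2 * (a * b))); last by rewrite ler_pM2r // mulr_gt0 //; lra.
by nra.
Qed.

Lemma N1_upper (R : realType) m (e : R) : (0 < m)%N -> 0 < e ->
  exists P0 : nat, forall p, (P0 <= p)%N -> prime p ->
    (N1 m p)%:R <= expR ((2 * Num.sqrt (Cm R m) + e) * Num.sqrt p%:R).
Proof.
move=> m0 e0; set c := 2 * Num.sqrt (Cm R m).
have c0 : 0 <= c by rewrite mulr_ge0 ?sqrtr_ge0.
have e4 : 0 < e / 4 by rewrite divr_gt0.
have [A A0 hA] := cnt_upper m0 e4.
(* With [D = 2 k^2] the two partitions have weight at most [(s (1 + 1 / k))^2] and [(s / k)^2],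
   where [s = sqrt p]. Their counts multiply to an exponent [(c + e / 4) (1 + 2 / k) s], and this
   [k] makes it at most [(c + e / 2) s]. *)
pose k := (Num.bound (8 * (c + e / 4) / e)).+2.
have kR : 0 < k%:R :> R by rewrite ltr0n.
have k2 : 2 <= k%:R :> R by rewrite (ler_nat _ 2).
have ke : (c + e / 4) * (1 + 2 / k%:R) <= c + e / 2.
  have : 8 * (c + e / 4) / e <= k%:R.
    apply: (@le_trans _ _ (Num.bound (8 * (c + e / 4) / e))%:R); last by rewrite ler_nat /k; lia.
    by apply/ltW/archi_boundP; rewrite divr_ge0 ?mulr_ge0 ?addr_ge0 // ltW.
  rewrite ler_pdivrMr // => h.
  have : 2 * (c + e / 4) / k%:R <= e / 4 by rewrite ler_pdivrMr //; lra.
  by move: (k%:R^-1 : R) => i; lra.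
have D3 : (3 < 2 * k ^ 2)%N by rewrite /k expnS expn1; lia.
have [W1 hW1] := zsf_structure R m0 D3.
have [W2 hW2] := power_le_expR (isT : 98.+2 <= 100)%N e4.
have [P0 hP0] := @exists_near_power 200 (W1 + W2) isT.
pose B := 2 * A + k%:R * A + 1.
exists (P0 + Num.bound (B ^+ 2))%N => p Pp p_pr.
have [P0p Bp] : (P0 <= p)%N /\ (Num.bound (B ^+ 2) <= p)%N by move: Pp; clear; split; lia.
have [w Ww wp] := hP0 p P0p.
have W1w : (W1 <= w)%N by apply: leq_trans Ww; rewrite leq_addr.
have W2w : (W2 <= w)%N by apply: leq_trans Ww; rewrite leq_addl.
set s := Num.sqrt p%:R.
have ss : s ^+ 2 = p%:R by rewrite sqr_sqrtr.
have B0 : 0 <= B by rewrite !addr_ge0 ?mulr_ge0 // ltW.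
have Bs : B <= s.
  rewrite -(ger0_norm B0) -sqrtr_sqr ler_wsqrtr //.
  apply: (@le_trans _ _ (Num.bound (B ^+ 2))%:R); last by rewrite ler_nat.
  by apply/ltW/archi_boundP; rewrite exprn_ge0.
have kA : 0 < k%:R * A by rewrite mulr_gt0.
have s0 : 0 < s by rewrite /B in Bs; lra.
have K0 : 2 * A * s <= p.-1%:R.
  have -> : p.-1%:R = s ^+ 2 - 1 :> R by rewrite ss -[in RHS](prednK (prime_gt0 p_pr)) -natr1 addrK.
  rewrite /B in Bs; nra.
have D0 : (0 < 2 * k ^ 2)%N by apply: leq_trans D3.
have pD : (2 * (p %/ (2 * k ^ 2)))%:R <= (s / k%:R) ^+ 2 :> R.
  rewrite expr_div_n ss ler_pdivlMr ?exprn_gt0 // -natrX -natrM ler_nat.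
  by rewrite mulnAC mulnC leq_divM.
have A1 : A <= s / k%:R by rewrite ler_pdivlMr //; rewrite /B in Bs; lra.
have k1 : k%:R^-1 <= 1 / 2 :> R by rewrite mul1r lef_pV2 ?posrE.
have sk : 0 < s / k%:R by rewrite divr_gt0.
have sks : s / k%:R <= s by rewrite ler_pdivrMr // ler_peMr ?(ltW s0) //; lra.
have As : 0 < A * s by rewrite mulr_gt0.
have Fb := hA (s / k%:R) p.-1 (2 * (p %/ (2 * k ^ 2)))%N A1 _ pD.
have {}Fb : (cnt p.-1 m (2 * (p %/ (2 * k ^ 2))))%:R <= expR ((c + e / 4) * (s / k%:R)).
  apply: Fb; apply: le_trans K0; have : A * (s / k%:R) <= A * s by rewrite ler_pM2l.
  by lra.
have Fa := hA (s * (1 + k%:R^-1)) p.-1 (p + 2 * (p %/ (2 * k ^ 2)))%N.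
have {}Fa : (cnt p.-1 m (p + 2 * (p %/ (2 * k ^ 2))))%:R <= expR ((c + e / 4) * (s * (1 + k%:R^-1))).
  apply: Fa.
  - by lra.
  - have : A * (s / k%:R) <= A * s by rewrite ler_pM2l.
    by lra.
  - have : 0 <= s * (s / k%:R) by rewrite mulr_ge0 // ltW.
    by rewrite natrD -ss; lra.
have := @N1_le p m p_pr (w ^ 98) _ _ (fun S zS mS => hW1 w p S W1w p_pr wp zS mS).
have := hW2 w p W2w wp; rewrite -/s.
move: (w ^ 98)%N => E pE NE.
pose Y := expR ((c + e / 2) * s).
have Y1 : 1 <= Y by rewrite -expR0 ler_expR mulr_ge0 ?addr_ge0 // ltW // divr_gt0.
have FF : (cnt p.-1 m (p + 2 * (p %/ (2 * k ^ 2))))%:R * (cnt p.-1 m (2 * (p %/ (2 * k ^ 2))))%:R <= Y.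
  apply: le_trans (ler_pM _ _ Fa Fb) _; rewrite ?ler0n // -expRD ler_expR.
  rewrite (_ : (c + e / 4) * (s * (1 + k%:R^-1)) + (c + e / 4) * (s / k%:R) = (c + e / 4) * (1 + 2 / k%:R) * s); last by (move: (k%:R^-1 : R) => z; ring).
  by rewrite ler_pM2r.
apply: (@le_trans _ _ (p.+1%:R ^+ E.+1 * Y)); last first.
  apply: (@le_trans _ _ (expR (e / 4 * s) * Y)); first by rewrite ler_pM2r ?expR_gt0.
  rewrite -expRD ler_expR -mulrDl ler_pM2r //; lra.
move: NE; rewrite -(ler_nat R) natrD !natrM natrX => /le_trans; apply.
have X0 : 0 < p.+1%:R ^+ E :> R by rewrite exprn_gt0 ?ltr0n.
have X1 := ler_wpM2l (ltW X0) FF.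
have X2 := ler_wpM2l (ltW X0) Y1.
have pp : 0 <= p%:R :> R by [].
have X3 := ler_wpM2l pp X1.
rewrite exprSr -natr1.
move: X2 X3; rewrite -natr1 mulr1; move: ((p%:R + 1) ^+ E : R) => q; lra.
Qed.

Lemma N1_lower (R : realType) m (e : R) : (0 < m)%N -> 0 < e ->
  exists P0 : nat, forall p, (P0 <= p)%N -> prime p ->
    expR ((2 * Num.sqrt (Cm R m) - e) * Num.sqrt p%:R) <= (N1 m p)%:R.
Proof.
move=> m0 e0; set c := 2 * Num.sqrt (Cm R m).
have c0 : 0 <= c by rewrite mulr_ge0 ?sqrtr_ge0.
have e2 : 0 < e / 2 by rewrite divr_gt0.
have [A A0 hA] := cnt_lower m0 e2.
pose B := A + 2 * c / e + 1.
have ce : 0 <= 2 * c / e by rewrite divr_ge0 ?mulr_ge0 // ltW.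
exists (Num.bound (B ^+ 2))%N => p Bp p_pr.
set s := Num.sqrt p%:R.
have ss : s ^+ 2 = p%:R by rewrite sqr_sqrtr.
have B0 : 0 <= B by rewrite !addr_ge0 // ltW.
have Bs : B <= s.
  rewrite -(ger0_norm B0) -sqrtr_sqr ler_wsqrtr //.
  apply: (@le_trans _ _ (Num.bound (B ^+ 2))%:R); last by rewrite ler_nat.
  by apply/ltW/archi_boundP; rewrite exprn_ge0.
have pE : p.-1%:R = s ^+ 2 - 1 :> R by rewrite ss -[in RHS](prednK (prime_gt0 p_pr)) -natr1 addrK.
have np : (p.-1 < p)%N by rewrite prednK // prime_gt0.
apply: (@le_trans _ _ (cnt p.-1 m p.-1)%:R); last by rewrite ler_nat cnt_le_N1.
(* [cnt_lower] is used at [x = s - 1], because [(s - 1)^2 <= s^2 - 1 = p - 1]; the loss is absorbed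
   by half of [e]. *)
rewrite /B in Bs; apply: le_trans (hA (s - 1) p.-1 p.-1 _ _ _); rewrite ?pE; try nra.
rewrite ler_expR -/c.
have : 2 * c / e <= s by lra.
rewrite ler_pdivrMr //; lra.
Qed.

Lemma two_sqrt_Cm (R : realType) m :
  2 * Num.sqrt (Cm R m) = Num.sqrt ((1 - 1 / m.+1%:R) * (2 / 3)) * pi.
Proof.
have pi0 : 0 <= pi :> R := pi_ge0 R.
have i1 : m.+1%:R^-1 <= 1 :> R by rewrite invf_le1 ?ler1n ?ltr0n.
rewrite -[2 in LHS](ger0_norm (ler0n R 2)) -sqrtr_sqr -sqrtrM ?exprn_ge0 //.
rewrite -[pi in RHS](ger0_norm pi0) -sqrtr_sqr -sqrtrM; last first.
  by rewrite mulr_ge0 // ?div1r ?subr_ge0.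
have : m.+1%:R != 0 :> R by rewrite pnatr_eq0.
by rewrite /Cm; move: (m.+1%:R : R) => a a0; congr Num.sqrt; field.
Qed.

Theorem theorem5p2 (R : realType) (m : nat) (hm : (0 < m)%N) :
  exists2 e : nat -> R, e @ \oo --> (0 : R) &
    \forall p \near \oo, prime p ->
      (N1 m p)%:R =
        expR ((Num.sqrt ((1 - 1 / m.+1%:R) * (2 / 3)) * pi + e p)
              * Num.sqrt p%:R) :> R.
Proof.
rewrite -two_sqrt_Cm; set c := 2 * _.
(* The exact error at primes, and [0] elsewhere so that it converges along all integers. The
   identity needs [N1 m p > 0], which the lower bound grants for large primes. *)
pose e p : R := if prime p then ln (N1 m p)%:R / Num.sqrt p%:R - c else 0.
exists e.
  apply/cvgrPdist_le => d d0.
  have [P1 h1] := N1_upper hm d0; have [P2 h2] := N1_lower hm d0.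
  exists (P1 + P2)%N => // p /= Pp; rewrite sub0r normrN /e.
  case: ifP => p_pr; last by rewrite normr0 ltW.
  have P1p : (P1 <= p)%N by move: Pp; clear; lia.
  have P2p : (P2 <= p)%N by move: Pp; clear; lia.
  have {}h1 := h1 p P1p p_pr; have {}h2 := h2 p P2p p_pr.
  have s0 : 0 < Num.sqrt p%:R :> R by rewrite sqrtr_gt0 ltr0n prime_gt0.
  have N0 : 0 < (N1 m p)%:R :> R by apply: lt_le_trans h2; rewrite expR_gt0.
  rewrite -[X in X <= _](lnK N0) ler_expR in h1; rewrite -[X in _ <= X](lnK N0) ler_expR in h2.
  rewrite ler_norml; apply/andP; split; first by rewrite lerBrDl ler_pdivlMr.
  by rewrite lerBlDl ler_pdivrMr.
have [P h] := N1_lower hm (ltr01 : (0 : R) < 1).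
exists P => // p /= Pp p_pr; rewrite /e p_pr.
have s0 : 0 < Num.sqrt p%:R :> R by rewrite sqrtr_gt0 ltr0n prime_gt0.
have N0 : 0 < (N1 m p)%:R :> R by apply: lt_le_trans (h p Pp p_pr); rewrite expR_gt0.
by rewrite addrC subrK divfK ?gt_eqF // lnK.
Qed.
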